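(* Let $Y$ be a Lévy process in $\mathbb{R}^d$ with generating triplet $(A,N,b)$ and with $h(0^+)=\infty$. Each of the following (mutually equivalent) conditions (C1)–(C4) is equivalent to (C5), where (C5) may be read with ''for some $m$'' or with ''for every $m$'' (both versions are equivalent to (C1)–(C4)). (C1) The density $p(t,x)$ of $Y_t$ exists and there are $T_1\in(0,\infty]$, $c_1>0$ such that $\sup_{x\in\mathbb{R}^d}p(t,x)\le c_1[h^{-1}(1/t)]^{-d}$ for all $0<t<T_1$. (C2) There are $T_2\in(0,\infty]$, $c_2>0$ such that $\int_{\mathbb{R}^d}e^{-t\,\mathrm{Re}[\Psi(z)]}dz\le c_2[h^{-1}(1/t)]^{-d}$ for all $0<t<T_2$. (C3) There are $T_3\in(0,\infty]$, $c_3\in(0,1]$, $\alpha_3\in(0,2]$ such that $c_3\Psi^*(|x|)\le \mathrm{Re}[\Psi(x)]$ for all $|x|>1/T_3$, and $\Psi^*(\lambda r)\ge c_3\lambda^{\alpha_3}\Psi^*(r)$ for all $\lambda\ge1$, $r>1/T_3$. (C4) There are $T_4\in(0,\infty]$, $c_4\in[1,\infty)$ such that $\Psi^*(|x|)\le c_4\big(\langle x,Ax\rangle+\int_{|\langle x,z\rangle|<1}|\langle x,z\rangle|^2N(dz)\big)$ for all $|x|>1/T_4$. (C5) There is $T_5\in(0,\infty]$ such that for some (every) $m\in\mathbb{N}$ there is $c_5>0$ such that for all $0<t<T_5$, $$\int_{\mathbb{R}^d}|z|^m e^{-t\,\mathrm{Re}[\Psi(z)]}\,dz\le c_5\,[h^{-1}(1/t)]^{-d-m}.$$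 Moreover, (C3) with constants $T_3,c_3,\alpha_3$ implies (C5) for every $m\in\mathbb{N}$ with $T_5=1/h(T_3)$ and a constant $c_5$ depending only on $d,m,\alpha_3,c_3$.
   Context: $Y=(Y_t)_{t\ge0}$ is a Lévy process in $\mathbb{R}^d$, $d\in\mathbb{N}$, with generating triplet $(A,N,b)$: $A$ is a symmetric non-negative definite $d\times d$ matrix, $b\in\mathbb{R}^d$, and $N$ is a Lévy measure (Borel measure with $N(\{0\})=0$, $\int(1\wedge|z|^2)N(dz)<\infty$). The characteristic exponent $\Psi$ is given by $\mathbb{E}e^{i\langle x,Y_t\rangle}=e^{-t\Psi(x)}$, $$\Psi(x)=\langle x,Ax\rangle-i\langle x,b\rangle-\int_{\mathbb{R}^d}\big(e^{i\langle x,z\rangle}-1-i\langle x,z\rangle\mathbf{1}_{|z|<1}\big)N(dz).$$ For $r>0$, $h(r)=r^{-2}\|A\|+\int_{\mathbb{R}^d}\big(1\wedge\frac{|x|^2}{r^2}\big)N(dx)$ and $\Psi^*(r)=\sup_{|z|\le r}\mathrm{Re}[\Psi(z)]$. Standing assumption: $h(0^+)=\infty$; then $h$ is a continuous strictly decreasing bijection of $(0,\infty)$ onto $(0,\infty)$ with inverse $h^{-1}$. Conventions: $1/\infty=0$, $h(\infty)=0$, $1/0=\infty$. $p(t,\cdot)$ is the density of the law of $Y_t$ with respect to Lebesgue measure (if $e^{-t\Psi}$ is integrable, it is the continuous one given by Fourier inversion). *)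

(* Defs.v *)
From HB Require Import structures.
From mathcomp Require Import all_boot all_order all_algebra.
From mathcomp Require Import all_classical all_reals all_analysis.
From mathcomp Require Import measurable_realfun complex.

Set Implicit Arguments.
Unset Strict Implicit.
Unset Printing Implicit Defensive.

Import Order.TTheory GRing.Theory Num.Theory.
Import numFieldNormedType.Exports.

Local Open Scope classical_set_scope.
Local Open Scope ring_scope.
Local Open Scope complex_scope.

(* Matrices, hence row vectors, carry their Borel sigma-algebra. *)
Section borel_matrix.
Variables (R : realType) (m n : nat).

HB.instance Definition _ := @isMeasurable.Build default_measure_display
  'M[R]_(m, n) <<s @open 'M[R]_(m, n) >>
  (@sigma_algebra0 _ setT _) (@sigma_algebraC _ _)
  (@sigma_algebra_bigcup _ setT _).

End borel_matrix.

Section borel_rV.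
Variable R : realType.

Lemma measurable_coord n (i : 'I_n) :
  measurable_fun [set: 'rV[R]_n] (fun v : 'rV[R]_n => v 0 i).
Proof.
apply: (measurability _ (RGenOpens.measurableE R)) => _ [_ [a [b ->]] <-].
rewrite setTI; apply: sub_sigma_algebra.
apply: open_comp => [x _|]; last exact: interval_open.
exact: coord_continuous.
Qed.

Lemma measurable_fun_rV d (T : measurableType d) n (f : T -> 'rV[R]_n) :
  (forall i, measurable_fun [set: T] (fun x => f x 0 i)) ->
  measurable_fun [set: T] f.
Proof.
move=> mf; apply: (measurability (@open 'rV[R]_n)) => //.
move=> _ [U oU <-]; rewrite setTI.
pose c (k : 'rV[rat]_n * rat) : 'rV[R]_n := map_mx ratr k.1.
pose B k := ball (c k) (ratr k.2).
pose D := [set k | B k `<=` U].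
have -> : f @^-1` U = \bigcup_(k in D) (f @^-1` (B k)).
  apply/seteqP; split=> [x Ux|x [k kD]]; last exact: kD.
  have : nbhs (f x) U by exact: open_nbhs_nbhs.
  move=> /nbhs_ballP[e /= e0 eU].
  have [r re] : exists r : rat, ratr r \in `]0, (e / 2)[%R.
    by apply: rat_in_itvoo; rewrite divr_gt0.
  move: re; rewrite in_itv /= => /andP[r0 re].
  have hq i : exists q : rat, ratr q \in `](f x 0 i - ratr r), (f x 0 i + ratr r)[%R.
    by apply: rat_in_itvoo; rewrite ltrD2l gtrN.
  pose q : 'rV[rat]_n := \row_i xchoose (hq i).
  have Bx : B (q, r) (f x).
    split=> // i j; rewrite ord1 !mxE /ball /= distrC.
    by have := xchooseP (hq j); rewrite in_itv /= ltr_distlC.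
  exists (q, r) => // y By; apply: eU.
  rewrite (splitr e); apply: (@ball_triangle _ _ (c (q, r))).
    by apply: ball_sym; apply: le_ball Bx; exact: ltW.
  by apply: le_ball By; exact: ltW.
rewrite bigcup_mkcond; apply: countable_bigcupT_measurable => // k.
case: ifPn => // _.
have [r0|r0] := ltP 0 (ratr k.2 : R); last first.
  rewrite (_ : _ @^-1` _ = set0) // -subset0 => x [] /=.
  by rewrite ltNge r0.
have -> : f @^-1` B k = \bigcap_(i in [set: 'I_n])
    ((fun x => f x 0 i) @^-1` (ball (c k 0 i) (ratr k.2))).
  apply/seteqP; split=> [x [_ h] i _|x h]; first exact: h.
  by split=> // i j; rewrite ord1; exact: h.
apply: fin_bigcap_measurable => // i _.
rewrite -[X in measurable X]setTI; apply: mf => //.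
exact: measurable_ball.
Qed.

End borel_rV.

Section lebesgue_rV.
Variable R : realType.
Implicit Type n : nat.

Definition rV_cons n (p : R * 'rV[R]_n) : 'rV[R]_n.+1 := row_mx p.1%:M p.2.

Lemma measurable_rV_cons n :
  measurable_fun [set: measurableTypeR R * 'rV[R]_n] (@rV_cons n).
Proof.
apply: measurable_fun_rV => i.
case: (@split_ordP 1 n i) => j ->.
  under eq_fun do rewrite (@row_mxEl _ 1 1 n) mxE ord1.
  exact: measurable_fst.
under eq_fun do rewrite (@row_mxEr _ 1 1 n).
exact: (measurableT_comp (measurable_coord j) measurable_snd).
Qed.

Definition rV_uncons n (v : 'rV[R]_n.+1) : R * 'rV[R]_n :=
  (v 0 0, \row_j v 0 (lift ord0 j)).

Lemma rV_consK n : cancel (@rV_cons n) (@rV_uncons n).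
Proof.
move=> [x v]; congr pair => /=.
  rewrite (_ : 0 = lshift n (0 : 'I_1)); last exact/val_inj.
  by rewrite (@row_mxEl _ 1 1 n) mxE.
apply/rowP => j; rewrite mxE (_ : lift ord0 j = rshift 1 j); last exact/val_inj.
by rewrite (@row_mxEr _ 1 1 n).
Qed.

Lemma measurable_rV_uncons n :
  measurable_fun [set: 'rV[R]_n.+1]
    (@rV_uncons n : 'rV[R]_n.+1 -> measurableTypeR R * 'rV[R]_n).
Proof.
apply: measurable_fun_pair; first exact: measurable_coord.
apply: measurable_fun_rV => j; under eq_fun do rewrite mxE.
exact: measurable_coord.
Qed.

Section step.
Variables (n : nat) (mu : {sigma_finite_measure set 'rV[R]_n -> \bar R}).

Definition lebesgue_rV_step : set 'rV[R]_n.+1 -> \bar R :=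
  pushforward (@lebesgue_measure R \x mu)%E (@rV_cons n).

Let mcons := @measurable_rV_cons n.

Let step0 : lebesgue_rV_step set0 = 0%E.
Proof. by rewrite /lebesgue_rV_step /pushforward preimage_set0 measure0. Qed.

Let step_ge0 A : (0 <= lebesgue_rV_step A)%E.
Proof. exact: measure_ge0. Qed.

Let step_sigma_additive : semi_sigma_additive lebesgue_rV_step.
Proof. exact: measure_semi_sigma_additive. Qed.

HB.instance Definition _ := isMeasure.Build _ _ _ lebesgue_rV_step
  step0 step_ge0 step_sigma_additive.

Let step_sigma_finite : sigma_finite setT lebesgue_rV_step.
Proof.
have /sigma_finiteP[F [FT ndF Ffin]] := sigma_finiteT (@lebesgue_measure R).
have /sigma_finiteP[G [GT ndG Gfin]] := sigma_finiteT mu.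
exists (fun k => @rV_uncons n @^-1` (F k `*` G k)).
  apply/seteqP; split=> // v _.
  have [k _ Fk] : (\bigcup_k F k) (rV_uncons v).1 by rewrite -FT.
  have [l _ Gl] : (\bigcup_k G k) (rV_uncons v).2 by rewrite -GT.
  exists (maxn k l) => //; split.
    by move: Fk; exact/subsetPset/ndF/leq_maxl.
  by move: Gl; exact/subsetPset/ndG/leq_maxr.
move=> k; have [mF muF] := Ffin k; have [mG muG] := Gfin k.
have mFG : measurable (F k `*` G k) by exact: measurableX.
split; first by rewrite -[X in measurable X]setTI; exact: measurable_rV_uncons.
rewrite /lebesgue_rV_step /pushforward.
have -> : @rV_cons n @^-1` (@rV_uncons n @^-1` (F k `*` G k)) = F k `*` G k.
  by rewrite -comp_preimage (_ : _ \o _ = id) //; exact/funext/rV_consK.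
rewrite product_measure1E//.
by rewrite lte_mul_pinfty// ge0_fin_numE.
Qed.

HB.instance Definition _ := Measure_isSigmaFinite.Build _ _ _ lebesgue_rV_step
  step_sigma_finite.

End step.

(* d-dimensional Lebesgue measure, as an iterated product; see lebesgue_rV_box. *)
Fixpoint lebesgue_rV n : {sigma_finite_measure set 'rV[R]_n -> \bar R} :=
  if n is k.+1 then lebesgue_rV_step (lebesgue_rV k) else \d_(0 : 'rV[R]_0).

End lebesgue_rV.

Lemma lebesgue_rV_box (R : realType) n (B : 'I_n -> set R) :
  (forall i, measurable (B i)) ->
  lebesgue_rV R n [set v | forall i, B i (v 0 i)] =
    (\prod_(i < n) lebesgue_measure (B i))%E.
Proof.
elim: n B => [|n IHn] B mB.
  by rewrite big_ord0 /= diracE mem_set// => -[].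
rewrite big_ord_recl -IHn; last by move=> i; exact: mB.
have mbox : measurable [set v : 'rV[R]_n | forall i, B (lift ord0 i) (v 0 i)].
  have -> : [set v : 'rV[R]_n | forall i, B (lift ord0 i) (v 0 i)] =
      \bigcap_(i in [set: 'I_n])
        ((fun v : 'rV[R]_n => v 0 i) @^-1` B (lift ord0 i)).
    by apply/seteqP; split=> [v h i _|v h i]; [exact: h|exact: (h i)].
  apply: fin_bigcap_measurable => // i _.
  by rewrite -[X in measurable X]setTI; apply: measurable_coord.
rewrite -product_measure1E//; last exact: mB.
congr (product_measure1 _ _ _).
apply/seteqP; split=> -[x v].
  move=> h; have e := rV_consK (x, v); split.
    by have := h ord0; rewrite -[v]/((x, v).2) -[x]/((x, v).1) -{-1}e.
  by move=> i /=; have := h (lift ord0 i); rewrite -[v]/((x, v).2) -{-1}e /= mxE.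
move=> [/= h0 h1] i; have [hx hv] := rV_consK (x, v).
have [j ->|->] := unliftP ord0 i; last by move: h0; rewrite -{1}hx.
by have := h1 j; rewrite -{1}hv mxE.
Qed.

Section euclidean.
Variables (R : realType) (d : nat).

Definition dotv (x y : 'rV[R]_d) : R := \sum_(i < d) x 0 i * y 0 i.

(* The library norm on matrices is the sup norm. *)
Definition enorm (x : 'rV[R]_d) : R := Num.sqrt (dotv x x).

(* Vectors are rows, so A x is encoded as x *m A^T. *)
Definition mxapp (A : 'M[R]_d) (x : 'rV[R]_d) : 'rV[R]_d := x *m A^T.

Definition opnorm (A : 'M[R]_d) : R :=
  sup [set enorm (mxapp A x) | x in [set x | enorm x <= 1]].

End euclidean.

Section complex_valued.
Variable R : realType.

Definition cexp (z : R[i]) : R[i] :=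
  (expR (complex.Re z))%:C * (cos (complex.Im z) +i* sin (complex.Im z)).

Context {disp : measure_display} {T : measurableType disp}.
Implicit Types (mu : {measure set T -> \bar R}) (f : T -> R[i]).

Definition cintegrable mu f : Prop :=
  mu.-integrable setT (fun x => (complex.Re (f x))%:E) /\
  mu.-integrable setT (fun x => (complex.Im (f x))%:E).

Definition cintegral mu f : R[i] :=
  (\int[mu]_x complex.Re (f x)) +i* (\int[mu]_x complex.Im (f x)).

End complex_valued.

Section levy_triplet.
Variables (R : realType) (d : nat).
Variables (A : 'M[R]_d) (N : {measure set 'rV[R]_d -> \bar R}) (b : 'rV[R]_d).

Definition levy_measure : Prop :=
  N [set 0] = 0%E /\
  (\int[N]_z (Num.min 1 (enorm z ^+ 2))%:E < +oo)%E.

Definition generating_triplet : Prop :=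
  [/\ A^T = A, forall x, 0 <= dotv x (mxapp A x) & levy_measure].

Definition Psi (x : 'rV[R]_d) : R[i] :=
  (dotv x (mxapp A x))%:C - 'i%C * (dotv x b)%:C
  - cintegral N (fun z => cexp ('i%C * (dotv x z)%:C) - 1
                   - 'i%C * (dotv x z * \1_[set z | enorm z < 1] z)%:C).

Definition Psi_star (r : R) : R :=
  sup [set complex.Re (Psi z) | z in [set z | enorm z <= r]].

Definition hfun (r : R) : R :=
  r ^- 2 * opnorm A + \int[N]_x Num.min 1 (enorm x ^+ 2 / r ^+ 2).

(* h on (0, oo], with h(oo) = 0. *)
Definition hfun_ext (r : \bar R) : \bar R :=
  if r is s%:E then (hfun s)%:E else 0%E.

(* h is a bijection of (0, oo) when h(0+) = oo; h_inv is its inverse. *)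
Definition h_inv (u : R) : R := xget 0 [set r | 0 < r /\ hfun r = u].

End levy_triplet.

Section levy_process.
Variables (R : realType) (d : nat) (disp : measure_display).
Variables (T : measurableType disp) (P : probability T R).
(* Only the values Y t with 0 <= t are constrained or used. *)
Variable Y : R -> {RV P >-> 'rV[R]_d}.

Definition increment (s t : R) (w : T) : 'rV[R]_d := (Y t w : 'rV[R]_d) - Y s w.

Definition independent_increments : Prop :=
  forall (n : nat) (t : nat -> R) (B : nat -> set 'rV[R]_d),
    0 <= t 0%N -> (forall k, t k <= t k.+1) -> (forall k, measurable (B k)) ->
    P (\bigcap_(k < n) (increment (t k) (t k.+1) @^-1` B k)) =
    (\prod_(k < n) P (increment (t k) (t k.+1) @^-1` B k))%E.

Definition stationary_increments : Prop :=
  forall (s t : R) (B : set 'rV[R]_d),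
    0 <= s -> 0 <= t -> measurable B ->
    P (increment s (s + t) @^-1` B) = P (increment 0 t @^-1` B).

Definition stochastically_continuous : Prop :=
  forall t e : R, 0 <= t -> 0 < e ->
    P [set w | e < enorm (increment t s w)]
      @[s --> within [set s | 0 <= s] (nbhs t)] --> 0%E.

Definition cadlag_paths : Prop :=
  {ae P, forall w, forall t : R, 0 <= t ->
    Y s w @[s --> t^'+] --> (Y t w : 'rV[R]_d) /\
    (0 < t -> cvg (Y s w @[s --> t^'-]))}.

Definition levy_process : Prop :=
  [/\ {ae P, forall w, Y 0 w = 0}, independent_increments,
      stationary_increments, stochastically_continuous & cadlag_paths].

Definition levy_process_with_triplet (A : 'M[R]_d)
    (N : {measure set 'rV[R]_d -> \bar R}) (b : 'rV[R]_d) : Prop :=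
  [/\ levy_process, generating_triplet A N &
    forall (t : R) (x : 'rV[R]_d), 0 <= t ->
      cintegral P (fun w => cexp ('i%C * (dotv x (Y t w))%:C)) =
      cexp (- (t%:C * Psi A N b x))].

(* A density of Y_t; it is the one given by Fourier inversion whenever
   e^{-t Psi} is integrable, otherwise any version may be chosen. *)
Definition density_at (A : 'M[R]_d) (N : {measure set 'rV[R]_d -> \bar R})
    (b : 'rV[R]_d) (t : R) (p : 'rV[R]_d -> R) : Prop :=
  [/\ measurable_fun setT p,
      forall x, 0 <= p x,
      forall B : set 'rV[R]_d, measurable B ->
        distribution P (Y t) B = (\int[lebesgue_rV R d]_(x in B) (p x)%:E)%E &
      cintegrable (lebesgue_rV R d) (fun z => cexp (- (t%:C * Psi A N b z))) ->
      forall x, (p x)%:C = ((2 * pi) ^- d)%:C *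
        cintegral (lebesgue_rV R d) (fun z =>
          cexp (- ('i%C * (dotv x z)%:C)) * cexp (- (t%:C * Psi A N b z)))].

End levy_process.

Section conditions.
Variables (R : realType) (d : nat).
Variables (A : 'M[R]_d) (N : {measure set 'rV[R]_d -> \bar R}) (b : 'rV[R]_d).

Local Notation rePsi z := (complex.Re (Psi A N b z)).
Local Notation Psis := (Psi_star A N b).
Local Notation hinv := (h_inv A N).

Definition C1 (disp : measure_display) (T : measurableType disp)
    (P : probability T R) (Y : R -> {RV P >-> 'rV[R]_d}) : Prop :=
  exists p : R -> 'rV[R]_d -> R,
    (forall t : R, 0 < t -> density_at Y A N b t (p t)) /\
    exists (T1 : \bar R) (c1 : R), [/\ (0 < T1)%E, 0 < c1 &
      forall t : R, 0 < t -> (t%:E < T1)%E ->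
        (ereal_sup [set (p t x)%:E | x in setT]
           <= (c1 * hinv (t^-1) ^- d)%:E)%E].

Definition C2 : Prop :=
  exists (T2 : \bar R) (c2 : R), [/\ (0 < T2)%E, 0 < c2 &
    forall t : R, 0 < t -> (t%:E < T2)%E ->
      (\int[lebesgue_rV R d]_z (expR (- (t * rePsi z)))%:E
         <= (c2 * hinv (t^-1) ^- d)%:E)%E].

Definition C3_with (T3 : \bar R) (c3 alpha3 : R) : Prop :=
  [/\ (0 < T3)%E, 0 < c3 <= 1, 0 < alpha3 <= 2,
      forall x : 'rV[R]_d, (T3^-1 < (enorm x)%:E)%E ->
        c3 * Psis (enorm x) <= rePsi x &
      forall lambda r : R, 1 <= lambda -> (T3^-1 < r%:E)%E ->
        c3 * lambda `^ alpha3 * Psis r <= Psis (lambda * r)].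

Definition C3 : Prop := exists T3 c3 alpha3, C3_with T3 c3 alpha3.

Definition C4 : Prop :=
  exists (T4 : \bar R) (c4 : R), [/\ (0 < T4)%E, 1 <= c4 &
    forall x : 'rV[R]_d, (T4^-1 < (enorm x)%:E)%E ->
      Psis (enorm x) <= c4 * (dotv x (mxapp A x)
        + \int[N]_(z in [set z | `|dotv x z| < 1]) (`|dotv x z| ^+ 2))].

Definition C5_with (T5 : \bar R) (m : nat) (c5 : R) : Prop :=
  forall t : R, 0 < t -> (t%:E < T5)%E ->
    (\int[lebesgue_rV R d]_z (enorm z ^+ m * expR (- (t * rePsi z)))%:E
       <= (c5 * hinv (t^-1) ^- (d + m))%:E)%E.

(* m ranges over the positive integers. *)
Definition C5_some : Prop :=
  exists2 T5 : \bar R, (0 < T5)%E &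
    exists2 m : nat, (0 < m)%N & exists2 c5, 0 < c5 & C5_with T5 m c5.

Definition C5_every : Prop :=
  exists2 T5 : \bar R, (0 < T5)%E &
    forall m : nat, (0 < m)%N -> exists2 c5, 0 < c5 & C5_with T5 m c5.

End conditions.

(* Main.v *)
Require Import Defs.
From HB Require Import structures.
From mathcomp Require Import all_boot all_order all_algebra.
From mathcomp Require Import all_classical all_reals all_analysis.
From mathcomp Require Import measurable_realfun complex ring lra zify.

Set Implicit Arguments.
Unset Strict Implicit.
Unset Printing Implicit Defensive.

Import Order.TTheory GRing.Theory Num.Theory.
Import numFieldNormedType.Exports.

Local Open Scope classical_set_scope.
Local Open Scope ring_scope.

(* Write psi = Re Psi and rho = 1 / h^{-1}(1/t).  Averaging 1 - cos <x, z> over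
   multiples of the coordinate vectors shows that Psi^*(1/r) and h(r) are
   comparable, with constants depending on d only.

   (C3) gives t psi(z) >= k (|z| / rho)^alpha for |z| >= rho, so that
   |z|^m e^{-t psi(z)} is dominated by rho^{m+d} times a product of Cauchy
   kernels of scale rho: this is (C5) for every m.  Splitting at |z| = rho
   leads from (C5) back to (C2).

   (C3) and (C4) are compared through s |-> <sx, A sx> + int 1 /\ <sx, z>^2 N(dz),
   whose increment between s = 1 and s = lambda is controlled above and below
   by the truncated second moment of (C4).

   The mere bound int e^{-2 t psi} <= c h^{-1}(1/t)^{-d} already implies (C3).
   Subadditivity of psi^{1/2} makes psi small on balls around all multiples kx
   if psi(x) is small, and the integral over many such disjoint balls would be
   too large; the integral over a single large ball makes Psi^* grow.  That
   bound follows from (C2) trivially, and from (C1) because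
   |E e^{i<z, Y_t>}|^2 = e^{-2 t psi(z)} integrates to at most (2 pi)^d sup p.

   Finally (C2) makes the characteristic function integrable, and Fourier
   inversion, regularised by e^{-eps |z|_1} whose transform is a product of
   Cauchy kernels, provides the bounded density of (C1). *)

(** * Euclidean space *)

(** The measure N has nothing but a moment condition, and no double integral against it is ever
    exchanged. The averages that bound h by [Psi_star] are therefore finite sums over the multiples
    j/n of a vector, and psi is seen to be measurable through the characteristic function of Y_1. On
    the Fourier side everything is real: a phase th in cos(<z, y - x> + th) selects the real or the
    imaginary part, and 1 + cos is nonnegative, so that Tonelli applies where cos alone would need
    integrability first. Cubes replace Euclidean balls wherever a volume is computed. The triplet
    enters the explicit constant of (C5) only through the comparison of h with [Psi_star], whose
    constant [cPsi] depends on d alone; this makes c5 uniform over all processes with the same c3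
    and alpha3. *)

Section euclidean_space.
Variables (R : realType) (d : nat).
Implicit Types x y z : 'rV[R]_d.

Lemma dotvC x y : dotv x y = dotv y x.
Proof. by apply: eq_bigr => i _; rewrite mulrC. Qed.

Lemma dotvDr x y z : dotv x (y + z) = dotv x y + dotv x z.
Proof.
by rewrite /dotv -big_split; apply: eq_bigr => i _; rewrite mxE mulrDr.
Qed.

Lemma dotvZr a x y : dotv x (a *: y) = a * dotv x y.
Proof.
by rewrite /dotv mulr_sumr; apply: eq_bigr => i _; rewrite mxE mulrCA.
Qed.

Lemma dotvNr x y : dotv x (- y) = - dotv x y.
Proof. by rewrite -scaleN1r dotvZr mulN1r. Qed.

Lemma dotvBr x y z : dotv x (y - z) = dotv x y - dotv x z.
Proof. by rewrite dotvDr dotvNr. Qed.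

Lemma dotvDl x y z : dotv (x + y) z = dotv x z + dotv y z.
Proof. by rewrite dotvC dotvDr !(dotvC z). Qed.

Lemma dotvZl a x y : dotv (a *: x) y = a * dotv x y.
Proof. by rewrite dotvC dotvZr dotvC. Qed.

Lemma dotv0 x : dotv x 0 = 0.
Proof. by rewrite -[0](scale0r x) dotvZr mul0r. Qed.

Lemma dotv_ge0 x : 0 <= dotv x x.
Proof. by apply: sumr_ge0 => i _; rewrite -expr2 sqr_ge0. Qed.

Lemma enorm_ge0 x : 0 <= enorm x. Proof. exact: sqrtr_ge0. Qed.

Lemma sqr_enorm x : enorm x ^+ 2 = dotv x x.
Proof. by rewrite /enorm sqr_sqrtr// dotv_ge0. Qed.

Lemma enormZ a x : enorm (a *: x) = `|a| * enorm x.
Proof.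
by rewrite /enorm dotvZl dotvZr mulrA -expr2 sqrtrM ?sqr_ge0// sqrtr_sqr.
Qed.

Lemma enormN x : enorm (- x) = enorm x.
Proof. by rewrite -scaleN1r enormZ normrN1 mul1r. Qed.

Lemma enorm0 : enorm (0 : 'rV[R]_d) = 0.
Proof. by rewrite /enorm dotv0 sqrtr0. Qed.

Lemma enorm_eq0 x : enorm x = 0 -> x = 0.
Proof.
move=> x0; have : dotv x x = 0 by rewrite -sqr_enorm x0 expr0n.
move=> /psumr_eq0P xi0; apply/rowP => i; rewrite mxE.
have := xi0 (fun i _ => sqr_ge0 (x 0 i)) i erefl.
by move=> /eqP; rewrite mulf_eq0 orbb => /eqP.
Qed.

Lemma CauchySchwarz_dotv x y : `|dotv x y| <= enorm x * enorm y.
Proof.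
have [x0|x0] := eqVneq (dotv x x) 0.
  have -> : x = 0 by apply: enorm_eq0; rewrite /enorm x0 sqrtr0.
  by rewrite dotvC dotv0 normr0 enorm0 mul0r.
have xx : 0 < dotv x x by rewrite lt_def x0 dotv_ge0.
rewrite -(@ler_pXn2r _ 2)// ?nnegrE ?mulr_ge0 ?enorm_ge0//.
rewrite real_normK ?num_real// exprMn !sqr_enorm.
(* The component of y orthogonal to x, multiplied by <x, x> to avoid a division. *)
have := dotv_ge0 (dotv x x *: y - dotv x y *: x).
rewrite dotvBr !dotvZr ![dotv (_ - _) _]dotvC !dotvBr !dotvZr ?(dotvC y x).
have -> : dotv x x * (dotv x x * dotv y y - dotv x y * dotv x y) -
   dotv x y * (dotv x x * dotv x y - dotv x y * dotv x x) =
   dotv x x * (dotv x x * dotv y y - dotv x y ^+ 2) by ring.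
by rewrite pmulr_rge0// subr_ge0.
Qed.

Lemma ler_enormD x y : enorm (x + y) <= enorm x + enorm y.
Proof.
rewrite -(@ler_pXn2r _ 2)// ?nnegrE ?addr_ge0 ?enorm_ge0//.
rewrite sqr_enorm dotvDl !dotvDr (dotvC y x) sqrrD !sqr_enorm.
have := CauchySchwarz_dotv x y; have := ler_norm (dotv x y); lra.
Qed.

Lemma coord_le_enorm x i : `|x 0 i| <= enorm x.
Proof.
rewrite -(@ler_pXn2r _ 2)// ?nnegrE ?enorm_ge0// real_normK ?num_real//.
rewrite sqr_enorm /dotv (bigD1 i)//= -expr2 lerDl.
by apply: sumr_ge0 => j _; rewrite -expr2 sqr_ge0.
Qed.

Lemma enorm_le_coords x c : (forall i, `|x 0 i| <= c) -> enorm x <= d%:R * c.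
Proof.
(* In dimension 0 the hypothesis says nothing on the sign of c, but both sides vanish. *)
move=> xc; have [i0 _|no] := pickP (fun _ : 'I_d => true); last first.
  have -> : x = 0 by apply/rowP => i; have := no i.
  by rewrite enorm0 -(card_ord d) (eq_card0 no) mul0r.
have c0 : 0 <= c by exact: le_trans (xc i0).
have d0 : (0 < d)%N by exact: leq_ltn_trans (ltn_ord i0).
rewrite -(@ler_pXn2r _ 2)// ?nnegrE ?enorm_ge0 ?mulr_ge0// sqr_enorm.
apply: (@le_trans _ _ (\sum_(i < d) c ^+ 2)).
  apply: ler_sum => i _; rewrite -expr2 -(real_normK (num_real (x 0 i))).
  by rewrite ler_pXn2r// nnegrE.
rewrite sumr_const card_ord -[_ ^+ 2 *+ d]mulr_natl exprMn ler_wpM2r ?sqr_ge0//.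
by rewrite expr2 ler_peMl// ler1n.
Qed.

Definition unitv (i : 'I_d) : 'rV[R]_d := delta_mx 0 i.

Lemma dotv_unitv i x : dotv (unitv i) x = x 0 i.
Proof.
rewrite /dotv (bigD1 i)//= mxE !eqxx mul1r big1 ?addr0// => j /negPf ji.
by rewrite mxE ji andbF mul0r.
Qed.

Lemma enorm_unitv i : enorm (unitv i) = 1.
Proof. by rewrite /enorm dotv_unitv mxE !eqxx sqrtr1. Qed.

Lemma measurable_dotv x : measurable_fun [set: 'rV[R]_d] (dotv x).
Proof.
apply: measurable_sum => i; apply: measurable_funM => //.
exact: measurable_coord.
Qed.

Lemma measurable_enorm : measurable_fun [set: 'rV[R]_d] (@enorm R d).
Proof.
apply: (measurableT_comp (continuous_measurable_fun (@sqrt_continuous R))).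
by apply: measurable_sum => i; apply: measurable_funM; exact: measurable_coord.
Qed.

Lemma measurable_dotv2 d1 (T : measurableType d1) (f g : T -> 'rV[R]_d) :
  measurable_fun setT f -> measurable_fun setT g ->
  measurable_fun setT (fun w => dotv (f w) (g w)).
Proof.
move=> mf mg; apply: measurable_sum => i.
by apply: measurable_funM; apply: (measurableT_comp (measurable_coord i)).
Qed.

Lemma measurable_rVB d1 (T : measurableType d1) (f g : T -> 'rV[R]_d) :
  measurable_fun setT f -> measurable_fun setT g ->
  measurable_fun setT (fun w => f w - g w).
Proof.
move=> mf mg; apply: measurable_fun_rV => i.
under eq_fun do rewrite !mxE.
by apply: measurable_funB; apply: (measurableT_comp (measurable_coord i)).
Qed.

(** Balls of the sup norm: their volume is explicit, and up to a factor d in the radius they are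
    Euclidean balls. *)
Definition cube x (rho : R) : set 'rV[R]_d :=
  [set v | forall i, `[x 0 i - rho, x 0 i + rho]%classic (v 0 i)].

Lemma measurable_boxes (B : 'I_d -> set R) : (forall i, measurable (B i)) ->
  measurable [set v : 'rV[R]_d | forall i, B i (v 0 i)].
Proof.
move=> mB.
have -> : [set v : 'rV[R]_d | forall i, B i (v 0 i)] =
    \bigcap_(i in [set: 'I_d]) ((fun v : 'rV[R]_d => v 0 i) @^-1` B i).
  by apply/seteqP; split=> [v h i _|v h i]; [exact: h|exact: (h i)].
apply: fin_bigcap_measurable => // i _.
by rewrite -[X in measurable X]setTI; apply: measurable_coord.
Qed.

Lemma measurable_cube x rho : measurable (cube x rho).
Proof.
by apply: (@measurable_boxes (fun i => `[x 0 i - rho, x 0 i + rho]%classic)).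
Qed.

Lemma lebesgue_cube x rho : 0 <= rho ->
  lebesgue_rV R d (cube x rho) = ((2 * rho) ^+ d)%:E.
Proof.
move=> r0.
rewrite (@lebesgue_rV_box R d (fun i => `[x 0 i - rho, x 0 i + rho]%classic))//.
under eq_bigr do rewrite lebesgue_measure_itv/= lte_fin.
transitivity (\prod_(i < d) (2 * rho)%:E)%E.
  apply: eq_bigr => i _; case: ifPn => [_|].
    by rewrite -EFinD; congr EFin; ring.
  rewrite -leNgt => h; congr EFin; lra.
by rewrite -(big_morph EFin (@EFinM _) erefl) prodr_const card_ord.
Qed.

Lemma enorm_ball_cube x rho : enorm x <= rho -> cube 0 rho x.
Proof.
move=> xr i; rewrite /= in_itv/= mxE sub0r add0r -ler_norml.
exact: le_trans (coord_le_enorm _ _) xr.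
Qed.

Lemma cube_enorm_ball x rho v : cube x rho v -> enorm (v - x) <= d%:R * rho.
Proof.
move=> h; apply: enorm_le_coords => i; rewrite !mxE ler_norml.
by have := h i; rewrite /= in_itv/= => /andP[? ?]; apply/andP; split; lra.
Qed.

End euclidean_space.

(** * Characteristic exponent and concentration function *)

Section trigonometric_bounds.
Variable R : realType.
Implicit Types u v : R.

Lemma oneBcos v : 1 - cos v = 2 * sin (v / 2) ^+ 2.
Proof.
have := cosD (v / 2) (v / 2); rewrite -splitr => ->.
by have := cos2Dsin2 (v / 2); set s := sin _; set c := cos _ => h; nra.
Qed.

Lemma oneBcos_ge0 v : 0 <= 1 - cos v.
Proof. by rewrite subr_ge0 cos_le1. Qed.

Lemma normr_sin_le v : `|sin v| <= `|v|.
Proof.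
have pos (w : R) : 0 <= w -> `|sin w| <= w.
  move=> w0.
  have [|c cw] := @MVT_segment _ (@sin R) (@cos R) 0 w w0.
    exact/continuous_subspaceT/continuous_sin.
  rewrite sin0 !subr0 => ->; rewrite normrM (ger0_norm w0) ler_piMl//.
  exact: cos_max.
have [v0|v0] := leP 0 v; first by rewrite (ger0_norm v0) pos.
have nv : 0 <= - v by lra.
by rewrite -normrN -sinN -[leRHS]normrN (ger0_norm nv) pos.
Qed.

Lemma oneBcos_le_sqr v : 1 - cos v <= v ^+ 2 / 2.
Proof.
rewrite oneBcos; have := normr_sin_le (v / 2).
rewrite -(@ler_pXn2r _ 2)// ?nnegrE// !real_normK ?num_real//; nra.
Qed.

(** By the mean value theorem sin w >= w / 2 on [0, 1], because cos >= 1/2 there; apply this at w =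
    |v| / 2 in 1 - cos v = 2 sin^2(v / 2). *)
Lemma oneBcos_ge_sqr v : `|v| <= 2 -> v ^+ 2 / 8 <= 1 - cos v.
Proof.
have pos (w : R) : 0 <= w <= 1 -> w / 2 <= sin w.
  move=> /andP[w0 w1].
  have [|c] := @MVT_segment _ (@sin R) (@cos R) 0 w w0.
    exact/continuous_subspaceT/continuous_sin.
  rewrite in_itv/= sin0 !subr0 => /andP[c0 cw] ->; rewrite mulrC.
  rewrite ler_wpM2r//; have := oneBcos_le_sqr c.
  have : c ^+ 2 <= 1 by rewrite expr_le1//; lra.
  lra.
rewrite -cos_norm -(real_normK (num_real v)); move: `|v| (normr_ge0 v) => w w0 w2.
have := pos (w / 2); rewrite oneBcos => h; have {}h := h ltac:(lra).
 have : 0 <= w / 2 / 2 by lra.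
by move: h; set s := sin _; nra.
Qed.

Lemma oneBcos_le v : 1 - cos v <= 2 * Num.min 1 (v ^+ 2).
Proof.
have := oneBcos_le_sqr v; have := cos_geN1 v; have := sqr_ge0 v.
by rewrite /Num.min; case: ifP; lra.
Qed.

(** Up to constants this is |sin(a + b)| <= |sin a| + |sin b|, squared; integrated against N it
    makes psi^{1/2} subadditive up to a constant. The proof is a parallelogram identity with
    explicit nonnegative remainders. *)
Lemma oneBcosD u v :
  1 - cos (u + v) <= 2 * (1 - cos u) + 2 * (1 - cos v).
Proof.
rewrite !oneBcos (mulrDl u v) sinD.
have := cos2Dsin2 (u / 2); have := cos2Dsin2 (v / 2).
set s1 := sin (u / 2); set s2 := sin (v / 2).
set c1 := cos (u / 2); set c2 := cos (v / 2) => h1 h2.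
have -> : 2 * (2 * s1 ^+ 2) + 2 * (2 * s2 ^+ 2) = 2 * (s1 * c2 + c1 * s2) ^+ 2
   + 2 * (s1 * c2 - c1 * s2) ^+ 2
   + 4 * s1 ^+ 2 * (1 - c2 ^+ 2) + 4 * s2 ^+ 2 * (1 - c1 ^+ 2) by ring.
have := sqr_ge0 (s1 * c2 - c1 * s2).
have : 0 <= s1 ^+ 2 * (1 - c2 ^+ 2) by rewrite mulr_ge0 ?sqr_ge0//; nra.
have : 0 <= s2 ^+ 2 * (1 - c1 ^+ 2) by rewrite mulr_ge0 ?sqr_ge0//; nra.
lra.
Qed.

(** It comes from |sin(k w)| <= k |sin w|. Iterating [oneBcosD] would lose the exact factor k^2. *)
Lemma oneBcosMn k v : 1 - cos (k%:R * v) <= k%:R ^+ 2 * (1 - cos v).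
Proof.
rewrite !oneBcos -mulrA; move: (v / 2) => w.
have : `|sin (k%:R * w)| <= k%:R * `|sin w|.
  elim: k => [|k IH]; first by rewrite !mul0r sin0 normr0.
  rewrite -natr1 !mulrDl !mul1r sinD (le_trans (ler_normD _ _))// !normrM.
  apply: lerD.
    by apply: le_trans IH; rewrite ler_piMr// cos_max.
  by rewrite ler_piMl// cos_max.
rewrite -(@ler_pXn2r _ 2)// ?nnegrE// ?mulr_ge0// exprMn !real_normK ?num_real//.
by move: (sin w ^+ 2) (sin (k%:R * w) ^+ 2) => a c; nra.
Qed.

(* Shifting the index by k averages out the zeros of [1 - cos]: by
   [oneBcosD] two terms k apart cannot both be small. *)
Lemma avg_oneBcos_ge m v : (0 < m)%N -> `|v| <= (4 * m)%:R ->
  Num.min 1 (v ^+ 2) <=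
  256 * ((4 * m)%:R^-1 * \sum_(j < 4 * m) (1 - cos (j.+1%:R / (4 * m)%:R * v))).
Proof.
move=> m0; set n := (4 * m)%N => vn.
have n0 : 0 < n%:R :> R by rewrite ltr0n muln_gt0.
have mn0 : m%:R != 0 :> R by rewrite pnatr_eq0 -lt0n.
pose th := `|v| / n%:R.
have th0 : 0 <= th by rewrite divr_ge0.
have th1 : th <= 1 by rewrite ler_pdivrMr// mul1r.
pose a j := 1 - cos (j%:R * th).
have aE j : 1 - cos (j%:R / n%:R * v) = a j.
  rewrite /a /th -[in LHS]cos_norm normrM ger0_norm; last first.
    by rewrite divr_ge0// ltW.
  by congr (1 - cos _); rewrite mulrAC mulrA.
under eq_bigr do rewrite aE.
have a0 j : 0 <= a j by exact: oneBcos_ge0.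
(* Since k th is the difference of (k + j + 1) th and (j + 1) th, [a k] is at most twice the sum of
   the two corresponding terms. Taking n = 4 m leaves room for 2 m indices j and a shift by k <= 2
   m. *)
have key k : (k <= 2 * m)%N -> (2 * m)%:R * a k <= 4 * \sum_(j < n) a j.+1.
  move=> km.
  have split1 : \sum_(j < 2 * m) a (k + j.+1)%N <= \sum_(j < n) a j.+1.
    rewrite -(big_mkord xpredT (fun j => a (k + j.+1)%N)).
    rewrite -(big_mkord xpredT (fun j => a j.+1)).
    have -> : \sum_(0 <= j < 2 * m) a (k + j.+1)%N =
              \sum_(k <= j < k + 2 * m) a j.+1.
      rewrite -[X in _ = \sum_(X <= _ < _) _](add0n k) big_addn addKn.
      by apply: eq_bigr => j _; rewrite addnS addnC.
    rewrite (@big_cat_nat _ _ _ (k + 2 * m) 0 n)//=; last by rewrite /n; lia.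
    rewrite (@big_cat_nat _ _ _ k 0 (k + 2 * m))//= ?leq_addr//.
    by rewrite addrAC lerDr addr_ge0// sumr_ge0.
  have split2 : \sum_(j < 2 * m) a j.+1 <= \sum_(j < n) a j.+1.
    rewrite -!(big_mkord xpredT (fun j => a j.+1)).
    rewrite (@big_cat_nat _ _ _ (2 * m) 0 n)//=; last by rewrite /n; lia.
    by rewrite lerDl sumr_ge0.
  have : \sum_(j < 2 * m) a k <=
      \sum_(j < 2 * m) (2 * a (k + j.+1)%N + 2 * a j.+1).
    apply: ler_sum => j _; have := oneBcosD ((k + j.+1)%:R * th) (- (j.+1%:R * th)).
    by rewrite {1}natrD mulrDl addrK cosN.
  rewrite sumr_const card_ord -[a k *+ _]mulr_natl => /le_trans; apply.
  rewrite big_split /= -!mulr_sumr; lra.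
(* Look for k th in [1, 2], where 1 - cos is bounded below. Steps of length th <= 1 cannot jump over
   this interval; if 2 m steps do not go beyond 2, then k = 2 m works, with k th = |v| / 2. *)
have [k [km kth2 kth1]] : exists k, [/\ (k <= 2 * m)%N, k%:R * th <= 2 &
    Num.min 1 (v ^+ 2) <= 4 * (k%:R * th) ^+ 2].
  have [h2|h2] := leP ((2 * m)%:R * th) 2.
    exists (2 * m)%N; split => //.
    have -> : (2 * m)%:R * th = `|v| / 2.
      by rewrite /th /n !natrM; field.
    rewrite exprMn real_normK ?num_real// ge_min; apply/orP; right; nra.
  have [k [km kth]] : exists k, (k <= 2 * m)%N /\ 1 <= k%:R * th <= 2.
    have exk : exists k, 1 <= k%:R * th by exists (2 * m)%N; lra.
    case: (ex_minnP exk) => k k1 kmin; exists k; split.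
      by apply: kmin; lra.
    rewrite k1/=; case: k k1 kmin => [|k] k1 kmin; first by lra.
    have : ~~ (1 <= k%:R * th) by apply/negP => /kmin; rewrite ltnn.
    by rewrite -natr1 mulrDl; lra.
  exists k; split => //; first by lra.
  rewrite ge_min; apply/orP; left; nra.
apply: (le_trans kth1).
(* Here 256 = 4 * 8 * 4 * 2: the choice of k, [oneBcos_ge_sqr], [key], and the passage from 1 / (2
   m) to 1 / n. *)
have := key k km; have := @oneBcos_ge_sqr (k%:R * th).
rewrite ger0_norm ?mulr_ge0// => /(_ kth2); rewrite -/(a k).
have -> : 256 * (n%:R^-1 * \sum_(j < n) a j.+1) =
  64 * ((2 * m)%:R^-1 * (2 * \sum_(j < n) a j.+1)).
  by rewrite /n !natrM; field.
have m20 : 0 < (2 * m)%:R :> R by rewrite ltr0n muln_gt0.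
move=> h1; rewrite -ler_pdivlMl// => h2.
have : (2 * m)%:R^-1 * (2 * \sum_(j < n) a j.+1) =
  2^-1 * ((2 * m)%:R^-1 * (4 * \sum_(j < n) a j.+1)).
  by rewrite !natrM; field.
lra.
Qed.

End trigonometric_bounds.

Section integrable_EFin.
Context d (T : measurableType d) (R : realType) (mu : {measure set T -> \bar R}).
Implicit Types f g : T -> R.

Lemma EFin_Rintegral f : mu.-integrable setT (EFin \o f) ->
  (\int[mu]_x f x)%:E = (\int[mu]_x (f x)%:E)%E.
Proof. by move=> fi; rewrite /Rintegral fineK// integrable_fin_num. Qed.

Lemma integrable_EFinZ c f : mu.-integrable setT (EFin \o f) ->
  mu.-integrable setT (EFin \o (fun z => c * f z)).
Proof.
by move=> /(integrableZl measurableT c); apply: eq_integrable.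
Qed.

Lemma integrable_EFinD f g : mu.-integrable setT (EFin \o f) ->
  mu.-integrable setT (EFin \o g) ->
  mu.-integrable setT (EFin \o (fun z => f z + g z)).
Proof.
by move=> fi gi; apply: eq_integrable (integrableD _ fi gi).
Qed.

Lemma integrable_EFin_sum n (f : 'I_n -> T -> R) :
  (forall i, mu.-integrable setT (EFin \o f i)) ->
  mu.-integrable setT (EFin \o (fun z => \sum_(i < n) f i z)).
Proof.
move=> fi; have := @integrable_sum _ _ _ mu setT measurableT _ (index_enum 'I_n)
  xpredT (fun i x => (f i x)%:E) (fun i _ => fi _).
by apply: eq_integrable => // x _; rewrite /= sumEFin.
Qed.

Lemma le_integrable_EFin f g : measurable_fun setT f ->
  (forall z, `|f z| <= g z) ->
  mu.-integrable setT (EFin \o g) -> mu.-integrable setT (EFin \o f).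
Proof.
move=> mf fg gi; apply: (le_integrable _ _ _ gi) => //.
  exact/measurable_EFinP.
by move=> z _; rewrite /= lee_fin (le_trans (fg z))// ler_norm.
Qed.

End integrable_EFin.

Section rintegral_sum.
Context d (T : measurableType d) (R : realType) (mu : {measure set T -> \bar R}).

Lemma RintegralN (f : T -> R) : mu.-integrable setT (EFin \o f) ->
  \int[mu]_x (- f x) = - \int[mu]_x f x.
Proof.
move=> fi; rewrite -mulN1r -RintegralZl//.
by apply: eq_Rintegral => x _; rewrite mulN1r.
Qed.

Lemma Rintegral_sum n (f : 'I_n -> T -> R) :
  (forall i, mu.-integrable setT (EFin \o f i)) ->
  \int[mu]_x (\sum_(i < n) f i x) = \sum_(i < n) \int[mu]_x f i x.
Proof.
elim: n f => [|n IH] f fi.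
  rewrite big_ord0 /Rintegral.
  by under eq_integral do rewrite big_ord0; rewrite integral0.
rewrite big_ord_recl -IH// -RintegralD//.
  by apply: eq_Rintegral => x _; rewrite big_ord_recl.
exact: integrable_EFin_sum.
Qed.

End rintegral_sum.

(** * The real part of the exponent, and its comparison with h *)

Section levy_exponent.
Variables (R : realType) (d : nat).
Variables (A : 'M[R]_d) (N : {measure set 'rV[R]_d -> \bar R}) (b : 'rV[R]_d).
Hypothesis gt : generating_triplet A N.
Implicit Types x y z : 'rV[R]_d.

Local Notation psi x := (complex.Re (Psi A N b x)).
Local Notation Psis := (Psi_star A N b).

Let AT : A^T = A. Proof. by case: gt. Qed.
Let App x : 0 <= dotv x (mxapp A x). Proof. by case: gt. Qed.

Lemma levy_integrable_dom (f : 'rV[R]_d -> R) C : measurable_fun setT f ->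
  (forall z, `|f z| <= C * Num.min 1 (enorm z ^+ 2)) ->
  N.-integrable setT (EFin \o f).
Proof.
move=> mf fC; have [_ _ [_ Nfin]] := gt.
have mm : measurable_fun setT (fun z : 'rV[R]_d => Num.min 1 (enorm z ^+ 2)).
  apply: measurable_minr => //.
  by apply: measurable_funX; exact: measurable_enorm.
have m0 z : 0 <= Num.min 1 (enorm z ^+ 2) by rewrite le_min ler01 sqr_ge0.
have im : N.-integrable setT (EFin \o (fun z => Num.min 1 (enorm z ^+ 2))).
  apply/integrableP; split; first exact/measurable_EFinP.
  by under eq_integral do rewrite /= ger0_norm//.
exact: le_integrable_EFin (integrable_EFinZ C im).
Qed.

Lemma sqr_dotv_le x z : dotv x z ^+ 2 <= enorm x ^+ 2 * enorm z ^+ 2.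
Proof.
rewrite -exprMn -(real_normK (num_real (dotv x z))).
rewrite ler_pXn2r ?nnegrE ?mulr_ge0 ?enorm_ge0//.
exact: CauchySchwarz_dotv.
Qed.

Lemma min1_scale (c v : R) : 0 <= c -> 0 <= v ->
  Num.min 1 (c * v) <= (1 + c) * Num.min 1 v.
Proof.
move=> c0 v0; rewrite ge_min /Num.min; case: ifP => h1.
  by apply/orP; left; lra.
by apply/orP; right; nra.
Qed.

Let integrable_min_dotv x :
  N.-integrable setT (EFin \o (fun z => Num.min 1 (dotv x z ^+ 2))).
Proof.
apply: (@levy_integrable_dom _ (1 + enorm x ^+ 2)).
  apply: measurable_minr => //.
  by apply: measurable_funX; exact: measurable_dotv.
move=> z; rewrite ger0_norm ?le_min ?ler01 ?sqr_ge0//.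
apply: le_trans (min1_scale _ _); rewrite ?sqr_ge0//.
by rewrite le_min !ge_min lexx/= sqr_dotv_le orbT.
Qed.

Let measurable_oneBcos x :
  measurable_fun setT (fun z : 'rV[R]_d => 1 - cos (dotv x z)).
Proof.
apply: measurable_funB => //.
apply: (measurableT_comp (continuous_measurable_fun (@continuous_cos R))).
exact: measurable_dotv.
Qed.

Let integrable_oneBcos x :
  N.-integrable setT (EFin \o (fun z => 1 - cos (dotv x z))).
Proof.
apply: (@levy_integrable_dom _ (2 * (1 + enorm x ^+ 2))) => // z.
rewrite ger0_norm ?oneBcos_ge0// (le_trans (oneBcos_le _))//.
rewrite -mulrA ler_wpM2l//.
apply: le_trans (min1_scale _ _); rewrite ?sqr_ge0//.
by rewrite le_min !ge_min lexx/= sqr_dotv_le orbT.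
Qed.

Lemma integrable_min1_enorm r : 0 < r ->
  N.-integrable setT (EFin \o (fun z => Num.min 1 (enorm z ^+ 2 / r ^+ 2))).
Proof.
move=> r0; apply: (@levy_integrable_dom _ (1 + r ^- 2)).
  apply: measurable_minr => //; apply: measurable_funM => //.
  by apply: measurable_funX; exact: measurable_enorm.
move=> z; rewrite ger0_norm ?le_min ?ler01 ?divr_ge0 ?sqr_ge0//.
by rewrite mulrC min1_scale// ?invr_ge0 ?sqr_ge0.
Qed.

Let measurable_dotv_lt1 x : measurable [set z : 'rV[R]_d | `|dotv x z| < 1].
Proof.
have mn : measurable_fun setT (fun z => `|dotv x z|).
  by apply: measurableT_comp => //; exact: measurable_dotv.
have := @measurable_fun_ltr _ _ R setT (fun z => `|dotv x z|) (cst 1).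
move=> /(_ mn _ measurableT [set true]); rewrite setTI; exact.
Qed.

Let integrable_trunc x : N.-integrable setT (EFin \o
  ((fun z => `|dotv x z| ^+ 2) \_ [set z | `|dotv x z| < 1])).
Proof.
have mn : measurable_fun setT (fun z => `|dotv x z|).
  by apply: measurableT_comp => //; exact: measurable_dotv.
apply: (@levy_integrable_dom _ (1 + enorm x ^+ 2)).
  apply/(measurable_restrictT _ _).1; first exact: measurable_dotv_lt1.
  exact/measurable_funTS/measurable_funX.
move=> z; rewrite patchE; case: ifPn => [|_]; last first.
  by rewrite normr0 mulr_ge0 ?le_min ?ler01 ?addr_ge0 ?sqr_ge0.
rewrite inE /= => xz1; rewrite ger0_norm ?sqr_ge0//.
apply: le_trans (min1_scale _ _); rewrite ?sqr_ge0// le_min.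
apply/andP; split; first by rewrite exprn_ile1// ltW.
by rewrite real_normK ?num_real ?sqr_dotv_le.
Qed.

(** The drift and the compensator are purely imaginary, so b disappears. *)
Lemma RePsiE x :
  psi x = dotv x (mxapp A x) + \int[N]_z (1 - cos (dotv x z)).
Proof.
have ReB (u v : R[i]) : complex.Re (u - v) = complex.Re u - complex.Re v.
  by case: u => ? ?; case: v.
rewrite /Psi !ReB /cintegral /= mul0r mul1r !subr0.
congr (_ + _); rewrite -RintegralN//.
  by apply: eq_Rintegral => z _; rewrite !mul0r !mul1r !subr0 expR0 add0r; ring.
have := integrableN (integrable_oneBcos x).
apply: eq_integrable => // z _ /=; congr EFin.
by rewrite !mul0r !mul1r !subr0 expR0 add0r; ring.
Qed.

Let qZ a x : dotv (a *: x) (mxapp A (a *: x)) = a ^+ 2 * dotv x (mxapp A x).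
Proof. by rewrite /mxapp -scalemxAl dotvZl dotvZr mulrA. Qed.

Let int_oneBcos_ge0 x : 0 <= \int[N]_z (1 - cos (dotv x z)).
Proof. by apply: Rintegral_ge0 => z _; exact: oneBcos_ge0. Qed.

Lemma RePsi_ge0 x : 0 <= psi x.
Proof. by rewrite RePsiE addr_ge0. Qed.

Lemma quad_le_RePsi x : dotv x (mxapp A x) <= psi x.
Proof. by rewrite RePsiE lerDl. Qed.

Lemma RePsi0 : psi 0 = 0.
Proof.
rewrite RePsiE dotvC dotv0 add0r /Rintegral.
under eq_integral do rewrite dotvC dotv0 cos0 subrr.
by rewrite integral0.
Qed.

Lemma RePsiD x y : psi (x + y) <= 2 * psi x + 2 * psi y.
Proof.
rewrite !RePsiE.
have q : dotv (x + y) (mxapp A (x + y)) <=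
    2 * dotv x (mxapp A x) + 2 * dotv y (mxapp A y).
  (* The parallelogram law: the defect is the quadratic form at x - y. *)
  have := App (x + -1 *: y).
  rewrite /mxapp !mulmxDl -scalemxAl !dotvDl !dotvDr !dotvZl !dotvZr; lra.
have : \int[N]_z (1 - cos (dotv (x + y) z)) <=
    \int[N]_z (2 * (1 - cos (dotv x z)) + 2 * (1 - cos (dotv y z))).
  apply: le_Rintegral => //.
    by apply: integrable_EFinD; apply: integrable_EFinZ.
  by move=> z _; rewrite dotvDl oneBcosD.
rewrite [leRHS]RintegralD//; try exact: integrable_EFinZ.
by rewrite !RintegralZl//; move: q; lra.
Qed.

Lemma RePsiMn k x : psi (k%:R *: x) <= k%:R ^+ 2 * psi x.
Proof.
rewrite !RePsiE qZ mulrDr lerD2l -RintegralZl//.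
apply: le_Rintegral => //.
  exact: integrable_EFinZ.
by move=> z _; rewrite dotvZl oneBcosMn.
Qed.

(** The function h of the one-dimensional projection <x, Y>, at radius 1; [dir_trunc] below is the
    truncated second moment of (C4). *)
Definition dir_conc x : R :=
  dotv x (mxapp A x) + \int[N]_z Num.min 1 (dotv x z ^+ 2).

Definition dir_trunc x : R := dotv x (mxapp A x)
  + \int[N]_(z in [set z | `|dotv x z| < 1]) (`|dotv x z| ^+ 2).

Let dir_truncE x : dir_trunc x = dotv x (mxapp A x)
  + \int[N]_z ((fun z => `|dotv x z| ^+ 2) \_ [set z | `|dotv x z| < 1]) z.
Proof. by rewrite /dir_trunc Rintegral_mkcond. Qed.

Let le_int (f g : 'rV[R]_d -> R) (c : R) : N.-integrable setT (EFin \o f) ->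
  N.-integrable setT (EFin \o g) -> (forall z, f z <= c * g z) ->
  \int[N]_z f z <= c * \int[N]_z g z.
Proof.
move=> fi gi fg; rewrite -RintegralZl//; apply: le_Rintegral => //.
exact: integrable_EFinZ.
Qed.

Lemma RePsi_le_conc x : psi x <= 2 * dir_conc x.
Proof.
rewrite RePsiE mulrDr lerD//; first by have := App x; lra.
by apply: le_int => // z; exact: oneBcos_le.
Qed.

Lemma dir_trunc_le_RePsi x : dir_trunc x <= 8 * psi x.
Proof.
rewrite RePsiE dir_truncE mulrDr lerD//; first by have := App x; lra.
apply: le_int => // z; rewrite patchE; case: ifPn => [|_].
  rewrite inE /= => z1; have := @oneBcos_ge_sqr _ (dotv x z).
  by rewrite real_normK ?num_real// => h; have {h} := h ltac:(lra); lra.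
by rewrite mulr_ge0// oneBcos_ge0.
Qed.

Let le_int2 (f g k : 'rV[R]_d -> R) (c : R) : N.-integrable setT (EFin \o f) ->
  N.-integrable setT (EFin \o g) -> N.-integrable setT (EFin \o k) ->
  (forall z, f z <= g z + c * k z) ->
  \int[N]_z f z <= \int[N]_z g z + c * \int[N]_z k z.
Proof.
move=> fi gi ki fg; have cki := integrable_EFinZ c ki.
rewrite -RintegralZl// -RintegralD//; apply: le_Rintegral => //.
exact: integrable_EFinD.
Qed.

(** Where |<x, z>| >= 1 the minimum already equals 1 at x and cannot grow; elsewhere it is at most
    l^2 <x, z>^2, which [dir_trunc] accounts for. *)
Lemma dir_concZ_le (l : R) x : 1 <= l ->
  dir_conc (l *: x) <= dir_conc x + l ^+ 2 * dir_trunc x.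
Proof.
move=> l1; have l21 : 1 <= l ^+ 2 by rewrite exprn_ege1.
rewrite dir_truncE /dir_conc qZ mulrDr addrACA lerD//.
  by have := App x; nra.
apply: le_int2 => // z; rewrite dotvZl exprMn patchE; case: ifPn.
  by move=> _; rewrite real_normK ?num_real// ge_min lerDr le_min ler01 sqr_ge0 orbT.
rewrite notin_setE /= => /negP; rewrite -leNgt => z1.
have : 1 <= dotv x z ^+ 2.
  by rewrite -(real_normK (num_real (dotv x z))) exprn_ege1.
by move=> h; rewrite mulr0 addr0 (min_idPl h) ge_min lexx.
Qed.

(** Where |<2x, z>| < 1 neither minimum is saturated, and doubling x adds 3 <x, z>^2, which is 3/4
    of <2x, z>^2. *)
Lemma dir_conc_double_ge x :
  dir_conc x + 3 / 4 * dir_trunc (2 *: x) <= dir_conc (2 *: x).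
Proof.
rewrite -lerBrDr -mulNr dir_truncE /dir_conc qZ mulrDr addrACA lerD//.
  by have := App x; lra.
apply: le_int2 => // z; rewrite dotvZl patchE; case: ifPn.
  rewrite inE/= dotvZl real_normK ?num_real// => z1.
  have : (2 * dotv x z) ^+ 2 <= 1.
    by rewrite -(real_normK (num_real (2 * _))) exprn_ile1// ltW.
  by move=> h; rewrite (min_idPr h) ge_min; apply/orP; right; nra.
move=> _; rewrite mulr0 addr0 le_min !ge_min lexx/=; apply/orP; right.
by have := sqr_ge0 (dotv x z); nra.
Qed.

Lemma mxappE x i : mxapp A x 0 i = \sum_j x 0 j * A i j.
Proof. by rewrite mxE; apply: eq_bigr => j _; rewrite mxE. Qed.

Let mxapp_bound t x : (forall i j, `|A i j| <= t) ->
  enorm (mxapp A x) <= d%:R * (d%:R * t) * enorm x.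
Proof.
move=> At; rewrite -mulrA; apply: enorm_le_coords => i; rewrite mxappE.
rewrite (le_trans (ler_norm_sum _ _ _))//.
apply: (@le_trans _ _ (\sum_(j < d) t * enorm x)).
  apply: ler_sum => j _; rewrite normrM mulrC ler_pM//.
  exact: coord_le_enorm.
by rewrite sumr_const card_ord -[X in X <= _]mulr_natl mulrA.
Qed.

Let has_sup_opnorm : has_sup [set enorm (mxapp A x) | x in [set x | enorm x <= 1]].
Proof.
split.
  by exists (enorm (mxapp A 0)), 0 => //=; rewrite enorm0 ler01.
pose t := \sum_i \sum_j `|A i j|.
have At i j : `|A i j| <= t.
  rewrite /t (bigD1 i)//= (bigD1 j)//= -addrA lerDl.
  by rewrite addr_ge0// sumr_ge0// => *; rewrite sumr_ge0.
exists (d%:R * (d%:R * t)) => _ [x /= x1 <-]; apply: (le_trans (mxapp_bound _ At)).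
by rewrite ler_piMr// !mulr_ge0// (sumr_ge0)// => i _; rewrite sumr_ge0.
Qed.

Lemma opnorm_ge0 : 0 <= opnorm A.
Proof.
apply: le_trans (enorm_ge0 (mxapp A 0)) _.
by apply: sup_upper_bound => //; exists 0 => //=; rewrite enorm0.
Qed.

Lemma enorm_mxapp_le x : enorm (mxapp A x) <= opnorm A * enorm x.
Proof.
have [x0|x0] := eqVneq (enorm x) 0.
  by rewrite (enorm_eq0 x0) /mxapp mul0mx enorm0 mulr0.
have xp : 0 < enorm x by rewrite lt_def x0 enorm_ge0.
have -> : enorm (mxapp A x) = enorm (mxapp A ((enorm x)^-1 *: x)) * enorm x.
  rewrite /mxapp -scalemxAl enormZ ger0_norm ?invr_ge0 ?enorm_ge0//.
  by rewrite mulrAC mulVf// mul1r.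
rewrite ler_wpM2r ?enorm_ge0//; apply: sup_upper_bound => //.
exists ((enorm x)^-1 *: x) => //=.
by rewrite enormZ ger0_norm ?invr_ge0 ?enorm_ge0// mulVf.
Qed.

Lemma quad_le_opnorm x : dotv x (mxapp A x) <= enorm x ^+ 2 * opnorm A.
Proof.
apply: le_trans (ler_norm _) (le_trans (CauchySchwarz_dotv _ _) _).
by rewrite expr2 -mulrA ler_wpM2l ?enorm_ge0// mulrC enorm_mxapp_le.
Qed.

Lemma quad_unitv i j : dotv (unitv R i) (mxapp A (unitv R j)) = A i j.
Proof. by rewrite dotv_unitv /mxapp -rowE !mxE. Qed.

(** Testing the form on e_i + e_j and e_i - e_j bounds |A_ij| by the mean of A_ii and A_jj, hence by
    the trace. *)
Lemma opnorm_le_trace : opnorm A <= d%:R ^+ 2 * \sum_i A i i.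
Proof.
have Aii i : 0 <= A i i by rewrite -quad_unitv.
pose t := \sum_i A i i.
have Ait i : A i i <= t by rewrite /t (bigD1 i)//= lerDl sumr_ge0.
have At i j : `|A i j| <= t.
  have Aji : A j i = A i j by rewrite -{1}AT mxE.
  have := App (unitv R i + unitv R j); have := App (unitv R i - unitv R j).
  rewrite -scaleN1r /mxapp !mulmxDl -scalemxAl !dotvDl !dotvDr !dotvZl !dotvZr.
  rewrite -/(mxapp A _) -/(mxapp A _) !quad_unitv Aji ler_norml.
  by have := Ait i; have := Ait j; lra.
apply: ge_sup; first by case: has_sup_opnorm.
move=> _ [x /= x1 <-]; apply: (le_trans (mxapp_bound _ At)).
by rewrite expr2 -[leRHS]mulrA ler_piMr// !mulr_ge0// sumr_ge0.
Qed.

Lemma dir_conc_le_hfun x r : 0 < r -> enorm x <= r^-1 -> dir_conc x <= hfun A N r.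
Proof.
move=> r0 xr; have x2 : enorm x ^+ 2 <= r ^- 2.
  by rewrite -exprVn ler_pXn2r ?nnegrE ?enorm_ge0 ?invr_ge0// ltW.
apply: lerD.
  by apply: le_trans (quad_le_opnorm _) _; rewrite ler_wpM2r ?opnorm_ge0.
apply: le_Rintegral => // [|z _]; first exact: integrable_min1_enorm.
rewrite le_min !ge_min lexx/=; apply/orP; right.
by rewrite (le_trans (sqr_dotv_le _ _))// mulrC ler_wpM2l ?sqr_ge0.
Qed.

Lemma RePsi_le_hfun x r : 0 < r -> enorm x <= r^-1 -> psi x <= 2 * hfun A N r.
Proof.
move=> r0 xr; apply: le_trans (RePsi_le_conc x) _.
by rewrite ler_wpM2l// dir_conc_le_hfun.
Qed.

Let has_sup_Psi_star r : 0 < r -> has_sup [set psi z | z in [set z | enorm z <= r]].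
Proof.
move=> r0; split; first by exists (psi 0), 0 => //=; rewrite enorm0 ltW.
exists (2 * hfun A N r^-1) => _ [z /= zr <-].
by apply: RePsi_le_hfun; rewrite ?invr_gt0 ?invrK.
Qed.

Lemma RePsi_le_Psi_star r z : 0 < r -> enorm z <= r -> psi z <= Psis r.
Proof. by move=> r0 zr; apply: sup_upper_bound; [exact: has_sup_Psi_star|exists z]. Qed.

Lemma Psi_star_le r c : 0 < r -> (forall z, enorm z <= r -> psi z <= c) ->
  Psis r <= c.
Proof.
move=> r0 h; apply: ge_sup; first by case: (has_sup_Psi_star r0).
by move=> _ [z /= zr <-]; exact: h.
Qed.

Lemma Psi_star_ge0 r : 0 < r -> 0 <= Psis r.
Proof.
by move=> r0; rewrite -RePsi0 RePsi_le_Psi_star// enorm0 ltW.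
Qed.

Lemma le_Psi_star r s : 0 < r -> r <= s -> Psis r <= Psis s.
Proof.
move=> r0 rs; apply: Psi_star_le => // z zr; apply: RePsi_le_Psi_star.
  exact: lt_le_trans rs.
exact: le_trans rs.
Qed.

Lemma Psi_star_le_hfun r : 0 < r -> Psis r <= 2 * hfun A N r^-1.
Proof.
move=> r0; apply: Psi_star_le => // z zr.
by apply: RePsi_le_hfun; rewrite ?invr_gt0 ?invrK.
Qed.

(** [avg_oneBcos_ge] covers only |<x, z>| <= 4 m, so the integrand is cut off there and m tends to
    infinity by dominated convergence. The averaged vectors (j/n) x have norm at most |x|, so each
    term is below [Psi_star] at |x|. *)
Lemma int_min_dotv_le x : 0 < enorm x ->
  \int[N]_z Num.min 1 (dotv x z ^+ 2) <= 256 * Psis (enorm x).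
Proof.
move=> x0.
pose f (m : nat) z : R := if `|dotv x z| <= (4 * m.+1)%:R
  then Num.min 1 (dotv x z ^+ 2) else 0.
have fle m z : f m z <= 256 * ((4 * m.+1)%:R^-1 *
     \sum_(j < 4 * m.+1) (1 - cos (j.+1%:R / (4 * m.+1)%:R * dotv x z))).
  rewrite /f; case: ifPn => [h|_]; first exact: avg_oneBcos_ge.
  rewrite mulr_ge0 ?ler0n// mulr_ge0 ?invr_ge0 ?ler0n//.
  by apply: sumr_ge0 => j _; exact: oneBcos_ge0.
have mf m : measurable_fun setT (f m).
  apply: measurable_fun_ifT => //; last first.
    by apply: measurable_minr => //; apply: measurable_funX; exact: measurable_dotv.
  apply: measurable_fun_ler => //.
  by apply: measurableT_comp => //; exact: measurable_dotv.
have f0 m z : 0 <= f m z.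
  by rewrite /f; case: ifP => // _; rewrite le_min ler01 sqr_ge0.
have fdom m z : f m z <= Num.min 1 (dotv x z ^+ 2).
  by rewrite /f; case: ifP => // _; rewrite le_min ler01 sqr_ge0.
have fi m : N.-integrable setT (EFin \o f m).
  by apply: le_integrable_EFin (integrable_min_dotv x) => // z; rewrite ger0_norm.
have fint m : \int[N]_z f m z <= 256 * Psis (enorm x).
  set n := (4 * m.+1)%N in fle *; have n0 : 0 < n%:R :> R by rewrite ltr0n.
  have gi j : N.-integrable setT (EFin \o
      (fun z => 1 - cos (j.+1%:R / n%:R * dotv x z))).
    have := integrable_oneBcos ((j.+1%:R / n%:R) *: x).
    by apply: eq_integrable => // z _; rewrite /= dotvZl.
  have sgi : N.-integrable setT (EFin \o
      (fun z => \sum_(j < n) (1 - cos (j.+1%:R / n%:R * dotv x z)))).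
    exact: integrable_EFin_sum.
  have : \int[N]_z f m z <= 256 / n%:R *
     \int[N]_z (\sum_(j < n) (1 - cos (j.+1%:R / n%:R * dotv x z))).
    apply: le_int => // z; apply: le_trans (fle m z) _.
    by rewrite mulrA.
  move=> /le_trans; apply; rewrite -mulrA ler_wpM2l ?ler0n// ler_pdivrMl// mulrC.
  rewrite Rintegral_sum//.
  apply: (@le_trans _ _ (\sum_(j < n) Psis (enorm x))); last first.
    by rewrite sumr_const card_ord mulr_natr.
  apply: ler_sum => j _.
  have : psi ((j.+1%:R / n%:R) *: x) <= Psis (enorm x).
    apply: RePsi_le_Psi_star => //.
    rewrite enormZ ler_piMl ?enorm_ge0// ger0_norm ?divr_ge0//.
    by rewrite ler_pdivrMr// mul1r ler_nat.
  rewrite RePsiE; under eq_Rintegral do rewrite dotvZl.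
  by have := App ((j.+1%:R / n%:R) *: x); lra.
have emf m : measurable_fun setT (EFin \o f m) by exact/measurable_EFinP.
have fcvg : {ae N, forall z, setT z ->
    (EFin \o f m) z @[m --> \oo] --> (Num.min 1 (dotv x z ^+ 2))%:E}.
  apply: aeW => z _; apply: cvg_near_cst.
  exists (Num.truncn `|dotv x z|).+1 => // m /= zm; rewrite /f ifT//.
  apply: ltW; apply: lt_le_trans (truncnS_gt _) _.
  by rewrite ler_nat (leq_trans zm)// (leq_trans (leqnSn m))// leq_pmull.
have fbd : {ae N, forall z m, setT z ->
    (`|(EFin \o f m) z| <= (Num.min 1 (dotv x z ^+ 2))%:E)%E}.
  by apply: aeW => z m _; rewrite /= lee_fin ger0_norm.
have [_ _ cvgf] := dominated_convergence measurableT emf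
  (measurable_int _ (integrable_min_dotv x)) fcvg (integrable_min_dotv x) fbd.
rewrite -lee_fin EFin_Rintegral//.
rewrite -(cvg_lim _ cvgf)//; apply: lime_le.
  by apply/cvg_ex; eexists; exact: cvgf.
apply: nearW => m /=.
by rewrite -EFin_Rintegral// lee_fin fint.
Qed.

(** The term d^3 is d^2 from [opnorm_le_trace] times d diagonal entries, and 256 d is
    [int_min_dotv_le] in d directions. The summand 1 makes the constant at least 1. *)
Definition cPsi : R := d%:R ^+ 3 + 256 * d%:R + 1.

Lemma cPsi_gt0 : 0 < cPsi.
Proof. apply: ltr_wpDl; last exact: ltr01.
apply: addr_ge0; first by rewrite exprn_ge0 ?ler0n.
by apply: mulr_ge0; exact: ler0n. Qed.

Lemma hfun_le_Psi_star r : 0 < r -> hfun A N r <= cPsi * Psis r^-1.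
Proof.
move=> r0; have ri : 0 < r^-1 by rewrite invr_gt0.
have P0 := Psi_star_ge0 ri.
have eu i : enorm (r^-1 *: unitv R i) = r^-1.
  by rewrite enormZ enorm_unitv mulr1 ger0_norm// ltW.
rewrite /cPsi 2!mulrDl mul1r -addrA lerD//.
  apply: (@le_trans _ _ (d%:R ^+ 2 * \sum_(i < d) Psis r^-1)); last first.
    by rewrite sumr_const card_ord -[Psis _ *+ _]mulr_natl mulrA -exprSr.
  apply: (@le_trans _ _ (r ^- 2 * (d%:R ^+ 2 * \sum_i A i i))).
    by rewrite ler_wpM2l ?opnorm_le_trace// invr_ge0 sqr_ge0.
  rewrite mulrCA ler_wpM2l// ?sqr_ge0// mulr_sumr; apply: ler_sum => i _.
  rewrite -quad_unitv -exprVn -qZ (le_trans (quad_le_RePsi _))//.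
  by apply: RePsi_le_Psi_star; rewrite ?eu.
rewrite -[leLHS]addr0 lerD//.
have : \int[N]_z Num.min 1 (enorm z ^+ 2 / r ^+ 2) <=
   1 * \int[N]_z (\sum_(i < d) Num.min 1 (dotv (r^-1 *: unitv R i) z ^+ 2)).
  apply: le_int; first exact: integrable_min1_enorm.
    by apply: integrable_EFin_sum => i.
  move=> z; rewrite mul1r sqr_enorm /dotv mulr_suml.
  (* The map u |-> min(1, u) is subadditive on nonnegative reals only, so the sign is carried
     through the induction over coordinates. *)
  pose K (u v : R) := 0 <= u /\ Num.min 1 u <= v.
  apply: (proj2 (_ : K _ _)); elim/big_ind2: _ => [|u1 u2 v1 v2|i _].
  - by rewrite /K ge_min lexx orbT.
  - move=> [u10 h1] [u20 h2]; split; first exact: addr_ge0.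
    apply: le_trans (lerD h1 h2); move: u10 u20 {h1 h2}.
    by rewrite /Num.min; do !case: ifP; lra.
  - rewrite /K -expr2 mulr_ge0 ?invr_ge0 ?sqr_ge0//; split=> //.
    by rewrite -/(dotv _ _) dotvZl dotv_unitv exprMn -exprVn mulrC.
rewrite mul1r => /le_trans; apply; rewrite Rintegral_sum//.
rewrite -mulrA; apply: (@le_trans _ _ (\sum_(i < d) 256 * Psis r^-1)).
  apply: ler_sum => i _; have := @int_min_dotv_le (r^-1 *: unitv R i).
  by rewrite eu; apply.
by rewrite sumr_const card_ord -[_ *+ _]mulr_natl; lra.
Qed.

End levy_exponent.

(** * The function h: monotonicity, continuity, inverse *)

Section concentration_function.
Variables (R : realType) (d : nat).
Variables (A : 'M[R]_d) (N : {measure set 'rV[R]_d -> \bar R}).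
Hypothesis gt : generating_triplet A N.
Local Notation h := (hfun A N).

Let Ni r : 0 < r ->
  N.-integrable setT (EFin \o (fun z => Num.min 1 (enorm z ^+ 2 / r ^+ 2))).
Proof. exact: (integrable_min1_enorm gt). Qed.

Lemma hfun_ge0 r : 0 <= h r.
Proof.
apply: addr_ge0.
  by rewrite mulr_ge0 ?invr_ge0 ?sqr_ge0 ?opnorm_ge0.
by apply: Rintegral_ge0 => z _; rewrite le_min ler01 divr_ge0 ?sqr_ge0.
Qed.

(** h is linear in its kernels r^-2 and min(1, v / r^2), so an inequality between increments of the
    kernels passes to h. *)
Let hfun_lin (a r s t : R) : 0 < r -> 0 < s -> 0 < t ->
  r ^- 2 - s ^- 2 <= a * (s ^- 2 - t ^- 2) ->
  (forall v : R, 0 <= v -> Num.min 1 (v / r ^+ 2) - Num.min 1 (v / s ^+ 2) <=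
     a * (Num.min 1 (v / s ^+ 2) - Num.min 1 (v / t ^+ 2))) ->
  h r - h s <= a * (h s - h t).
Proof.
move=> r0 s0 t0 hA hN; rewrite /hfun !opprD addrACA [in leRHS]addrACA mulrDr.
apply: lerD.
  by rewrite -!mulrBl mulrA ler_wpM2r ?opnorm_ge0.
rewrite -!RintegralB//; try exact: Ni.
rewrite -RintegralZl//; last first.
  by have := integrableB measurableT (Ni s0) (Ni t0); exact: eq_integrable.
apply: le_Rintegral => //.
- by have := integrableB measurableT (Ni r0) (Ni s0); exact: eq_integrable.
- apply: integrable_EFinZ.
  by have := integrableB measurableT (Ni s0) (Ni t0); exact: eq_integrable.
- by move=> z _; apply: hN; exact: sqr_ge0.
Qed.

Let invsq_lt (r s : R) : 0 < r -> r < s -> s ^- 2 < r ^- 2.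
Proof.
move=> r0 rs; have s0 : 0 < s by exact: lt_trans rs.
by rewrite ltf_pV2 ?posrE ?exprn_gt0// ltr_pXn2r ?nnegrE ?ltW.
Qed.

Let invsq_le (r s : R) : 0 < r -> r <= s -> s ^- 2 <= r ^- 2.
Proof.
move=> r0; rewrite le_eqVlt => /predU1P[->//|/(invsq_lt r0)]; exact: ltW.
Qed.

Lemma hfun_noninc r s : 0 < r -> r <= s -> h s <= h r.
Proof.
move=> r0 rs; have s0 : 0 < s by exact: lt_le_trans rs.
apply: lerD; first by rewrite ler_wpM2r ?opnorm_ge0 ?invsq_le.
apply: le_Rintegral; rewrite ?Ni// => z _.
by rewrite le_min !ge_min lexx/= ler_wpM2l ?sqr_ge0 ?orbT ?invsq_le.
Qed.

Lemma hfun_scale r s : 0 < r -> r <= s -> r ^+ 2 * h r <= s ^+ 2 * h s.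
Proof.
move=> r0 rs; have s0 : 0 < s by exact: lt_le_trans rs.
rewrite !mulrDr lerD//.
  by rewrite !mulrA !divff ?mul1r// sqrf_eq0 gt_eqF.
rewrite -!RintegralZl//; try exact: Ni.
apply: le_Rintegral; rewrite ?(integrable_EFinZ _ (Ni _))// => z _.
have rs2 : r ^+ 2 <= s ^+ 2 by rewrite ler_pXn2r// nnegrE ltW.
have mE (t v : R) : 0 < t -> t ^+ 2 * Num.min 1 (v / t ^+ 2) = Num.min (t ^+ 2) v.
  move=> t0; rewrite minr_pMr ?sqr_ge0// mulr1 mulrC divfK//.
  by rewrite sqrf_eq0 gt_eqF.
by rewrite !mE// le_min !ge_min rs2 lexx !orbT.
Qed.

Hypothesis hoo : h r @[r --> 0^'+] --> +oo.

Lemma hfun_unbounded (M e : R) : 0 < e -> exists2 r, 0 < r < e & M < h r.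
Proof.
move=> e0; have /cvgryPgt/(_ M) := hoo => hM.
have hr : \forall r \near 0^'+, 0 < r < e.
  near=> r; apply/andP; split; near: r; first exact: nbhs_right_gt.
  exact: nbhs_right_lt.
by case: (@filter_ex _ _ (@at_right_proper_filter R 0) _ (filterI hM hr)) => r []; exists r.
Unshelve. all: by end_near. Qed.

(* If [h s = h t], then [A = 0] and [N] lives on [|z| >= t], so that [h] is
   bounded near 0. *)
Lemma hfun_decr s t : 0 < s -> s < t -> h t < h s.
Proof.
move=> s0 st; have t0 : 0 < t by exact: lt_trans st.
rewrite lt_def hfun_noninc ?ltW// andbT; apply/eqP => hst.
have [r /andP[r0 rs] hr] := hfun_unbounded (h s) s0.
have dst : 0 < s ^- 2 - t ^- 2 by rewrite subr_gt0 invsq_lt.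
(* With this a the product a (s^-2 - t^-2) is r^-2, which settles the Gaussian part and the range v
   < s^2. For v >= s^2 the left side of the kernel inequality is 0. *)
pose a := r ^- 2 / (s ^- 2 - t ^- 2).
suff : h r - h s <= a * (h s - h t) by rewrite hst subrr mulr0; lra.
apply: hfun_lin => //.
  by rewrite /a divfK ?gt_eqF// lerBlDr lerDl invr_ge0 sqr_ge0.
move=> v v0; have [vs|vs] := leP 1 (v / s ^+ 2).
  have vr : 1 <= v / r ^+ 2.
    by apply: le_trans vs _; rewrite ler_wpM2l// invsq_le// ltW.
  rewrite (min_idPl vr) subrr mulr_ge0//.
    by rewrite divr_ge0 ?invr_ge0 ?sqr_ge0 ?ltW.
  by rewrite subr_ge0 ge_min lexx.
have vt : v / t ^+ 2 <= v / s ^+ 2 by rewrite ler_wpM2l// invsq_le// ltW.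
rewrite (min_idPr (le_trans vt (ltW vs))) -mulrBr.
rewrite mulrCA /a divfK ?gt_eqF// lerBlDr.
by rewrite ge_min lerDl divr_ge0 ?sqr_ge0// orbT.
Qed.

Lemma hfun_gt0 s : 0 < s -> 0 < h s.
Proof.
move=> s0; apply: (le_lt_trans (hfun_ge0 (2 * s))).
by apply: hfun_decr => //; lra.
Qed.

Lemma ltr_hfun s t : 0 < s -> 0 < t -> (h s < h t) = (t < s).
Proof.
move=> s0 t0; have [ts|st] := ltP t s; first by rewrite hfun_decr.
by rewrite ltNge hfun_noninc.
Qed.

Lemma hfun_inj s t : 0 < s -> 0 < t -> h s = h t -> s = t.
Proof.
move=> s0 t0 hst; apply/eqP; rewrite eq_le !leNgt.
apply/andP; split; apply/negP => st.
  by have := hfun_decr t0 st; rewrite hst ltxx.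
by have := hfun_decr s0 st; rewrite hst ltxx.
Qed.

Lemma hfun_vanish (e : R) : 0 < e -> exists2 r, 0 < r & h r < e.
Proof.
move=> e0.
pose f (n : nat) z : R := Num.min 1 (enorm (z : 'rV[R]_d) ^+ 2 / n.+1%:R ^+ 2).
have fi n : N.-integrable setT (EFin \o f n) by exact: Ni.
have emf n : measurable_fun setT (EFin \o f n) by apply: (measurable_int N).
have f1 n z : 0 <= f n z <= Num.min 1 (enorm z ^+ 2 / 1 ^+ 2).
  rewrite !le_min ler01 divr_ge0 ?sqr_ge0//= !ge_min lexx/=.
  by rewrite ler_wpM2l ?sqr_ge0 ?orbT ?invsq_le// ler1n.
have fcvg : {ae N, forall z, setT z -> (EFin \o f n) z @[n --> \oo] --> cst 0%E z}.
  apply: aeW => z _; apply: cvg_EFin; first exact: nearW.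
  have : (enorm z ^+ 2 * (n.+1%:R^-1 * n.+1%:R^-1)) @[n --> \oo] -->
      enorm z ^+ 2 * (0 * 0).
    by apply: cvgM; [exact: cvg_cst|apply: cvgM; exact: cvg_harmonic].
  rewrite !mulr0; apply: squeeze_cvgr; last exact: cvg_cst.
  apply: nearW => n; rewrite /= /f le_min ler01 divr_ge0 ?sqr_ge0//=.
  by rewrite ge_min -invfM -expr2 lexx orbT.
have fbd : {ae N, forall z n, setT z ->
    (`|(EFin \o f n) z| <= (Num.min 1 (enorm z ^+ 2 / 1 ^+ 2))%:E)%E}.
  by apply: aeW => z n _; rewrite /= lee_fin ger0_norm; case/andP: (f1 n z).
have [_ _] := dominated_convergence measurableT emf
  (measurable_cst _) fcvg (Ni ltr01) fbd.
rewrite integral0 => cvgf.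
have {}cvgf : (\int[N]_z f n z) @[n --> \oo] --> (0 : R).
  by move/fine_cvgP : cvgf => [_].
have : (n.+1%:R^-1 * n.+1%:R^-1 * opnorm A + \int[N]_z f n z) @[n --> \oo] -->
   0 * 0 * opnorm A + 0.
  apply: cvgD => //; apply: cvgM; last exact: cvg_cst.
  by apply: cvgM; exact: cvg_harmonic.
rewrite mulr0 mul0r addr0 => /cvgrPdist_lt/(_ _ e0)[n _ /(_ n (leqnn n))] /=.
rewrite sub0r normrN -invfM -expr2 => hn; exists n.+1%:R => //.
exact: le_lt_trans (ler_norm _) hn.
Qed.

(** h decreases while r^2 h(r) increases, so h(y) lies between h(x) and h(x) x^2 / y^2. *)
Lemma hfun_continuous x : 0 < x -> {for x, continuous h}.
Proof.
move=> x0; rewrite /prop_for /continuous_at.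
pose e y : R := h x * `|x ^+ 2 / (y ^+ 2) - 1|.
have e0 : e y @[y --> x] --> 0.
  have -> : 0 = h x * `|x ^+ 2 / (x ^+ 2) - 1|.
    by rewrite divff ?sqrf_eq0 ?gt_eqF// subrr normr0 mulr0.
  apply: cvgM; first exact: cvg_cst.
  apply: cvg_norm; apply: cvgB; last exact: cvg_cst.
  apply: cvgM; first exact: cvg_cst.
  apply: cvgV; first by rewrite sqrf_eq0 gt_eqF.
  by rewrite expr2; under eq_cvg do rewrite expr2; apply: cvgM; exact: cvg_id.
apply: (@squeeze_cvgr _ _ _ _ (fun y => h x - e y) (fun y => h x + e y)).
- near=> y; have y0 : 0 < y by near: y; exact: lt_nbhsr.
  rewrite -ler_distl distrC ler_norml /e; have y20 : 0 < y ^+ 2 by rewrite exprn_gt0.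
  have [xy|yx] := leP x y.
    have := hfun_noninc x0 xy; have := hfun_scale x0 xy.
    rewrite mulrC -ler_pdivrMl// => h1 h2.
    have := ler_norm (- (x ^+ 2 / y ^+ 2 - 1)); rewrite normrN => h3.
    have := hfun_ge0 x => hx0.
    have : h x * - (x ^+ 2 / y ^+ 2 - 1) <= h x * `|x ^+ 2 / y ^+ 2 - 1|.
      exact: ler_wpM2l.
    by move: h1; rewrite mulrCA; move: (_ * `|_|) => w; lra.
  have := hfun_noninc y0 (ltW yx); have := hfun_scale y0 (ltW yx).
  rewrite -ler_pdivlMl// => h1 h2.
  have h3 := ler_norm (x ^+ 2 / y ^+ 2 - 1).
  have := hfun_ge0 x => hx0.
  have : h x * (x ^+ 2 / y ^+ 2 - 1) <= h x * `|x ^+ 2 / y ^+ 2 - 1|.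
    exact: ler_wpM2l.
  by move: h1; rewrite mulrA; move: (_ * `|_|) => w; lra.
- by rewrite -[X in _ --> X]subr0; apply: cvgB => //; exact: cvg_cst.
- by rewrite -[X in _ --> X]addr0; apply: cvgD => //; exact: cvg_cst.
Unshelve. all: by end_near. Qed.

Lemma hfun_surj u : 0 < u -> exists2 r, 0 < r & h r = u.
Proof.
move=> u0; have [b b0 hb] := hfun_vanish u0.
have [a /andP[a0 ab] ha] := hfun_unbounded u b0.
have [||c] := @IVT _ h a b u (ltW ab).
- apply: continuous_in_subspaceT => x; rewrite inE/= in_itv/= => /andP[ax _].
  by apply: hfun_continuous; exact: lt_le_trans ax.
- by rewrite ge_min le_max (ltW hb) (ltW ha) orbT.
rewrite in_itv/= => /andP[ac _] <-; exists c => //.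
exact: lt_le_trans ac.
Qed.

Lemma h_invP u : 0 < u -> 0 < h_inv A N u /\ h (h_inv A N u) = u.
Proof.
move=> u0; have [r r0 hr] := hfun_surj u0.
exact: (@xgetPex _ 0 [set r | 0 < r /\ h r = u] (ex_intro _ r (conj r0 hr))).
Qed.

Lemma h_invK r : 0 < r -> h_inv A N (h r) = r.
Proof.
by move=> r0; have [i0 hi] := h_invP (hfun_gt0 r0); exact: hfun_inj.
Qed.

End concentration_function.

(** * Conditions on the exponent *)

Section power_growth.
Variable R : realType.

Lemma powRE (a x : R) : 0 < a -> a `^ x = expR (x * ln a).
Proof. by move=> a0; rewrite /powR gt_eqF. Qed.

(** Geometric growth along the scales L^k becomes power growth of exponent ln g / ln L for a
    nondecreasing f. Capping the exponent at 2 only weakens the bound since lambda >= 1. P stands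
    for the range r > 1/T. *)
Lemma power_growth (P : R -> Prop) (f : R -> R) (c g L : R) :
  0 < c -> 1 < g -> 1 < L -> (forall r, P r -> 0 < r) ->
  (forall r s, P r -> r <= s -> P s) -> (forall r, P r -> 0 <= f r) ->
  (forall r s, P r -> r <= s -> f r <= f s) ->
  (forall k r, P r -> c * g ^+ k * f r <= f (L ^+ k * r)) ->
  exists alpha c' : R, [/\ 0 < alpha <= 2, 0 < c' <= 1 &
    forall lambda r, 1 <= lambda -> P r ->
      c' * lambda `^ alpha * f r <= f (lambda * r)].
Proof.
move=> c0 g1 L1 P0 PU f0 fnd fk.
have lng : 0 < ln g by rewrite ln_gt0.
have lnL : 0 < ln L by rewrite ln_gt0.
have Lp : 0 < L by lra.
have gp : 0 < g by lra.
pose al := Num.min 2 (ln g / ln L).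
have al0 : 0 < al by rewrite lt_min divr_gt0// andbT.
have alL : al * ln L <= ln g by rewrite -ler_pdivlMr// ge_min lexx orbT.
pose c' := Num.min 1 (c * expR (- (al * ln L))).
have c'0 : 0 < c' by rewrite lt_min ltr01 mulr_gt0 ?expR_gt0.
exists al, c'; split; first by rewrite al0 ge_min lexx.
  by rewrite c'0 ge_min lexx.
move=> l r l1 Pr; have lp : 0 < l by lra.
have lnl : 0 <= ln l by rewrite ln_ge0.
(* The largest k with L^k <= l; the factor e^{-al ln L} in [c'] pays for this rounding. *)
pose k := Num.truncn (ln l / ln L).
have [k1 k2] : k%:R * ln L <= ln l /\ ln l < k.+1%:R * ln L.
  have := truncn_itv (divr_ge0 lnl (ltW lnL)).
  by rewrite -/k ler_pdivlMr// ltr_pdivrMr// => /andP.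
have Lk : L ^+ k <= l.
  by rewrite -ler_ln ?posrE ?exprn_gt0// lnXn// -mulr_natl.
have r0 := P0 _ Pr.
have Lk1 : 1 <= L ^+ k by rewrite exprn_ege1// ltW.
apply: (le_trans _ (fnd _ _ _ (ler_wpM2r (ltW r0) Lk))); last first.
  by apply: PU Pr _; rewrite ler_peMl// ltW.
apply: (le_trans _ (fk k r Pr)); rewrite ler_wpM2r ?f0//.
apply: (@le_trans _ _ (c * expR (- (al * ln L)) * l `^ al)).
  by rewrite ler_wpM2r ?powR_ge0// ge_min lexx orbT.
rewrite -mulrA ler_wpM2l ?(ltW c0)// powRE// -expRD.
rewrite -[leRHS]lnK ?posrE ?exprn_gt0// ler_expR lnXn// -mulr_natl.
have : al * ln l <= al * (k.+1%:R * ln L) by rewrite ler_wpM2l// ltW.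
have e : al * (k.+1%:R * ln L) = k%:R * (al * ln L) + al * ln L.
  by rewrite -natr1; ring.
by rewrite e => h; rewrite [leLHS]addrC lerBlDr (le_trans h)// lerD2r ler_wpM2l.
Qed.

Lemma lt_inve_gt0 (T : \bar R) r : (0 < T)%E -> (T^-1 < r%:E)%E -> 0 < r.
Proof. by rewrite -lte_fin => T0; apply: le_lt_trans; rewrite inve_ge0 ltW. Qed.

End power_growth.

Section conditions_on_exponent.
Variables (R : realType) (d : nat) (d0 : (0 < d)%N).
Variables (A : 'M[R]_d) (N : {measure set 'rV[R]_d -> \bar R}) (b : 'rV[R]_d).
Hypothesis gt : generating_triplet A N.
Local Notation psi x := (complex.Re (Psi A N b x)).
Local Notation Psis := (Psi_star A N b).
Local Notation h := (hfun A N).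
Local Notation cP := (cPsi R d).

Lemma dir_conc_le_Psi_star x : 0 < enorm x ->
  dir_conc A N x <= cP * Psis (enorm x).
Proof.
move=> x0; have i0 : 0 < (enorm x)^-1 by rewrite invr_gt0.
apply: (le_trans (dir_conc_le_hfun gt i0 _)); first by rewrite invrK.
by apply: (le_trans (hfun_le_Psi_star b gt i0)); rewrite invrK.
Qed.

Lemma exists_enorm r : 0 <= r -> exists x : 'rV[R]_d, enorm x = r.
Proof.
move=> r0; exists (r *: unitv R (Ordinal d0)).
by rewrite enormZ enorm_unitv mulr1 ger0_norm.
Qed.

Lemma C3_C4 : C3 A N b -> C4 A N b.
Proof.
move=> [T [c [al [T0 /andP[c0 c1] /andP[al0 al2] ha hb]]]].
pose cc := cP; have cc0 : 0 < cc by exact: cPsi_gt0.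
(* At the scale l with l^al = w, (C3) gives psi(l x) >= c^2 w p for p = [Psi_star] at |x|, while
   psi(l x) <= 2 cc p + 2 l^2 [dir_trunc] x. As c^2 w >= 2 cc + 2, what remains is p <= l^2
   [dir_trunc] x. *)
pose w := Num.max 1 (2 * (cc + 1) / c ^+ 2).
have w1 : 1 <= w by rewrite le_max lexx.
have cw : 2 * (cc + 1) <= c ^+ 2 * w.
  by rewrite [leRHS]mulrC -ler_pdivrMr ?exprn_gt0// le_max lexx orbT.
pose l := w `^ al^-1.
have l1 : 1 <= l.
  by rewrite -(powRr0 w) ler_powR// invr_ge0 ltW.
have lal : l `^ al = w.
  by rewrite /l -powRrM mulVf ?gt_eqF// powRr1//; lra.
exists T, (l ^+ 2); split => //; first by rewrite exprn_ege1.
move=> x Tx; have x0 := lt_inve_gt0 T0 Tx.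
rewrite -/(dir_trunc A N x).
have lx : enorm (l *: x) = l * enorm x by rewrite enormZ ger0_norm//; lra.
have Tlx : (T^-1 < (enorm (l *: x))%:E)%E.
  by apply: (lt_le_trans Tx); rewrite lx lee_fin ler_peMl// ltW.
have P0 := Psi_star_ge0 b gt x0.
have := dir_concZ_le gt x l1.
have := RePsi_le_conc b gt (l *: x).
have := ha _ Tlx; rewrite lx.
have := hb _ _ l1 Tx; rewrite lal.
have := dir_conc_le_Psi_star x0; rewrite -/cc.
move: P0 cw; set p := Psis (enorm x); set q := Psis (l * enorm x).
move=> P0 cw h1 h2 h3 h4 h5.
have : c * (c * w * p) <= c * q by rewrite ler_wpM2l// ltW.
have : 2 * (cc + 1) * p <= c ^+ 2 * w * p by rewrite ler_wpM2r.
lra.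
Qed.

Lemma C4_C3 : C4 A N b -> C3 A N b.
Proof.
move=> [T [c [T0 c1 hc]]].
have cc0 : 1 <= cP.
  rewrite /cPsi lerDr; apply: addr_ge0; first by rewrite exprn_ge0 ?ler0n.
    by apply: mulr_ge0; exact: ler0n.
have c0 : 0 < c by lra.
have hpsi x : (T^-1 < (enorm x)%:E)%E -> Psis (enorm x) <= 8 * c * psi x.
  move=> /hc; rewrite -/(dir_trunc A N x) => /le_trans; apply.
  rewrite (mulrC 8) -mulrA ler_wpM2l ?(ltW c0)//; exact: dir_trunc_le_RePsi.
(* By (C4), [dir_trunc] at 2x is at least [dir_conc] at 2x divided by c cP. So the increment in
   [dir_conc_double_ge] is a fixed fraction th of the new value, and doubling multiplies [dir_conc]
   by at least g = 1 / (1 - th). *)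
pose th := 3 / 4 / (c * cP).
have th0 : 0 < th by rewrite !divr_gt0// mulr_gt0//; lra.
have th1 : th <= 3 / 4.
  rewrite /th ler_pdivrMr ?mulr_gt0//; last by lra.
  have : 1 <= c * cP by rewrite mulr_ege1.
  by lra.
pose g := (1 - th)^-1.
have g1 : 1 < g by rewrite invf_gt1; lra.
have growth x : (T^-1 < (enorm x)%:E)%E -> g * dir_conc A N x <= dir_conc A N (2 *: x).
  move=> Tx; have x0 := lt_inve_gt0 T0 Tx.
  rewrite mulrC ler_pdivrMr; last by lra.
  have e2 : enorm (2 *: x) = 2 * enorm x by rewrite enormZ ger0_norm.
  have := dir_conc_double_ge gt x.
  have := hc (2 *: x); rewrite -/(dir_trunc A N _) e2.
  have T2 : (T^-1 < (2 * enorm x)%:E)%E.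
    by apply: (lt_le_trans Tx); rewrite lee_fin; lra.
  move=> /(_ T2); have := @dir_conc_le_Psi_star (2 *: x); rewrite e2.
  move=> /(_ ltac:(lra)); set D := dir_conc A N (2 *: x).
  set p := Psis _; set K := dir_trunc _ _ _ => h1 h2 h3.
  have : th * D <= 3 / 4 * K.
    rewrite /th mulrAC ler_pdivrMr ?mulr_gt0//; last by lra.
    have : cP * p <= cP * (c * K) by rewrite ler_wpM2l//; lra.
    lra.
  lra.
(* The growth of [dir_conc] along one vector x of norm r is transferred to [Psi_star]: at r through
   psi <= 2 [dir_conc] and [hpsi], which cost 16 c, and at 2^k r through the factor cP. *)
have iter k r : (T^-1 < r%:E)%E ->
    (16 * c * cP)^-1 * g ^+ k * Psis r <= Psis (2 ^+ k * r).
  move=> Tr; have r0 := lt_inve_gt0 T0 Tr.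
  have [x xr] := exists_enorm (ltW r0).
  have k1 j : 1 <= 2 ^+ j :> R by rewrite exprn_ege1// ler1n.
  have ek j : enorm (2 ^+ j *: x) = 2 ^+ j * r by rewrite enormZ xr ger0_norm.
  have kr j : (T^-1 < (2 ^+ j * r)%:E)%E.
    by apply: (lt_le_trans Tr); rewrite lee_fin ler_peMl// ltW.
  have gD : g ^+ k * dir_conc A N x <= dir_conc A N (2 ^+ k *: x).
    elim: k => [|k IH]; first by rewrite !expr0 mul1r scale1r.
    rewrite !exprS -scalerA -mulrA; apply: le_trans (growth _ _); last by rewrite ek.
    by rewrite ler_wpM2l//; lra.
  have := @dir_conc_le_Psi_star (2 ^+ k *: x).
  rewrite ek => /(_ (lt_inve_gt0 T0 (kr k))) h1.
  have h2 := RePsi_le_conc b gt x; have := hpsi x; rewrite xr => /(_ Tr) h3.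
  rewrite -mulrA ler_pdivrMl ?mulr_gt0//; last by lra.
  have gk : 0 <= g ^+ k by rewrite exprn_ge0//; lra.
  apply: (@le_trans _ _ (g ^+ k * (16 * c * dir_conc A N x))).
    rewrite ler_wpM2l//; have : 8 * c * psi x <= 8 * c * (2 * dir_conc A N x).
      by rewrite ler_wpM2l// mulr_ge0// ltW.
    lra.
  have : 16 * c * (g ^+ k * dir_conc A N x) <= 16 * c * (cP * Psis (2 ^+ k * r)).
    by rewrite ler_wpM2l ?mulr_ge0 ?(ltW c0)//; apply: le_trans h1.
  lra.
have [al [c' [al02 c'01 hc']]] : exists al c' : R, [/\ 0 < al <= 2, 0 < c' <= 1 &
    forall l r, 1 <= l -> (T^-1 < r%:E)%E ->
      c' * l `^ al * Psis r <= Psis (l * r)].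
  apply: (@power_growth R (fun r => (T^-1 < r%:E)%E) Psis (16 * c * cP)^-1 g 2).
  - by rewrite invr_gt0 !mulr_gt0//; lra.
  - exact: g1.
  - by rewrite ltr1n.
  - by move=> r; exact: lt_inve_gt0.
  - by move=> r s /lt_le_trans + rs; apply; rewrite lee_fin.
  - by move=> r /(lt_inve_gt0 T0); exact: Psi_star_ge0.
  - by move=> r s /(lt_inve_gt0 T0); exact: le_Psi_star.
  - exact: iter.
exists T, (Num.min c' (8 * c)^-1), al; split => //.
- rewrite lt_min ge_min invr_gt0 mulr_gt0// andbT; lra.
- move=> x Tx; apply: (@le_trans _ _ ((8 * c)^-1 * Psis (enorm x))).
    rewrite ler_wpM2r ?ge_min ?lexx ?orbT//.
    by apply: Psi_star_ge0 => //; exact: lt_inve_gt0 Tx.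
  by rewrite ler_pdivrMl ?mulr_gt0// hpsi.
- move=> l r l1 Tr; apply: le_trans (hc' _ _ l1 Tr).
  rewrite !ler_wpM2r ?powR_ge0 ?ge_min ?lexx//.
  by apply: Psi_star_ge0 => //; exact: lt_inve_gt0 Tr.
Qed.

End conditions_on_exponent.

(** * Cauchy kernels *)

Section cauchy_kernel.
Variable R : realType.
Implicit Types eps u phi x y : R.
Local Notation leb := (@lebesgue_measure R).

(** The Fourier transform of e^{-eps |z|}, of total mass 2 pi. *)
Definition cauchyk eps x : R := 2 * eps / (eps ^+ 2 + x ^+ 2).

Let den_gt0 eps x : 0 < eps -> 0 < eps ^+ 2 + x ^+ 2.
Proof. by move=> e0; rewrite ltr_pwDl ?sqr_ge0// exprn_gt0. Qed.

Lemma cauchyk_ge0 eps x : 0 < eps -> 0 <= cauchyk eps x.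
Proof. by move=> e0; rewrite divr_ge0 ?(ltW (den_gt0 _ _))// mulr_ge0// ltW. Qed.

Lemma cauchyk_le eps x : 0 < eps -> cauchyk eps x <= 2 / eps.
Proof.
move=> e0; rewrite /cauchyk ler_pdivrMr ?den_gt0// mulrDr.
have -> : 2 / eps * eps ^+ 2 = 2 * eps by field; rewrite gt_eqF.
by rewrite lerDl mulr_ge0 ?sqr_ge0// divr_ge0// ltW.
Qed.

Lemma cauchykN eps x : cauchyk eps (- x) = cauchyk eps x.
Proof. by rewrite /cauchyk sqrrN. Qed.

Lemma continuous_cauchyk eps y : 0 < eps ->
  continuous (fun x => cauchyk eps (x - y)).
Proof.
move=> e0 x; apply: cvgM; first exact: cvg_cst.
apply: cvgV; first by rewrite gt_eqF// den_gt0.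
apply: cvgD; first exact: cvg_cst.
by rewrite expr2; under eq_cvg do rewrite expr2;
  apply: cvgM; apply: cvgB; do ?[exact: cvg_id|exact: cvg_cst].
Qed.

Lemma is_derive_affine (a c x : R) : is_derive x 1 (fun z => a * z + c) a.
Proof.
have -> : (fun z : R => a * z + c) = (a *: id) + cst c by [].
by apply: is_derive_eq; rewrite addr0 -[RHS]mulr1.
Qed.

Lemma is_derive_affine_comp (f : R -> R) (df a c x : R) :
  is_derive (a * x + c) 1 f df -> is_derive x 1 (fun z => f (a * z + c)) (df * a).
Proof.
move=> hf.
have := @is_derive1_comp _ f (fun z => a * z + c) x df a hf (is_derive_affine a c x).
exact.
Qed.

Lemma is_derive_cauchyk eps y x : 0 < eps ->
  is_derive x 1 (fun z => 2 * atan (eps^-1 * z - eps^-1 * y)) (cauchyk eps (x - y)).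
Proof.
move=> e0.
have h := is_derive_affine_comp (is_derive1_atan (eps^-1 * x - eps^-1 * y)).
have := is_deriveZ 2 h.
move=> h2; apply: (is_derive_eq h2).
rewrite /cauchyk -mulrBr /GRing.scale/=; field.
by rewrite !gt_eqF// den_gt0.
Qed.

(** Up to the factor eps^2 + u^2, an antiderivative of the damped cosine. The [+ 0] gives the
    exponent the affine shape that [is_derive_affine_comp] expects. *)
Lemma is_derive_damped eps u phi x :
  is_derive x 1 (fun z => expR (- eps * z + 0) *
     (u * sin (u * z + phi) - eps * cos (u * z + phi)))
   ((eps ^+ 2 + u ^+ 2) * (expR (- eps * x + 0) * cos (u * x + phi))).
Proof.
have dE := is_derive_affine_comp (is_derive_expR (- eps * x + 0)).
have ds := is_derive_affine_comp (is_derive_sin (u * x + phi)).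
have dc := is_derive_affine_comp (is_derive_cos (u * x + phi)).
have := is_deriveM dE (is_deriveB (is_deriveZ u ds) (is_deriveZ eps dc)).
move=> h; apply: (is_derive_eq h).
rewrite /GRing.scale/=.
have -> : (u \*: (fun z : R => sin (u * z + phi)) -
   eps \*: (fun z : R => cos (u * z + phi))) x =
   u * sin (u * x + phi) - eps * cos (u * x + phi) by [].
ring.
Qed.


Let cvg_damped0 eps u phi : 0 < eps ->
  (expR (- eps * z + 0) * (u * sin (u * z + phi) - eps * cos (u * z + phi)))
    @[z --> +oo] --> (0 : R).
Proof.
move=> e0.
have hexp : expR (- eps * z + 0) @[z --> +oo] --> (0 : R).
  under eq_cvg do rewrite addr0 mulNr.
  apply: (@cvg_comp _ _ _ (fun z => eps * z) (fun z => expR (- z))); last exact: cvgr_expR.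
  exact: gt0_cvgMry.
apply: (@squeeze_cvgr _ _ _ _ (fun z => - ((`|u| + eps) * expR (- eps * z + 0)))
  (fun z => (`|u| + eps) * expR (- eps * z + 0))).
- apply: nearW => z; rewrite -ler_norml normrM (ger0_norm (expR_ge0 _)) [leLHS]mulrC.
  rewrite ler_wpM2r ?expR_ge0// (le_trans (ler_normB _ _))// !normrM lerD//.
    by rewrite ler_piMr// sin_max.
  by rewrite (gtr0_norm e0) ler_piMr ?cos_max// ltW.
- rewrite -[X in _ --> X]oppr0; apply: cvgN.
  by rewrite -[X in _ --> X](mulr0 (`|u| + eps)); apply: cvgM => //; exact: cvg_cst.
- by rewrite -[X in _ --> X](mulr0 (`|u| + eps)); apply: cvgM => //; exact: cvg_cst.
Qed.

Let continuous_damped eps u phi : continuous (fun z : R =>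
  expR (- eps * z + 0) * (1 + cos (u * z + phi))).
Proof.
move=> z; have aff (a c : R) : a * z0 + c @[z0 --> z] --> a * z + c.
  by apply: cvgD; [apply: cvgM; [exact: cvg_cst|exact: cvg_id]|exact: cvg_cst].
apply: cvgM; first by apply: continuous_comp; [exact: aff|exact: continuous_expR].
apply: cvgD; first exact: cvg_cst.
by apply: continuous_comp; [exact: aff|exact: continuous_cos].
Qed.

Let integral0y_damped eps u phi : 0 < eps ->
  (\int[leb]_(z in `[0%R, +oo[) (expR (- eps * z + 0) * (1 + cos (u * z + phi)))%:E =
   (eps^-1 + (eps * cos phi - u * sin phi) / (eps ^+ 2 + u ^+ 2))%:E)%E.
Proof.
move=> e0; have de := den_gt0 u e0.
pose F (z : R) : R := - eps^-1 * expR (- eps * z + 0) + (eps ^+ 2 + u ^+ 2)^-1 *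
  (expR (- eps * z + 0) * (u * sin (u * z + phi) - eps * cos (u * z + phi))).
have dF (z : R) : is_derive z 1 F (expR (- eps * z + 0) * (1 + cos (u * z + phi))).
  have h1 := is_derive_affine_comp (is_derive_expR (- eps * z + 0)).
  have h2 := is_deriveZ ((eps ^+ 2 + u ^+ 2)^-1) (is_derive_damped eps u phi z).
  have := is_deriveD (is_deriveZ (- eps^-1) h1) h2.
  move=> h; apply: (is_derive_eq h); rewrite /GRing.scale/=; field.
  by rewrite !gt_eqF.
rewrite (@ge0_continuous_FTC2y _ _ F 0 0).
- rewrite -EFinB; congr EFin; rewrite /F sub0r !mulr0 !add0r expR0; field.
  by rewrite !gt_eqF.
- by move=> z _; rewrite mulr_ge0 ?expR_ge0//; have := cos_geN1 (u * z + phi); lra.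
- exact/continuous_subspaceT/continuous_damped.
- rewrite -[X in _ --> X](addr0) -[X in _ --> X + _](mulr0 (- eps^-1)).
  rewrite -[X in _ --> _ + X](mulr0 ((eps ^+ 2 + u ^+ 2)^-1)).
  apply: cvgD; apply: cvgM; do ?exact: cvg_cst; last exact: cvg_damped0.
  (* For u = phi = 0 the damped function is -eps e^{-eps z}, which yields the limit of the bare
     exponential. *)
  have := @cvg_damped0 eps 0 0 e0.
  under eq_cvg do rewrite !mul0r !addr0 cos0 add0r mulr1 -mulrN1.
  move=> /(cvgM (cvg_cst (- eps^-1))); rewrite mulr0.
  apply: cvg_trans; apply: near_eq_cvg; apply: nearW => z.
  rewrite -[LHS]/(- eps^-1 * (expR (eps * -1 * z) * (eps * -1))) addr0 mulrN1.
  by field; rewrite gt_eqF.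
- by move=> z _; exact: (@ex_derive _ _ _ _ _ _ _ (dF z)).
- apply: cvg_at_right_filter; apply: differentiable_continuous.
  by apply/derivable1_diffP; exact: (@ex_derive _ _ _ _ _ _ _ (dF 0)).
- by move=> z _; rewrite derive1E; exact: derive_val.
Qed.

Lemma ge0_integral_fold (f : R -> R) : measurable_fun setT f ->
  (forall x, 0 <= f x) ->
  (\int[leb]_x (f x)%:E = \int[leb]_(x in `[0%R, +oo[) (f x)%:E +
     \int[leb]_(x in `[0%R, +oo[) (f (- x))%:E)%E.
Proof.
move=> mf f0.
have mN : measurable_fun setT (fun x => f (- x)) by exact: measurableT_comp.
rewrite (@ge0_integration_by_substitution0 R (fun x => (f (- x))%:E))//; last 2 first.
- exact/measurable_EFinP.
- by move=> x; rewrite lee_fin.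
rewrite -(setUv (`[0%R, +oo[%classic : set R)) ge0_integral_setU//=; last 4 first.
- exact: measurableC.
- by rewrite setUv; exact/measurable_EFinP.
- by move=> x _; rewrite lee_fin.
- exact/disj_setPCl.
congr (_ + _)%E; rewrite setCitvr.
rewrite integral_itv_bndo_bndc; last exact/measurable_EFinP/measurable_funTS.
by apply: eq_integral => x _; rewrite opprK.
Qed.

(* Adding the constant 1 keeps the integrand nonnegative, and the phase makes
   the identity stable under integration of further variables. *)
Lemma integral_expR_cos eps u phi : 0 < eps ->
  (\int[leb]_z (expR (- eps * `|z|) * (1 + cos (z * u + phi)))%:E =
   (2 / eps + cauchyk eps u * cos phi)%:E)%E.
Proof.
move=> e0; have de := den_gt0 u e0.
rewrite ge0_integral_fold.
- transitivity (\int[leb]_(z in `[0%R, +oo[)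
       (expR (- eps * z + 0) * (1 + cos (u * z + phi)))%:E +
     \int[leb]_(z in `[0%R, +oo[)
       (expR (- eps * z + 0) * (1 + cos ((- u) * z + phi)))%:E)%E.
    congr (_ + _)%E; apply: eq_integral => z; rewrite inE/= in_itv/= andbT => z0.
      by rewrite ger0_norm// addr0 [z * u]mulrC.
    by rewrite normrN ger0_norm// addr0 (_ : - z * u = - u * z)//; ring.
  rewrite !integral0y_damped// -EFinD sqrrN; congr EFin; rewrite /cauchyk; field.
  by rewrite !gt_eqF.
- apply: measurable_funM.
    apply: (measurableT_comp (continuous_measurable_fun (@continuous_expR R))).
    by apply: measurable_funM => //; exact: measurableT_comp.
  apply: measurable_funD => //.
  apply: (measurableT_comp (continuous_measurable_fun (@continuous_cos R))).
  by apply: measurable_funD => //; apply: measurable_funM.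
- by move=> z; rewrite mulr_ge0 ?expR_ge0//; have := cos_geN1 (z * u + phi); lra.
Qed.

Lemma integral_itv_cauchyk eps y a b : 0 < eps -> a < b ->
  (\int[leb]_(x in `[a, b]) (cauchyk eps (x - y))%:E =
    (2 * (atan ((b - y) / eps) - atan ((a - y) / eps)))%:E)%E.
Proof.
move=> e0 ab.
have dF x := @is_derive_cauchyk eps y x e0.
rewrite (@continuous_FTC2 _ _ (fun z => 2 * atan (eps^-1 * z - eps^-1 * y)))//.
- by rewrite -EFinB -mulrBr -!mulrBr ![eps^-1 * _]mulrC.
- exact/continuous_subspaceT/continuous_cauchyk.
- have cF x : {for x, continuous (fun z => 2 * atan (eps^-1 * z - eps^-1 * y))}.
    apply: differentiable_continuous.
    by apply/derivable1_diffP; exact: (@ex_derive _ _ _ _ _ _ _ (dF x)).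
  split; first by move=> x _; exact: (@ex_derive _ _ _ _ _ _ _ (dF x)).
    by apply: cvg_at_right_filter; exact: cF.
  by apply: cvg_at_left_filter; exact: cF.
- by move=> x _; rewrite derive1E; exact: derive_val.
Qed.

Lemma integral_cauchyk_le eps y : 0 < eps ->
  (\int[leb]_x (cauchyk eps (x - y))%:E <= (2 * pi)%:E)%E.
Proof.
move=> e0.
have mk : measurable_fun setT (fun x => (cauchyk eps (x - y))%:E).
  apply/measurable_EFinP; apply: continuous_measurable_fun.
  exact: continuous_cauchyk.
have k0 x : (0 <= (cauchyk eps (x - y))%:E)%E by rewrite lee_fin cauchyk_ge0.
pose I (n : nat) := (`[- n.+1%:R, n.+1%:R]%classic : set R).
have UI : \bigcup_n I n = setT.
  apply/seteqP; split => // x _; exists (Num.truncn `|x|) => //=.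
  by rewrite /I /= in_itv/= -ler_norml ltW// truncnS_gt.
have ndI : {homo I : n m / (n <= m)%N >-> (n <= m)%O}.
  move=> n m nm; apply/subsetPset => x; rewrite /I /= !in_itv/= => /andP[xn nx].
  have : n.+1%:R <= m.+1%:R :> R by rewrite ler_nat.
  by move=> ?; apply/andP; split; lra.
have cI := @ge0_nondecreasing_set_cvg_integral _ (measurableTypeR R) R I
  (fun x => (cauchyk eps (x - y))%:E) leb ndI (fun n => measurable_itv _)
  (fun n => measurable_funTS mk) (fun n x _ => k0 x).
rewrite -UI -(cvg_lim _ cI)//.
apply: lime_le; first by apply/cvg_ex; eexists; exact: cI.
apply: nearW => n; rewrite integral_itv_cauchyk//; last first.
  by rewrite (@lt_trans _ _ 0)// ?oppr_lt0.
rewrite lee_fin ler_wpM2l//.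
have := atan_ltpi2 ((n.+1%:R - y) / eps).
by have := atan_gtNpi2 ((- n.+1%:R - y) / eps); lra.
Qed.

End cauchy_kernel.

Section lebesgue_rV_integral.
Variable R : realType.
Local Notation leb := (@lebesgue_measure R).

Lemma rV_cons0 n (p : R * 'rV[R]_n) : rV_cons p 0 ord0 = p.1.
Proof. by have := congr1 fst (rV_consK p). Qed.

Lemma rV_consS n (p : R * 'rV[R]_n) i : rV_cons p 0 (lift ord0 i) = p.2 0 i.
Proof. by have /rowP/(_ i) := congr1 snd (rV_consK p); rewrite mxE. Qed.

Lemma integral_rV0 (f : 'rV[R]_0 -> \bar R) : measurable_fun setT f ->
  (\int[lebesgue_rV R 0]_z f z)%E = f 0.
Proof. by move=> mf; rewrite /= integral_dirac// diracT mul1e. Qed.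

Lemma ge0_integral_rV_cons n (f : 'rV[R]_n.+1 -> \bar R) :
  measurable_fun setT f -> (forall z, 0 <= f z)%E ->
  (\int[lebesgue_rV R n.+1]_z f z =
   \int[leb]_x \int[lebesgue_rV R n]_v f (rV_cons (x, v)))%E.
Proof.
move=> mf f0.
have mfc : measurable_fun [set: measurableTypeR R * 'rV[R]_n] (f \o @rV_cons R n).
  apply: measurableT_comp => //; exact: measurable_rV_cons.
rewrite /= ge0_integral_pushforward//; last exact: measurable_rV_cons.
rewrite preimage_setT.
exact: (@fubini_tonelli1 _ _ (measurableTypeR R) _ R leb (lebesgue_rV R n)
  (f \o @rV_cons R n) mfc (fun p => f0 _)).
Qed.

Lemma integral_cube n (x : 'rV[R]_n) rho : 0 <= rho ->
  (\int[lebesgue_rV R n]_z (\1_(cube x rho) z)%:E = ((2 * rho) ^+ n)%:E)%E.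
Proof.
move=> r0; rewrite integral_indic//; last exact: measurable_cube.
by rewrite setIT; exact: lebesgue_cube.
Qed.

Lemma ge0_integral_rV_prod n (f : 'I_n -> R -> R) :
  (forall i, measurable_fun setT (f i)) -> (forall i x, 0 <= f i x) ->
  (\int[lebesgue_rV R n]_v (\prod_(i < n) f i (v 0 i))%:E =
   \prod_(i < n) \int[leb]_x (f i x)%:E)%E.
Proof.
elim: n f => [|n IH] f mf f0.
  rewrite integral_rV0; first by rewrite !big_ord0.
  by under eq_fun do rewrite big_ord0; exact: measurable_cst.
have mp k (g : 'I_k -> R -> R) : (forall i, measurable_fun setT (g i)) ->
    measurable_fun setT (fun v : 'rV[R]_k => (\prod_(i < k) g i (v 0 i))%:E).
  move=> mg; apply/measurable_EFinP; apply: measurable_prod => i _.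
  exact: measurableT_comp (mg i) (measurable_coord i).
rewrite ge0_integral_rV_cons//; last first.
- by move=> z; rewrite lee_fin prodr_ge0.
- exact: mp.
rewrite big_ord_recl -IH//.
rewrite -ge0_integralZr//; last 3 first.
- by apply/measurable_EFinP; exact: mf.
- by move=> x _; rewrite lee_fin.
- by apply: integral_ge0 => v _; rewrite lee_fin prodr_ge0.
apply: eq_integral => x _.
rewrite -ge0_integralZl_EFin//; last first.
- by apply: (mp n (fun i => f (lift ord0 i))).
- by move=> v _; rewrite lee_fin prodr_ge0.
apply: eq_integral => v _; rewrite -EFinM big_ord_recl rV_cons0/=.
by congr (_ * _)%:E; apply: eq_bigr => i _; rewrite rV_consS.
Qed.

End lebesgue_rV_integral.

Section product_kernel.
Variables (R : realType) (n : nat) (eps : R).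
Implicit Types u v y z : 'rV[R]_n.

Definition l1norm z : R := \sum_(i < n) `|z 0 i|.

Definition damp z : R := expR (- eps * l1norm z).

Definition pkernel u : R := \prod_(i < n) cauchyk eps (u 0 i).

Lemma l1norm_ge0 z : 0 <= l1norm z. Proof. exact: sumr_ge0. Qed.

Lemma damp_ge0 z : 0 <= damp z. Proof. exact: expR_ge0. Qed.

Lemma measurable_damp : measurable_fun setT damp.
Proof.
apply: (measurableT_comp (continuous_measurable_fun (@continuous_expR R))).
apply: measurable_funM => //; apply: measurable_sum => i.
by apply: measurableT_comp => //; exact: measurable_coord.
Qed.

Hypothesis e0 : 0 < eps.

Lemma damp_le1 z : damp z <= 1.
Proof.
by rewrite -expR0 ler_expR mulNr oppr_le0 mulr_ge0 ?l1norm_ge0// ltW.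
Qed.

Lemma pkernel_ge0 u : 0 <= pkernel u.
Proof. by apply: prodr_ge0 => i _; exact: cauchyk_ge0. Qed.

Lemma pkernel_le u : pkernel u <= (2 / eps) ^+ n.
Proof.
apply: (@le_trans _ _ (\prod_(i < n) (2 / eps))).
  by apply: ler_prod => i _; rewrite cauchyk_ge0// cauchyk_le.
by rewrite prodr_const card_ord.
Qed.

Lemma pkernelN u : pkernel (- u) = pkernel u.
Proof. by apply: eq_bigr => i _; rewrite mxE cauchykN. Qed.

Lemma measurable_pkernel : measurable_fun setT pkernel.
Proof.
apply: measurable_prod => i _.
apply: (@measurableT_comp _ _ _ _ _ _ (cauchyk eps) _ (fun v => v 0 i)).
  have -> : cauchyk eps = (fun x => cauchyk eps (x - 0)).
    by apply/funext => x; rewrite subr0.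
  by apply: continuous_measurable_fun; exact: continuous_cauchyk.
exact: measurable_coord.
Qed.

Lemma integral_pkernel_le y :
  (\int[lebesgue_rV R n]_v (pkernel (v - y))%:E <= ((2 * pi) ^+ n)%:E)%E.
Proof.
under eq_integral.
  move=> v _; rewrite (_ : pkernel (v - y) =
    \prod_(i < n) (fun x => cauchyk eps (x - y 0 i)) (v 0 i)); last first.
    by apply: eq_bigr => i _; rewrite !mxE.
  over.
rewrite (@ge0_integral_rV_prod R n (fun i x => cauchyk eps (x - y 0 i))).
- apply: (@le_trans _ _ (\prod_(i < n) (2 * pi)%:E)%E); last first.
    by rewrite -(big_morph EFin (@EFinM _) erefl) prodr_const card_ord.
  pose K (s t : \bar R) := (0 <= s)%E /\ (s <= t)%E.
  apply: (proj2 (_ : K _ _)); elim/big_ind2: _ => [|s1 t1 s2 t2|i _].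
  - by split.
  - by move=> [s10 h1] [s20 h2]; split; [exact: mule_ge0|exact: lee_pmul].
  - split; last exact: integral_cauchyk_le.
    by apply: integral_ge0 => x _; rewrite lee_fin cauchyk_ge0.
- by move=> i; apply: continuous_measurable_fun; exact: continuous_cauchyk.
- by move=> i x; exact: cauchyk_ge0.
Qed.

Lemma integral_box_pkernel (a b : 'I_n -> R) y : (forall i, a i < b i) ->
  (\int[lebesgue_rV R n]_(v in [set v : 'rV[R]_n | forall i, `[a i, b i]%classic (v 0%R i)])
     (pkernel (v - y))%:E =
   (\prod_(i < n) (2 * (atan ((b i - y 0 i) / eps) - atan ((a i - y 0 i) / eps))))%:E)%E.
Proof.
move=> ab; set B := [set v | _].
rewrite integral_mkcond.
under eq_integral.
  move=> v _; rewrite (_ : _ v = (\prod_(i < n) (fun x => cauchyk eps (x - y 0 i) *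
    \1_(`[a i, b i]%classic) x) (v 0 i))%:E); last first.
    rewrite patchE; case: ifPn.
      rewrite inE => Bv; congr EFin; apply: eq_bigr => i _.
      by rewrite !mxE indicE mem_set ?mulr1//; exact: Bv.
    rewrite notin_setE => nB; have [i ni] : exists i, ~ `[a i, b i]%classic (v 0 i).
      by apply/existsNP.
    by rewrite (bigD1 i)//= indicE memNset// mulr0 mul0r.
  over.
rewrite (@ge0_integral_rV_prod R n
  (fun i x => cauchyk eps (x - y 0 i) * \1_(`[a i, b i]%classic) x)).
- rewrite (big_morph EFin (@EFinM _) erefl); apply: eq_bigr => i _.
  rewrite -integral_itv_cauchyk// [RHS]integral_mkcond; apply: eq_integral => x _.
  by rewrite patchE indicE; case: ifPn => _; rewrite ?mulr1 ?mulr0.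
- move=> i; apply: measurable_funM; last exact: measurable_indic.
  by apply: continuous_measurable_fun; exact: continuous_cauchyk.
- by move=> i x; rewrite mulr_ge0 ?cauchyk_ge0// indicE.
Qed.

End product_kernel.

(** * Fourier transform of the damping factor in dimension n *)

Section damped_fourier.
Variables (R : realType).
Local Notation leb := (@lebesgue_measure R).

Lemma measurable_damp_cos n (eps phi : R) (u : 'rV[R]_n) : measurable_fun setT
  (fun z => damp eps z * (1 + cos (dotv z u + phi))).
Proof.
apply: measurable_funM; first exact: measurable_damp.
apply: measurable_funD => //.
apply: (measurableT_comp (continuous_measurable_fun (@continuous_cos R))).
apply: measurable_funD => //.
by under eq_fun do rewrite dotvC; exact: measurable_dotv.
Qed.

Lemma integral_damp_oneDcos n (eps phi : R) (u : 'rV[R]_n) : 0 < eps ->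
  (\int[lebesgue_rV R n]_z (damp eps z * (1 + cos (dotv z u + phi)))%:E =
   ((2 / eps) ^+ n + pkernel eps u * cos phi)%:E)%E.
Proof.
move=> e0; have pos k (z w : 'rV[R]_k) a : 0 <= damp eps z * (1 + cos (dotv z w + a)).
  by rewrite mulr_ge0 ?damp_ge0//; have := cos_geN1 (dotv z w + a); lra.
elim: n u phi => [|n IH] u phi.
  rewrite integral_rV0; last by apply/measurable_EFinP; exact: (@measurable_damp_cos _ eps).
  by rewrite /damp /l1norm /dotv /pkernel !big_ord0 mulr0 expR0 expr0 add0r !mul1r.
rewrite ge0_integral_rV_cons; last first.
- by move=> z; rewrite lee_fin.
- by apply/measurable_EFinP; exact: (@measurable_damp_cos _ eps).
pose u' : 'rV[R]_n := \row_i u 0 (lift ord0 i).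
have pk : pkernel eps u = cauchyk eps (u 0 ord0) * pkernel eps u'.
  rewrite /pkernel big_ord_recl; congr (_ * _); apply: eq_bigr => i _.
  by rewrite mxE.
set k := pkernel eps u' in pk *.
have k0 : 0 <= k by exact: pkernel_ge0.
have k1 : k <= (2 / eps) ^+ n by exact: pkernel_le.
have mexp : measurable_fun setT (fun x : R => expR (- eps * `|x|)).
  apply: (measurableT_comp (continuous_measurable_fun (@continuous_expR R))).
  by apply: measurable_funM => //; exact: measurableT_comp.
have mexpc : measurable_fun setT
    (fun x : R => expR (- eps * `|x|) * (1 + cos (x * u 0 ord0 + phi))).
  apply: measurable_funM => //; apply: measurable_funD => //.
  apply: (measurableT_comp (continuous_measurable_fun (@continuous_cos R))).
  by apply: measurable_funD => //; apply: measurable_funM.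
(* The inner integral, with x u_0 absorbed into the phase, is (2/eps)^n + k cos. Rewritten as
   ((2/eps)^n - k) + k (1 + cos) it has two nonnegative terms, because k <= (2/eps)^n, and both are
   one-dimensional integrals already known. *)
transitivity (\int[leb]_x (((2 / eps) ^+ n - k)%:E * (expR (- eps * `|x|))%:E +
   k%:E * (expR (- eps * `|x|) * (1 + cos (x * u 0 ord0 + phi)))%:E))%E.
  apply: eq_integral => x _.
  transitivity (\int[lebesgue_rV R n]_v ((expR (- eps * `|x|))%:E *
      (damp eps v * (1 + cos (dotv v u' + (x * u 0 ord0 + phi))))%:E))%E.
    apply: eq_integral => v _; rewrite -EFinM mulrA; congr (_ * (1 + cos _))%:E.
      rewrite /damp /l1norm big_ord_recl rV_cons0 -expRD -mulrDr.
      by under eq_bigr do rewrite rV_consS.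
    rewrite /dotv big_ord_recl rV_cons0 addrA; congr (_ + _).
    rewrite addrC; congr (_ + _).
    by apply: eq_bigr => i _; rewrite rV_consS mxE.
  rewrite ge0_integralZl_EFin ?expR_ge0//; last 2 first.
  - by move=> v _; rewrite lee_fin.
  - by apply/measurable_EFinP; exact: (@measurable_damp_cos _ eps).
  by rewrite IH -/k -!EFinM -EFinD; congr EFin; ring.
have c0 x : 0 <= expR (- eps * `|x|) * (1 + cos (x * u 0 ord0 + phi)).
  by rewrite mulr_ge0 ?expR_ge0//; have := cos_geN1 (x * u 0 ord0 + phi); lra.
rewrite ge0_integralD//; last first.
- by apply/measurable_EFinP; exact: measurable_funM.
- by move=> x _; rewrite -EFinM lee_fin mulr_ge0.
- by apply/measurable_EFinP; exact: measurable_funM.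
- by move=> x _; rewrite -EFinM lee_fin mulr_ge0 ?expR_ge0 ?subr_ge0.
rewrite !ge0_integralZl_EFin ?subr_ge0//;
  try by [exact/measurable_EFinP|move=> x _; rewrite lee_fin ?expR_ge0].
rewrite integral_expR_cos//.
have -> : (\int[leb]_x (expR (- eps * `|x|))%:E = (2 / eps)%:E)%E.
  have := @integral_expR_cos R eps 0 (pi / 2) e0.
  rewrite cos_pihalf mulr0 addr0 => <-; apply: eq_integral => x _.
  by rewrite mulr0 add0r cos_pihalf addr0 mulr1.
by rewrite -!EFinM -EFinD pk exprS; congr EFin; ring.
Qed.

Lemma integral_damp n (eps : R) : 0 < eps ->
  (\int[lebesgue_rV R n]_z (damp eps z)%:E = ((2 / eps) ^+ n)%:E)%E.
Proof.
move=> e0; have := @integral_damp_oneDcos n eps (pi / 2) 0 e0.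
rewrite cos_pihalf mulr0 addr0 => <-; apply: eq_integral => z _.
by rewrite dotv0 add0r cos_pihalf addr0 mulr1.
Qed.

Lemma integrable_damp n (eps : R) : 0 < eps ->
  (lebesgue_rV R n).-integrable setT (EFin \o damp eps).
Proof.
move=> e0; apply/integrableP; split; first by apply/measurable_EFinP; exact: measurable_damp.
under eq_integral do rewrite /= ger0_norm ?damp_ge0//.
by rewrite integral_damp// ltry.
Qed.

Lemma integrable_dampM n (eps : R) (f : 'rV[R]_n -> R) : 0 < eps ->
  measurable_fun setT f -> (forall z, `|f z| <= 1) ->
  (lebesgue_rV R n).-integrable setT (EFin \o (fun z => damp eps z * f z)).
Proof.
move=> e0 mf f1; apply: le_integrable_EFin (integrable_damp n e0).
  by apply: measurable_funM => //; exact: measurable_damp.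
by move=> z; rewrite normrM ger0_norm ?damp_ge0// ler_piMr// damp_ge0.
Qed.

Lemma Rintegral_damp_cos n (eps phi : R) (u : 'rV[R]_n) : 0 < eps ->
  \int[lebesgue_rV R n]_z (damp eps z * cos (dotv z u + phi)) =
  pkernel eps u * cos phi.
Proof.
move=> e0.
have mc : measurable_fun setT (fun z : 'rV[R]_n => cos (dotv z u + phi)).
  apply: (measurableT_comp (continuous_measurable_fun (@continuous_cos R))).
  apply: measurable_funD => //.
  by under eq_fun do rewrite dotvC; exact: measurable_dotv.
have ic := integrable_dampM e0 mc (fun z => cos_max _).
have := @RintegralD _ _ _ (lebesgue_rV R n) setT (damp eps)
  (fun z => damp eps z * cos (dotv z u + phi)) measurableT (integrable_damp n e0) ic.
rewrite {2}/Rintegral integral_damp//= /Rintegral.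
under eq_integral do rewrite -{1}[damp eps _]mulr1 -mulrDr.
by rewrite integral_damp_oneDcos//= => /addrI.
Qed.

End damped_fourier.

(** * Integral conditions *)

Section integral_conditions.
Variables (R : realType) (d : nat) (d0 : (0 < d)%N).
Variables (A : 'M[R]_d) (N : {measure set 'rV[R]_d -> \bar R}) (b : 'rV[R]_d).
Hypothesis gt : generating_triplet A N.
Local Notation psi x := (complex.Re (Psi A N b x)).
Local Notation Psis := (Psi_star A N b).
Local Notation h := (hfun A N).
Local Notation hinv := (h_inv A N).
Local Notation cP := (cPsi R d).
Hypothesis hoo : h r @[r --> 0^'+] --> +oo.
Hypothesis mpsi : measurable_fun setT (fun x => psi x).

Let mexp t : measurable_fun setT (fun z => expR (- (t * psi z))).
Proof.
apply: (measurableT_comp (continuous_measurable_fun (@continuous_expR R))).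
by apply: measurableT_comp => //; apply: measurable_funM.
Qed.

Let mexpm t m : measurable_fun setT (fun z => enorm z ^+ m * expR (- (t * psi z))).
Proof.
by apply: measurable_funM => //; apply: measurable_funX; exact: measurable_enorm.
Qed.

(** The n-th power of e^{-x/n} <= n/x. *)
Lemma expRN_le_pow (n : nat) (x : R) : (0 < n)%N -> 0 < x ->
  expR (- x) <= (n%:R / x) ^+ n.
Proof.
move=> n0 x0; have n0' : 0 < n%:R :> R by rewrite ltr0n.
have <- : expR (- (x / n%:R)) ^+ n = expR (- x).
  by rewrite -expRM_natl mulrN mulrC divfK// gt_eqF.
rewrite ler_pXn2r ?nnegrE ?expR_ge0 ?divr_ge0 ?(ltW x0)//.
rewrite expRN -(invf_div x) lef_pV2 ?posrE ?expR_gt0 ?divr_gt0//.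
by apply: le_trans (expR_ge1Dx _); rewrite lerDr.
Qed.

Lemma pkernel_ge rho (z : 'rV[R]_d) : 0 < rho ->
  (2 * rho / (rho ^+ 2 + enorm z ^+ 2)) ^+ d <= pkernel rho z.
Proof.
move=> r0; rewrite -[X in _ ^+ X]card_ord -prodr_const; apply: ler_prod => i _.
have p0 (x : R) : 0 < rho ^+ 2 + x ^+ 2 by rewrite ltr_pwDl ?sqr_ge0// exprn_gt0.
rewrite divr_ge0 ?(ltW (p0 _)) ?mulr_ge0 ?(ltW r0)//=.
rewrite ler_wpM2l ?mulr_ge0 ?(ltW r0)// lef_pV2 ?posrE// lerD2l.
rewrite -(real_normK (num_real (z 0 i))) ler_pXn2r ?nnegrE ?enorm_ge0//.
exact: coord_le_enorm.
Qed.

(** An integer n with al n >= m + 2 d: the n-th power bound of the exponential then decays like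
    |z|^(-m - 2 d), enough to absorb |z|^m and to stay below the product of d Cauchy kernels. *)
Definition C5_exponent m (al : R) : nat := (Num.truncn ((m + 2 * d)%:R / al)).+1.

(** The quotient c^2 / cP is the coefficient in the lower bound of t psi; the summand 1 serves |z|
    <= rho, the n-th power serves |z| > rho, and (2 pi)^d is the mass of the kernel. *)
Definition C5_constant m (al c : R) : R :=
  (1 + ((C5_exponent m al)%:R / (c ^+ 2 / cP)) ^+ C5_exponent m al) *
  (2 * pi) ^+ d.

Lemma C5_constant_gt0 m al c : 0 < c -> 0 < C5_constant m al c.
Proof.
move=> c0; rewrite mulr_gt0 ?exprn_gt0 ?mulr_gt0 ?pi_gt0// ltr_pwDl//.
by rewrite exprn_ge0// !divr_ge0// ?sqr_ge0// ltW// cPsi_gt0.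
Qed.

Lemma C3_C5 T al c m : C3_with A N b T c al ->
  C5_with A N b (hfun_ext A N T)^-1%E m (C5_constant m al c).
Proof.
move=> [T0 /andP[c0 c1] /andP[al0 al2] ha hb] t t0 tT.
have it0 : 0 < t^-1 by rewrite invr_gt0.
have [r0 hr] := h_invP gt hoo it0; set r := hinv t^-1 in r0 hr *.
pose rho := r^-1; have rho0 : 0 < rho by rewrite invr_gt0.
(* t < 1/h(T) means h(T) < 1/t = h(r), that is r < T. For T infinite the conventions h(oo) = 0 and
   1/oo = 0 leave only rho > 0. *)
have Trho : (T^-1 < rho%:E)%E.
  case: T T0 tT {ha hb} => [s||] //=.
  rewrite lte_fin => s0 tT; rewrite inver gt_eqF// lte_fin ltf_pV2 ?posrE//.
  rewrite -(ltr_hfun gt hoo)// hr; move: tT.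
  rewrite inver gt_eqF ?(hfun_gt0 gt hoo)// lte_fin.
  by rewrite -[X in X < _]invrK ltf_pV2 ?posrE// hfun_gt0.
pose k := c ^+ 2 / cP; have k0 : 0 < k by rewrite divr_gt0 ?exprn_gt0 ?cPsi_gt0.
(* Each half of (C3) contributes a factor c, and 1/t = h(r) <= cP [Psi_star] rho contributes
   1/cP. *)
have low z : rho <= enorm z -> k * (enorm z / rho) `^ al <= t * psi z.
  move=> rz; have z0 : 0 < enorm z by exact: lt_le_trans rz.
  have Tz : (T^-1 < (enorm z)%:E)%E by apply: (lt_le_trans Trho); rewrite lee_fin.
  pose l := enorm z / rho; have l1 : 1 <= l by rewrite ler_pdivlMr// mul1r.
  have := ha z Tz; have := hb l rho l1 Trho.
  have -> : l * rho = enorm z by rewrite /l divfK// gt_eqF.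
  rewrite -/l => h1 h2.
  have := hfun_le_Psi_star b gt r0; rewrite hr -/rho => h3.
  have la0 : 0 <= l `^ al by exact: powR_ge0.
  rewrite -ler_pdivrMl// /k mulrC.
  apply: le_trans h2; apply: (le_trans _ (ler_wpM2l (ltW c0) h1)).
  have -> : c ^+ 2 / cP * l `^ al / t = c ^+ 2 * l `^ al * (t^-1 / cP) by ring.
  have -> : c * (c * l `^ al * Psis rho) = c ^+ 2 * l `^ al * Psis rho by ring.
  rewrite ler_wpM2l ?(mulr_ge0 (sqr_ge0 _) la0)//.
  by rewrite ler_pdivrMr ?cPsi_gt0// mulrC.
pose n := C5_exponent m al.
have nk0 : 0 <= n%:R / k by rewrite mulr_ge0 ?invr_ge0 ?(ltW k0).
pose C := 1 + (n%:R / k) ^+ n.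
have nal : (m + 2 * d)%:R <= al * n%:R.
  by rewrite mulrC -ler_pdivrMr// ltW// truncnS_gt.
have C1 : 1 <= C by rewrite lerDl exprn_ge0.
have dom z : enorm z ^+ m * expR (- (t * psi z)) <=
    C * rho ^+ (m + d) * pkernel rho z.
  apply: le_trans (ler_wpM2l _ (pkernel_ge z rho0)); last first.
    by rewrite mulr_ge0 ?exprn_ge0 ?(ltW rho0)//; lra.
  have [u uE] : exists u, u = enorm z / rho by exists (enorm z / rho).
  have u0 : 0 <= u by rewrite uE divr_ge0 ?enorm_ge0// ltW.
  have -> : enorm z = u * rho by rewrite uE divfK// gt_eqF.
  have u21 : 0 < 1 + u ^+ 2 by rewrite ltr_pwDl ?sqr_ge0.
  have -> : C * rho ^+ (m + d) * (2 * rho / (rho ^+ 2 + (u * rho) ^+ 2)) ^+ d =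
      rho ^+ m * (C * (2 / (1 + u ^+ 2)) ^+ d).
    have -> : 2 * rho / (rho ^+ 2 + (u * rho) ^+ 2) = 2 / (1 + u ^+ 2) / rho.
      by field; rewrite !gt_eqF//= exprMn -[X in X + _]mul1r -mulrDl mulr_gt0 ?exprn_gt0.
    rewrite [(_ / rho) ^+ d]exprMn exprD (exprVn rho d).
    have := expf_neq0 d (lt0r_neq0 rho0).
    by move: (rho ^+ d) (rho ^+ m) ((2 / _) ^+ d) => rd rm w rd0; field.
  rewrite exprMn [_ ^+ m * _ ^+ m]mulrC -mulrA ler_wpM2l ?exprn_ge0 ?(ltW rho0)//.
  rewrite (exprMn d 2) (exprVn (1 + u ^+ 2)) [leRHS]mulrA ler_pdivlMr ?exprn_gt0//.
  have tp0 : 0 <= t * psi z by rewrite mulr_ge0 ?(ltW t0) ?RePsi_ge0.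
  (* In the scaled variable u = |z| / rho the case u <= 1 needs only C >= 1. For u > 1 the decay
     u^(-m - 2 d) cancels u^m and dominates (1 + u^2)^d <= (2 u^2)^d. *)
  have [u1|u1] := leP u 1.
    apply: (@le_trans _ _ (1 * 2 ^+ d)); last by rewrite ler_wpM2r// exprn_ge0.
    rewrite ler_pM ?mulr_ge0 ?exprn_ge0 ?expR_ge0 ?(ltW u21)//.
      rewrite mulr_ile1 ?exprn_ge0 ?expR_ge0 ?exprn_ile1//.
      by rewrite -expR0 ler_expR oppr_le0.
    rewrite ler_pXn2r ?nnegrE ?(ltW u21)//.
    by have : u ^+ 2 <= 1 by [rewrite exprn_ile1]; lra.
  have up : 0 < u by lra.
  have e1 : expR (- (t * psi z)) <= (n%:R / k) ^+ n / u ^+ (m + 2 * d).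
    apply: (@le_trans _ _ (expR (- (k * u `^ al)))).
      rewrite ler_expR lerN2 uE low//.
      by move: u1; rewrite uE ltr_pdivlMr// mul1r => /ltW.
    have ua : 0 < u `^ al by rewrite powR_gt0.
    have n0 : (0 < n)%N by [].
    apply: (le_trans (expRN_le_pow n0 (mulr_gt0 k0 ua))).
    rewrite invfM mulrA [leLHS]exprMn ler_wpM2l ?(exprn_ge0 _ nk0)//.
    rewrite exprVn lef_pV2 ?posrE ?exprn_gt0//.
    rewrite -!powR_mulrn ?powR_ge0//.
    by rewrite -powRrM ler_powR// ltW.
  apply: (@le_trans _ _ ((n%:R / k) ^+ n * 2 ^+ d)); last first.
    by rewrite ler_wpM2r ?exprn_ge0// /C lerDr.
  apply: (@le_trans _ _ (u ^+ m * ((n%:R / k) ^+ n / u ^+ (m + 2 * d)) *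
      (2 * u ^+ 2) ^+ d)).
    rewrite ler_pM ?mulr_ge0 ?exprn_ge0 ?expR_ge0 ?(ltW u21)//.
      by rewrite ler_wpM2l ?exprn_ge0.
    rewrite ler_pXn2r ?nnegrE ?mulr_ge0 ?sqr_ge0 ?(ltW u21)//.
    by have : 1 <= u ^+ 2 by [rewrite exprn_ege1// ltW]; lra.
  rewrite (exprMn d 2) -(exprM u 2) exprD le_eqVlt; apply/orP; left; apply/eqP.
  have := expf_neq0 m (lt0r_neq0 up); have := expf_neq0 (2 * d) (lt0r_neq0 up).
  by move: (u ^+ m) (u ^+ (2 * d)) => um ud ? ?; field; apply/andP.
have pk : measurable_fun setT (EFin \o (fun z : 'rV[R]_d => pkernel rho z)).
  by apply/measurable_EFinP; exact: measurable_pkernel.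
apply: (@le_trans _ _ (\int[lebesgue_rV R d]_z ((C * rho ^+ (m + d))%:E * (pkernel rho z)%:E))%E).
  apply: ge0_le_integral => //.
  - by move=> z _; rewrite lee_fin mulr_ge0 ?expR_ge0 ?exprn_ge0 ?enorm_ge0.
  - exact/measurable_EFinP.
  - by apply/measurable_EFinP; apply: measurable_funM => //; exact: measurable_pkernel.
  - by move=> z _; rewrite -EFinM lee_fin dom.
have C0 : 0 <= C * rho ^+ (m + d) by rewrite mulr_ge0 ?exprn_ge0 ?(ltW rho0)//; lra.
rewrite ge0_integralZl_EFin//; last first.
  by move=> z _; rewrite lee_fin pkernel_ge0.
have pk2 : (\int[lebesgue_rV R d]_z (pkernel rho z)%:E <= ((2 * pi) ^+ d)%:E)%E.
  apply: le_trans (integral_pkernel_le rho0 0).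
  by rewrite le_eqVlt; apply/orP; left; apply/eqP/eq_integral => z _; rewrite subr0.
apply: (@le_trans _ _ ((C * rho ^+ (m + d))%:E * ((2 * pi) ^+ d)%:E)%E).
  by apply: lee_wpmul2l => //; rewrite lee_fin.
rewrite -EFinM lee_fin /C5_constant -/n -/k -/C addnC exprVn.
by rewrite le_eqVlt; apply/orP; left; apply/eqP; ring.
Qed.

Lemma C5_some_C2 : C5_some A N b -> C2 A N b.
Proof.
move=> [T T0 [m m0 [c c0 hc]]].
exists T, (2 ^+ d + c); split => //; first by rewrite addr_gt0// exprn_gt0.
move=> t t0 tT; have := hc t t0 tT.
have it0 : 0 < t^-1 by rewrite invr_gt0.
have [r0 hr] := h_invP gt hoo it0; set r := hinv t^-1 in r0 hr *.
pose rho := r^-1; have rho0 : 0 < rho by rewrite invr_gt0.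
move=> hm.
apply: (@le_trans _ _ (\int[lebesgue_rV R d]_z ((\1_(cube 0 rho) z)%:E +
    (rho ^- m)%:E * (enorm z ^+ m * expR (- (t * psi z)))%:E))%E).
  apply: ge0_le_integral => //.
  - exact/measurable_EFinP.
  - apply: emeasurable_funD.
      by apply/measurable_EFinP; apply: measurable_indic; exact: measurable_cube.
    by apply/measurable_EFinP; apply: measurable_funM.
  - move=> z _; rewrite -EFinM -EFinD lee_fin.
    have [zr|rz] := leP (enorm z) rho.
      rewrite indicE mem_set; last exact: enorm_ball_cube.
      apply: (@le_trans _ _ 1).
        by rewrite -expR0 ler_expR oppr_le0 mulr_ge0 ?(ltW t0) ?RePsi_ge0.
      by rewrite lerDl !mulr_ge0 ?invr_ge0 ?exprn_ge0 ?enorm_ge0 ?expR_ge0 ?(ltW rho0).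
    rewrite -[leLHS]add0r lerD ?indicE// mulrA ler_peMl ?expR_ge0//.
    rewrite mulrC ler_pdivlMr ?exprn_gt0// mul1r.
    by rewrite ler_pXn2r ?nnegrE ?enorm_ge0// ltW.
rewrite ge0_integralD//; last first.
- by apply/measurable_EFinP; apply: measurable_funM.
- by move=> z _; rewrite -EFinM lee_fin !mulr_ge0 ?invr_ge0 ?exprn_ge0 ?enorm_ge0
    ?expR_ge0 ?(ltW rho0).
- by apply/measurable_EFinP; apply: measurable_indic; exact: measurable_cube.
rewrite integral_cube ?(ltW rho0)//.
rewrite ge0_integralZl_EFin ?invr_ge0 ?exprn_ge0 ?(ltW rho0)//; last first.
- exact/measurable_EFinP.
- by move=> z _; rewrite lee_fin mulr_ge0 ?exprn_ge0 ?enorm_ge0 ?expR_ge0.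
rewrite [(2 ^+ d + c) / _]mulrDl EFinD; apply: leeD.
  by rewrite lee_fin exprMn exprVn.
apply: (@le_trans _ _ ((rho ^- m)%:E * (c * r ^- (d + m))%:E)%E).
  by rewrite lee_wpmul2l// lee_fin invr_ge0 exprn_ge0// ltW.
rewrite -EFinM lee_fin /rho exprVn invrK exprD invfM.
rewrite le_eqVlt; apply/orP; left; apply/eqP; field.
by rewrite !expf_neq0// gt_eqF.
Qed.

End integral_conditions.

(** * From integrability to (C3), by volume comparison *)

Section lower_bounds_from_integrability.
Variables (R : realType) (d : nat) (d0 : (0 < d)%N).
Variables (A : 'M[R]_d) (N : {measure set 'rV[R]_d -> \bar R}) (b : 'rV[R]_d).
Hypothesis gt : generating_triplet A N.
Local Notation psi x := (complex.Re (Psi A N b x)).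
Local Notation Psis := (Psi_star A N b).
Local Notation h := (hfun A N).
Local Notation hinv := (h_inv A N).
Hypothesis hoo : h r @[r --> 0^'+] --> +oo.
Hypothesis mpsi : measurable_fun setT (fun x => psi x).
Local Notation leb := (lebesgue_rV R d).

Let mexp t : measurable_fun setT (fun z => expR (- (t * psi z))).
Proof.
apply: (measurableT_comp (continuous_measurable_fun (@continuous_expR R))).
by apply: measurableT_comp => //; apply: measurable_funM.
Qed.

Let integral_cubes_ge (n : nat) (y : 'I_n -> 'rV[R]_d) rho s q : 0 <= rho ->
  trivIset setT (fun k => cube (y k) rho) ->
  (forall k z, cube (y k) rho z -> s * psi z <= q) ->
  ((n%:R * ((2 * rho) ^+ d * expR (- q)))%:E <=
     \int[leb]_z (expR (- (s * psi z)))%:E)%E.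
Proof.
move=> rho0 triv sq.
have e0 z : (0 <= (expR (- (s * psi z)))%:E)%E by rewrite lee_fin expR_ge0.
have mE : measurable_fun setT (fun z => (expR (- (s * psi z)))%:E).
  exact/measurable_EFinP.
have mC k : measurable (cube (y k) rho) by exact: measurable_cube.
apply: (@le_trans _ _ (\sum_(k <- index_enum 'I_n)
    \int[leb]_(z in cube (y k) rho) (expR (- (s * psi z)))%:E)%E).
  apply: (@le_trans _ _ (\sum_(k < n) ((2 * rho) ^+ d * expR (- q))%:E)%E).
    by rewrite sumEFin sumr_const card_ord mulr_natl.
  apply: lee_sum => k _.
  apply: (@le_trans _ _ (\int[leb]_(z in cube (y k) rho) (cst (expR (- q))%:E z))%E).
    rewrite integral_cst// [X in (_ <= _ * X)%E](lebesgue_cube _ rho0).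
    by rewrite -EFinM mulrC.
  apply: ge0_le_integral => //.
  - by move=> z _; rewrite lee_fin expR_ge0.
  - exact: measurable_funTS.
  - by move=> z Cz; rewrite lee_fin ler_expR lerN2; exact: sq Cz.
rewrite -ge0_integral_bigsetU//.
- apply: ge0_subset_integral => //; exact: bigsetU_measurable.
- exact: index_enum_uniq.
- by apply: sub_trivIset triv.
- exact: measurable_funTS.
Qed.

Lemma C2half_C3 (T c : R) : 0 < T -> 0 < c ->
  (forall t, 0 < t < T ->
     (\int[leb]_z (expR (- (2 * t * psi z)))%:E <= (c * hinv t^-1 ^- d)%:E)%E) ->
  C3 A N b.
Proof.
move=> T0 c0 hT.
have quarter (u : R) : 0 < u -> u / 4 <= u by move=> ?; lra.
(* The arithmetic behind the exponent 9 used below, with H = h(1/r): psi(z) <= 2 m^2 psi(x) + 4 H <=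
   H/2 + 4 H. *)
have combine (pz pk py kp mp H : R) : pz <= 2 * pk + 2 * py -> pk <= kp -> kp <= mp ->
    py <= 2 * H -> 8 * mp < 2 * H -> 2 * pz <= 9 * H by move=> ? ? ? ? ?; lra.
have iT0 : 0 < T^-1 by rewrite invr_gt0.
have [s0 hs] := h_invP gt hoo iT0; set s := hinv T^-1 in s0 hs.
have is0 : 0 < s^-1 by rewrite invr_gt0.
pose P r := ((s%:E)^-1 < r%:E)%E.
have PE r : P r = (s^-1 < r) :> Prop.
  by rewrite /P inver gt_eqF// lte_fin.
have P0 r : P r -> 0 < r by rewrite PE; apply: lt_trans.
have PU r r' : P r -> r <= r' -> P r' by rewrite !PE; exact: lt_le_trans.
(* The hypothesis at t = 1/h(1/r), where h^{-1}(1/t)^{-d} is r^d. *)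
have hP r : P r -> (\int[leb]_z (expR (- (2 / h r^-1 * psi z)))%:E <= (c * r ^+ d)%:E)%E.
  move=> Pr; have r0 := P0 _ Pr; have ir0 : 0 < r^-1 by rewrite invr_gt0.
  have hr0 := hfun_gt0 gt hoo ir0.
  have := hT (h r^-1)^-1; rewrite invrK (h_invK gt hoo)// exprVn invrK; apply.
  rewrite invr_gt0 hr0/= -[X in _ < X]invrK ltf_pV2 ?posrE// -hs ltr_hfun//.
  by rewrite -[X in _ < X]invrK ltf_pV2 ?posrE//; rewrite -PE.
pose e8 : R := expR 8.
pose dR : R := d%:R; have dR1 : 1 <= dR by rewrite ler1n.
(* If [Psi_star] at L r were below 2 [Psi_star] r <= 4 h(1/r), the exponent would be at most 8 on
   the cube of half-side L r / d. Its volume (2 (2 + c e^8) r)^d is chosen to exceed c e^8 r^d,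
   against [hP]. *)
pose L := dR * (2 + c * e8).
have ce : 0 < c * e8 by rewrite mulr_gt0 ?expR_gt0.
have L1 : 1 < L.
  have : 1 * (2 + c * e8) <= dR * (2 + c * e8) by rewrite ler_wpM2r//; lra.
  by rewrite /L; lra.
have double r : P r -> 2 * Psis r <= Psis (L * r).
  move=> Pr; have r0 := P0 _ Pr; have ir0 : 0 < r^-1 by rewrite invr_gt0.
  have hr0 := hfun_gt0 gt hoo ir0.
  have Lr0 : 0 < L * r by rewrite mulr_gt0//; lra.
  rewrite leNgt; apply/negP => small.
  have h1 := Psi_star_le_hfun b gt r0.
  have : 1%:R * ((2 * (L * r / dR)) ^+ d * expR (- 8)) <= c * r ^+ d.
    rewrite -lee_fin; apply: (le_trans _ (hP r Pr)).
    apply: (@integral_cubes_ge 1 (fun=> 0)).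
    - by rewrite divr_ge0 ?(ltW Lr0)//; lra.
    - by move=> i j _ _ _; rewrite !ord1.
    - move=> _ z /cube_enorm_ball; rewrite subr0 -/dR [dR * _]mulrC divfK; last by lra.
      move=> zL; have := RePsi_le_Psi_star b gt Lr0 zL => h2.
      by rewrite mulrAC ler_pdivrMr//; lra.
  rewrite mul1r expRN ler_pdivrMr ?expR_gt0// -/e8.
  have -> : 2 * (L * r / dR) = 2 * (2 + c * e8) * r.
    by rewrite /L; field; lra.
  rewrite exprMn mulrAC ler_pM2r ?exprn_gt0// leNgt => /negP; apply.
  apply: (@lt_le_trans _ _ (2 * (2 + c * e8))); first by lra.
  by rewrite -[leLHS]expr1 ler_weXn2l//; lra.
have iter k r : P r -> 1 * 2 ^+ k * Psis r <= Psis (L ^+ k * r).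
  move=> Pr; rewrite mul1r; elim: k => [|k IH]; first by rewrite !expr0 !mul1r.
  have Pk : P (L ^+ k * r).
    have Lk : 1 <= L ^+ k by rewrite exprn_ege1// ltW.
    by apply: (PU r) => //; rewrite ler_peMl// ltW// P0.
  rewrite exprS -(mulrA 2) (exprS L) -(mulrA L); apply: (le_trans _ (double _ Pk)).
  by rewrite ler_wpM2l.
have [al [c' [al02 c'01 hc']]] := @power_growth R P Psis 1 2 L ltr01
  (ltr1n _ 2) L1 P0 PU (fun r Pr => Psi_star_ge0 b gt (P0 r Pr))
  (fun r r' Pr => le_Psi_star b gt (P0 r Pr)) iter.
(* More cubes than [hP] allows: each one has half-side r / (4 d), hence volume (r / (2 d))^d, and
   carries an integrand of at least e^{-9}. K = 8 m^2 makes psi so small at x, if the claim fails,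
   that this holds around the first m multiples of x. *)
pose m := (Num.truncn (expR 1 * c * e8 * (2 * dR) ^+ d)).+1.
have m0 : 0 < m%:R :> R by rewrite ltr0n.
pose K := 8 * m%:R ^+ 2 : R.
have K0 : 0 < K by rewrite mulr_gt0 ?exprn_gt0.
have low x : P (enorm x) -> Psis (enorm x) <= K * psi x.
  set r := enorm x => Pr.
  have r0 := P0 _ Pr; have ir0 : 0 < r^-1 by rewrite invr_gt0.
  have hr0 := hfun_gt0 gt hoo ir0.
  apply: (le_trans (Psi_star_le_hfun b gt r0)); rewrite leNgt; apply/negP => small.
  have rho0 : 0 <= r / (4 * dR) by rewrite divr_ge0 ?(ltW r0)//; lra.
  have near k z : cube (k.+1%:R *: x) (r / (4 * dR)) z ->
      enorm (z - k.+1%:R *: x) <= r / 4.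
    move=> /cube_enorm_ball; rewrite -/dR.
    by have -> : dR * (r / (4 * dR)) = r / 4 by field; lra.
  have : m%:R * ((2 * (r / (4 * dR))) ^+ d * expR (- 9)) <= c * r ^+ d.
    rewrite -lee_fin; apply: (le_trans _ (hP r Pr)).
    apply: (@integral_cubes_ge m (fun k => k.+1%:R *: x)) => //.
    (* The cubes lie in balls of radius r/4 around distinct multiples of x, which are at least r
       apart. *)
    - move=> i j _ _ [z [/= /near zi /near zj]].
      apply/eqP; apply/negPn/negP => ij.
      have : enorm (i.+1%:R *: x - j.+1%:R *: x) <= r / 4 + r / 4.
        have -> : i.+1%:R *: x - j.+1%:R *: x =
          (z - j.+1%:R *: x) + - (z - i.+1%:R *: x) by rewrite opprB [RHS]addrC addrA subrK.
        by apply: le_trans (ler_enormD _ _) _; rewrite enormN lerD.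
      rewrite -scalerBl enormZ -/r.
      have : 1 <= `|i.+1%:R - j.+1%:R : R|.
        have {}ij : (i != j :> nat) by [].
        case: (ltngtP i j) ij => // ij _.
          rewrite distrC ger0_norm; last by rewrite subr_ge0 ler_nat ltnW.
          by rewrite -natrB ?ler1n ?subn_gt0 // ltnW.
        rewrite ger0_norm; last by rewrite subr_ge0 ler_nat ltnW.
        by rewrite -natrB ?ler1n ?subn_gt0 // ltnW.
      move=> h1; have : 1 * r <= `|i.+1%:R - j.+1%:R| * r by rewrite ler_wpM2r// ltW.
      lra.
    - move=> k z /near zk.
      have h1 := RePsiMn b gt k.+1 x.
      have h2 := RePsiD b gt (k.+1%:R *: x) (z - k.+1%:R *: x).
      have h3 : psi (z - k.+1%:R *: x) <= 2 * h r^-1.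
        by apply: RePsi_le_hfun => //; rewrite invrK (le_trans zk)// quarter.
      move: h2; rewrite addrC subrK => h2.
      have h4 : k.+1%:R ^+ 2 * psi x <= m%:R ^+ 2 * psi x.
        by rewrite ler_wpM2r ?RePsi_ge0// ler_pXn2r ?nnegrE// ler_nat.
      rewrite mulrAC ler_pdivrMr//; apply: combine h2 h1 h4 h3 _.
      by rewrite mulrA.
  rewrite expRN mulrA ler_pdivrMr ?expR_gt0//.
  have -> : 2 * (r / (4 * dR)) = r / (2 * dR) by field; lra.
  have -> : expR 9 = expR 1 * e8 :> R by rewrite -expRD; congr expR; lra.
  rewrite exprMn exprVn mulrA ler_pdivrMr ?exprn_gt0//; last by lra.
  rewrite leNgt => /negP; apply.
  rewrite [ltRHS]mulrC -[ltLHS]mulrA mulrC.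
  have rd : 0 < r ^+ d by rewrite exprn_gt0.
  have -> : c * r ^+ d * (expR 1 * e8 * (2 * dR) ^+ d) =
    expR 1 * c * e8 * (2 * dR) ^+ d * r ^+ d by ring.
  by rewrite ltr_pM2r// truncnS_gt.
exists s%:E, (Num.min c' K^-1), al; split => //.
- move: c'01 => /andP[c'0 c'1].
  by rewrite lt_min c'0 invr_gt0 K0 ge_min c'1.
- move=> x Px; have Px0 := P0 _ Px.
  apply: (@le_trans _ _ (K^-1 * Psis (enorm x))).
    by rewrite ler_wpM2r ?(Psi_star_ge0 b gt)// ge_min lexx orbT.
  by rewrite ler_pdivrMl// low.
- move=> l r l1 Pr; apply: le_trans (hc' _ _ l1 Pr).
  by rewrite !ler_wpM2r ?powR_ge0 ?(Psi_star_ge0 b gt (P0 _ Pr))// ge_min lexx.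
Qed.

End lower_bounds_from_integrability.

(** * Fourier inversion *)

Section real_fubini.
Context d1 d2 (T1 : measurableType d1) (T2 : measurableType d2) (R : realType).
Variables (m1 : {sigma_finite_measure set T1 -> \bar R}).
Variables (m2 : probability T2 R).

Lemma integrable_bounded (g : T2 -> R) c : measurable_fun setT g ->
  (forall y, `|g y| <= c) -> m2.-integrable setT (EFin \o g).
Proof.
move=> mg gc; apply: (@le_integrable_EFin _ _ _ m2 g (cst c)) => //.
exact: finite_measure_integrable_cst.
Qed.

Lemma normr_expectation_le (g : T2 -> R) c : measurable_fun setT g ->
  (forall y, `|g y| <= c) -> `|\int[m2]_y g y| <= c.
Proof.
move=> mg gc; have ig := integrable_bounded mg gc.
apply: (le_trans (le_normr_Rintegral measurableT ig)).
apply: (@le_trans _ _ (\int[m2]_y (cst c y))); last first.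
  by rewrite Rintegral_cst// [X in fine X]probability_setT mulr1.
apply: le_Rintegral => //.
  apply: (@integrable_bounded _ c) => [|y]; first exact: measurableT_comp.
  by rewrite normr_id.
apply: (@integrable_bounded _ c) => // y.
by rewrite ger0_norm// (le_trans (normr_ge0 _) (gc y)).
Qed.

(** As [m2] has mass 1, an integrable majorant in the first variable alone makes f integrable for
    the product. *)
Lemma Rintegral_swap (f : T1 * T2 -> R) (g : T1 -> R) :
  measurable_fun setT f -> m1.-integrable setT (EFin \o g) ->
  (forall x y, `|f (x, y)| <= g x) ->
  \int[m1]_x \int[m2]_y f (x, y) = \int[m2]_y \int[m1]_x f (x, y).
Proof.
move=> mf ig fg.
have mfx x : measurable_fun setT (fun y => f (x, y)) by exact: measurableT_comp.
have mfy y : measurable_fun setT (fun x => f (x, y)) by exact: measurableT_comp.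
have if2 x : m2.-integrable setT (EFin \o (fun y => f (x, y))).
  exact: integrable_bounded (mfx x) (fg x).
have if1 y : m1.-integrable setT (EFin \o (fun x => f (x, y))).
  exact: le_integrable_EFin (mfy y) (fg ^~ y) ig.
have imf : (m1 \x m2)%E.-integrable setT (EFin \o f).
  apply/integrable12ltyP; first exact/measurable_EFinP.
  have /integrableP[_ gfin] := ig.
  apply: le_lt_trans gfin; apply: ge0_le_integral => //.
  - by move=> x _; apply: integral_ge0.
  - apply: (@measurable_fun_fubini_tonelli_F _ _ T1 T2 R m2 (fun p => `|f p|%:E)) => //.
    by apply/measurable_EFinP; exact: measurableT_comp.
  - by apply: measurableT_comp => //; exact: measurable_int ig.
  - move=> x _; apply: (@le_trans _ _ (\int[m2]_y (cst `|(g x)%:E| y))%E).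
      apply: ge0_le_integral => //.
        by apply: measurableT_comp => //; apply/measurable_EFinP.
      by move=> y _; rewrite /= lee_fin (le_trans (fg x y))// ler_norm.
    by rewrite integral_cst// [X in (_ * X)%E]probability_setT mule1.
have := Fubini imf => /= FF.
rewrite /Rintegral; congr fine.
transitivity (\int[m1]_x \int[m2]_y (f (x, y))%:E)%E.
  by apply: eq_integral => x _; rewrite fineK// (integrable_fin_num _ (if2 x)).
rewrite FF; apply: eq_integral => y _; rewrite fineK//.
exact: (integrable_fin_num _ (if1 y)).
Qed.

End real_fubini.

Section characteristic_function.
Variables (R : realType) (d : nat) (mu : probability 'rV[R]_d R).
Implicit Types x y z : 'rV[R]_d.
Local Notation leb := (lebesgue_rV R d).

Definition phic z : R := \int[mu]_y cos (dotv z y).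
Definition phis z : R := \int[mu]_y sin (dotv z y).
Definition phi2 z : R := phic z ^+ 2 + phis z ^+ 2.

(* With phi the characteristic function of mu, [chi x 0 z] and
   [chi x (- pi / 2) z] are the real and imaginary parts of
   e^(-i <x, z>) phi(z). *)
Definition chi x th z : R := \int[mu]_y cos (dotv z (y - x) + th).

Lemma measurable_cos_comp d1 (T : measurableType d1) (f : T -> R) :
  measurable_fun setT f -> measurable_fun setT (fun w => cos (f w)).
Proof.
by move=> mf; apply: (measurableT_comp (continuous_measurable_fun (@continuous_cos R))).
Qed.

Lemma measurable_sin_comp d1 (T : measurableType d1) (f : T -> R) :
  measurable_fun setT f -> measurable_fun setT (fun w => sin (f w)).
Proof.
by move=> mf; apply: (measurableT_comp (continuous_measurable_fun (@continuous_sin R))).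
Qed.

Let icos z th : mu.-integrable setT (EFin \o (fun y => cos (dotv z y + th))).
Proof.
apply: (@integrable_bounded _ _ _ mu _ 1) => [|y]; last exact: cos_max.
by apply: measurable_cos_comp; apply: measurable_funD => //; exact: measurable_dotv.
Qed.

Let isin z : mu.-integrable setT (EFin \o (fun y => sin (dotv z y))).
Proof.
apply: (@integrable_bounded _ _ _ mu _ 1) => [|y]; last exact: sin_max.
by apply: measurable_sin_comp; exact: measurable_dotv.
Qed.

Let icos0 z : mu.-integrable setT (EFin \o (fun y => cos (dotv z y))).
Proof. by have := icos z 0; apply: eq_integrable => // y _ /=; rewrite addr0. Qed.

Lemma chiE x th z :
  chi x th z = phic z * cos (th - dotv z x) - phis z * sin (th - dotv z x).
Proof.
set a := th - _; rewrite mulrC [phis z * _]mulrC.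
rewrite -!RintegralZl// -RintegralB//; try exact: integrable_EFinZ.
apply: eq_Rintegral => y _; rewrite dotvBr addrAC -addrA cosD /a; ring.
Qed.

Lemma phi2_ge0 z : 0 <= phi2 z.
Proof. by rewrite addr_ge0 ?sqr_ge0. Qed.

Lemma normr_chi_le x th z : `|chi x th z| <= Num.sqrt (phi2 z).
Proof.
rewrite -(@ler_pXn2r _ 2)// ?nnegrE ?sqrtr_ge0// sqr_sqrtr ?phi2_ge0//.
rewrite real_normK ?num_real// chiE; set a := th - _.
have := cos2Dsin2 a; rewrite /phi2; set c := cos a; set s := sin a => cs.
have -> : phic z ^+ 2 + phis z ^+ 2 =
  (phic z ^+ 2 + phis z ^+ 2) * (c ^+ 2 + s ^+ 2) by rewrite cs mulr1.
by have := sqr_ge0 (phic z * s + phis z * c); nra.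
Qed.

Let measurable_arg x th :
  measurable_fun setT (fun p : 'rV[R]_d * 'rV[R]_d => dotv p.1 (p.2 - x) + th).
Proof.
apply: measurable_funD => //; apply: measurable_dotv2 => //.
exact: measurable_rVB.
Qed.

Let icosB x th z :
  mu.-integrable setT (EFin \o (fun y => cos (dotv z (y - x) + th))).
Proof.
apply: (@integrable_bounded _ _ _ mu _ 1) => [|y]; last exact: cos_max.
apply: measurable_cos_comp; apply: measurable_funD => //.
by apply: measurable_dotv2 => //; exact: measurable_rVB.
Qed.

(** The measurability half of Tonelli applies to 1 + cos; the constant 1 integrates to 1 and is
    subtracted. *)
Lemma measurable_chi x th : measurable_fun setT (chi x th).
Proof.
pose F (p : 'rV[R]_d * 'rV[R]_d) : \bar R := (1 + cos (dotv p.1 (p.2 - x) + th))%:E.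
have mF : measurable_fun setT F.
  apply/measurable_EFinP; apply: measurable_funD => //.
  by apply: measurable_cos_comp; exact: measurable_arg.
have F0 p : (0 <= F p)%E.
  by rewrite lee_fin; have := cos_geN1 (dotv p.1 (p.2 - x) + th); lra.
have := measurable_fun_fubini_tonelli_F (m2 := mu) F mF F0 => mG.
have -> : chi x th = (fun z => fine (\int[mu]_y F (z, y))%E - 1).
  apply/funext => z; rewrite /F.
  have ic := icosB x th z.
  rewrite -[fine _]/(\int[mu]_y (1 + cos (dotv z (y - x) + th))) RintegralD//.
    by rewrite Rintegral_cst// [X in fine X]probability_setT mulr1 addrAC subrr add0r.
  by apply: (@integrable_bounded _ _ _ mu _ 1) => // y; rewrite normr1.
apply: measurable_funB => //.
by apply: measurableT_comp => //; exact: measurable_fine.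
Qed.

Lemma chi00 z : chi 0 0 z = phic z.
Proof. by apply: eq_Rintegral => y _; rewrite subr0 addr0. Qed.

Lemma measurable_phic : measurable_fun setT phic.
Proof.
by rewrite (_ : phic = chi 0 0); [exact: measurable_chi|apply/funext => z; rewrite chi00].
Qed.

Lemma measurable_phis : measurable_fun setT phis.
Proof.
rewrite (_ : phis = chi 0 (- (pi / 2))); first exact: measurable_chi.
by apply/funext => z; apply: eq_Rintegral => y _; rewrite subr0 cosBpihalf.
Qed.

Lemma measurable_phi2 : measurable_fun setT phi2.
Proof.
by apply: measurable_funD; apply: measurable_funX;
  [exact: measurable_phic|exact: measurable_phis].
Qed.

(** The left side is the damped inversion integral and the right side a smoothing of mu. At th = -
    pi / 2 it is 0, which removes the imaginary part. *)
Lemma integral_damp_chi eps x th : 0 < eps ->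
  \int[leb]_z (damp eps z * chi x th z) =
  (\int[mu]_y pkernel eps (y - x)) * cos th.
Proof.
move=> e0.
pose f (p : 'rV[R]_d * 'rV[R]_d) := damp eps p.1 * cos (dotv p.1 (p.2 - x) + th).
have mf : measurable_fun setT f.
  apply: measurable_funM.
    by apply: (@measurableT_comp _ _ _ _ _ _ (damp eps) _ fst) => //;
      exact: measurable_damp.
  by apply: measurable_cos_comp; exact: measurable_arg.
have fd z y : `|f (z, y)| <= damp eps z.
  by rewrite normrM ger0_norm ?damp_ge0// ler_piMr ?damp_ge0// cos_max.
have ic z := icosB x th z.
transitivity (\int[leb]_z \int[mu]_y f (z, y)).
  by apply: eq_Rintegral => z _; rewrite /f/= RintegralZl.
rewrite (@Rintegral_swap _ _ _ _ R leb mu f _ mf (integrable_damp d e0) fd) mulrC -RintegralZl//.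
  by apply: eq_Rintegral => y _; rewrite /f/= Rintegral_damp_cos// mulrC.
apply: (@integrable_bounded _ _ _ mu _ ((2 / eps) ^+ d)) => [|y].
  apply: (measurableT_comp (measurable_pkernel e0)).
  exact: measurable_rVB.
by rewrite ger0_norm ?pkernel_ge0// pkernel_le.
Qed.

End characteristic_function.

(** The square makes the smoothing scale vanish faster than the margin 1/(n+1) by which boxes are
    shrunk during inversion. *)
Definition epsn (R : realType) (n : nat) : R := (n.+1%:R ^+ 2)^-1.

Lemma epsn_gt0 (R : realType) n : 0 < epsn R n.
Proof. by rewrite invr_gt0 exprn_gt0. Qed.

(** * Smoothed densities and their limits *)

Section fourier_bounds.
Variables (R : realType) (d : nat) (mu : probability 'rV[R]_d R).
Implicit Types x y z : 'rV[R]_d.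
Local Notation leb := (lebesgue_rV R d).
Local Notation chi := (chi mu).
Local Notation phi2 := (phi2 mu).

Local Notation eps_ := (epsn R).

Let eps_gt0 n : 0 < eps_ n. Proof. exact: epsn_gt0. Qed.

Let eps_cvg0 : eps_ n @[n --> \oo] --> (0 : R).
Proof.
have -> : 0 = 0 * 0 :> R by rewrite mulr0.
rewrite /epsn; under eq_cvg do rewrite expr2 invfM.
by apply: cvgM; exact: cvg_harmonic.
Qed.

Let damp_cvg1 z : damp (eps_ n) z @[n --> \oo] --> (1 : R).
Proof.
have h : (- eps_ n * l1norm z) @[n --> \oo] --> - 0 * l1norm z.
  by apply: cvgM; [exact: cvgN|exact: cvg_cst].
rewrite oppr0 mul0r in h.
by rewrite -expR0; apply: (cvg_comp _ _ h); exact: continuous_expR.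
Qed.

Let damp_nd z : {homo (fun n => damp (eps_ n) z) : n m / (n <= m)%N >-> n <= m}.
Proof.
move=> n m nm; rewrite ler_expR ler_wpM2r ?l1norm_ge0// lerN2.
by rewrite lef_pV2 ?posrE ?exprn_gt0// ler_pXn2r ?nnegrE// ler_nat.
Qed.

Let ipk eps x : 0 < eps -> mu.-integrable setT (EFin \o (fun y => pkernel eps (y - x))).
Proof.
move=> e0; apply: (@integrable_bounded _ _ _ mu _ ((2 / eps) ^+ d)) => [|y].
  apply: (measurableT_comp (measurable_pkernel e0)).
  exact: measurable_rVB.
by rewrite ger0_norm ?pkernel_ge0// pkernel_le.
Qed.

(** |phi|^2 is the characteristic function of the difference of two independent variables of law
    mu. *)
Lemma phi2_chi z : phi2 z = \int[mu]_x chi x 0 z.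
Proof.
have mc : measurable_fun setT (fun x => cos (dotv z x)).
  by apply: measurable_cos_comp; exact: measurable_dotv.
have ms : measurable_fun setT (fun x => sin (dotv z x)).
  by apply: measurable_sin_comp; exact: measurable_dotv.
rewrite /phi2 !expr2 -!RintegralZl//; last 2 first.
- by apply: (@integrable_bounded _ _ _ mu _ 1) => // y; exact: sin_max.
- by apply: (@integrable_bounded _ _ _ mu _ 1) => // y; exact: cos_max.
rewrite -RintegralD//; last 2 first.
- apply: integrable_EFinZ.
  by apply: (@integrable_bounded _ _ _ mu _ 1) => // y; exact: cos_max.
- apply: integrable_EFinZ.
  by apply: (@integrable_bounded _ _ _ mu _ 1) => // y; exact: sin_max.
by apply: eq_Rintegral => x _; rewrite chiE sub0r cosN sinN mulrN opprK.
Qed.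

Lemma normr_chi_le1 x th z : `|chi x th z| <= 1.
Proof.
apply: (@normr_expectation_le _ _ _ mu) => [|y]; last exact: cos_max.
apply: measurable_cos_comp; apply: measurable_funD => //.
by apply: measurable_dotv2 => //; exact: measurable_rVB.
Qed.

Lemma integral_damp_phi2 eps : 0 < eps ->
  \int[leb]_z (damp eps z * phi2 z) = \int[mu]_x \int[mu]_y pkernel eps (y - x).
Proof.
move=> e0; pose f (p : 'rV[R]_d * 'rV[R]_d) := damp eps p.1 * chi p.2 0 p.1.
have mf : measurable_fun setT f.
  apply: measurable_funM.
    by apply: (@measurableT_comp _ _ _ _ _ _ (damp eps) _ fst) => //;
      exact: measurable_damp.
  rewrite (_ : (fun p => _) = (fun p => phic mu p.1 * cos (dotv p.1 p.2) +
      phis mu p.1 * sin (dotv p.1 p.2))); last first.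
    by apply/funext => p; rewrite chiE sub0r cosN sinN mulrN opprK.
  have m12 : measurable_fun setT (fun p : 'rV[R]_d * 'rV[R]_d => dotv p.1 p.2).
    exact: measurable_dotv2.
  apply: measurable_funD; apply: measurable_funM.
  - apply: (@measurableT_comp _ _ _ _ _ _ (phic mu) _ fst) => //.
    exact: measurable_phic.
  - exact: measurable_cos_comp.
  - apply: (@measurableT_comp _ _ _ _ _ _ (phis mu) _ fst) => //.
    exact: measurable_phis.
  - exact: measurable_sin_comp.
have fd z x : `|f (z, x)| <= damp eps z.
  by rewrite normrM ger0_norm ?damp_ge0// ler_piMr ?damp_ge0// normr_chi_le1.
have ichi z : mu.-integrable setT (EFin \o (fun x => chi x 0 z)).
  apply: (@integrable_bounded _ _ _ mu _ 1) => [|y]; last exact: normr_chi_le1.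
  rewrite (_ : (fun p => _) = (fun x => phic mu z * cos (dotv z x) +
      phis mu z * sin (dotv z x))); last first.
    by apply/funext => p; rewrite chiE sub0r cosN sinN mulrN opprK.
  apply: measurable_funD; apply: measurable_funM => //.
    by apply: measurable_cos_comp; exact: measurable_dotv.
  by apply: measurable_sin_comp; exact: measurable_dotv.
transitivity (\int[leb]_z \int[mu]_x f (z, x)).
  by apply: eq_Rintegral => z _; rewrite phi2_chi /f/= RintegralZl.
rewrite (@Rintegral_swap _ _ _ _ R leb mu f _ mf (integrable_damp d e0) fd).
by apply: eq_Rintegral => x _; rewrite /f/= integral_damp_chi// cos0 mulr1.
Qed.

Lemma phi2_le1 z : phi2 z <= 1.
Proof.
rewrite phi2_chi; apply: le_trans (ler_norm _) _.
apply: (@normr_expectation_le _ _ _ mu) => [|y]; last exact: normr_chi_le1.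
rewrite (_ : (fun p => _) = (fun x => phic mu z * cos (dotv z x) +
    phis mu z * sin (dotv z x))); last first.
  by apply/funext => p; rewrite chiE sub0r cosN sinN mulrN opprK.
apply: measurable_funD; apply: measurable_funM => //.
  by apply: measurable_cos_comp; exact: measurable_dotv.
by apply: measurable_sin_comp; exact: measurable_dotv.
Qed.

(** The damped integral of |phi|^2 equals the double mu-integral of the kernel. Its inner integral
    is at most M times the Lebesgue mass (2 pi)^d, uniformly in eps, and the damping is removed by
    monotone convergence, with no integrability of |phi|^2 assumed beforehand. *)
Lemma bounded_density_phi2 M : 0 <= M ->
  (forall B, measurable B -> (mu B <= M%:E * leb B)%E) ->
  (\int[leb]_z (phi2 z)%:E <= (M * (2 * pi) ^+ d)%:E)%E.
Proof.
move=> M0 muM.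
have pkM eps x : 0 < eps -> \int[mu]_y pkernel eps (y - x) <= M * (2 * pi) ^+ d.
  move=> e0; rewrite -lee_fin EFin_Rintegral; last exact: ipk.
  have mpk : measurable_fun setT (fun y => (pkernel eps (y - x))%:E).
    exact: measurable_int (ipk x e0).
  have pk0 y : (0 <= (pkernel eps (y - x))%:E)%E by rewrite lee_fin pkernel_ge0.
  apply: (@le_trans _ _ (\int[mscale (NngNum M0) leb]_y (pkernel eps (y - x))%:E)%E).
    exact: ge0_le_measure_integral.
  rewrite ge0_integral_mscale//= EFinM lee_wpmul2l ?lee_fin//.
  exact: integral_pkernel_le.
have dphi n : (\int[leb]_z (damp (eps_ n) z * phi2 z)%:E <= (M * (2 * pi) ^+ d)%:E)%E.
  rewrite -EFin_Rintegral; last first.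
    apply: integrable_dampM => //; first exact: measurable_phi2.
    by move=> z; rewrite ger0_norm ?phi2_ge0// phi2_le1.
  rewrite lee_fin integral_damp_phi2//.
  apply: le_trans (ler_norm _) _.
  apply: (@normr_expectation_le _ _ _ mu) => [|x].
    pose F (p : 'rV[R]_d * 'rV[R]_d) := (pkernel (eps_ n) (p.2 - p.1))%:E.
    have mF : measurable_fun setT F.
      apply/measurable_EFinP; apply: (measurableT_comp (measurable_pkernel _)) => //.
      exact: measurable_rVB.
    have F0 p : (0 <= F p)%E by rewrite lee_fin pkernel_ge0.
    have := measurable_fun_fubini_tonelli_F (m2 := mu) F mF F0 => mG.
    exact: measurableT_comp mG.
  by rewrite ger0_norm ?pkM// Rintegral_ge0// => y _; rewrite pkernel_ge0.
have limE z : limn (fun n => (damp (eps_ n) z * phi2 z)%:E) = (phi2 z)%:E.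
  apply/cvg_lim => //; apply: cvg_EFin; first exact: nearW.
  rewrite -[X in _ --> X]mul1r; apply: cvgM; [exact: damp_cvg1|exact: cvg_cst].
under eq_integral do rewrite -limE.
rewrite monotone_convergence//.
- apply: lime_le; last exact: nearW.
  apply: ereal_nondecreasing_is_cvgn => n m nm; apply: ge0_le_integral => //.
  - by move=> z _; rewrite lee_fin mulr_ge0 ?damp_ge0 ?phi2_ge0.
  - by apply/measurable_EFinP; apply: measurable_funM;
      [exact: measurable_damp|exact: measurable_phi2].
  - by apply/measurable_EFinP; apply: measurable_funM;
      [exact: measurable_damp|exact: measurable_phi2].
  - by move=> z _; rewrite lee_fin ler_wpM2r ?phi2_ge0// damp_nd.
- move=> n; apply/measurable_EFinP; apply: measurable_funM;
    [exact: measurable_damp|exact: measurable_phi2].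
- by move=> n z _; rewrite lee_fin mulr_ge0 ?damp_ge0 ?phi2_ge0.
- by move=> z _ n m nm; rewrite lee_fin ler_wpM2r ?phi2_ge0// damp_nd.
Qed.

Hypothesis iphi : leb.-integrable setT (EFin \o (fun z => Num.sqrt (phi2 z))).

Definition inversion_density x : R := (2 * pi) ^- d * \int[leb]_z chi x 0 z.

(** The convolution of mu with the normalized product kernel; its nonnegativity and measurability
    pass to the inversion density, its pointwise limit. *)
Definition smooth_density n x : R :=
  (2 * pi) ^- d * \int[mu]_y pkernel (eps_ n) (y - x).

Definition density_bound : R := (2 * pi) ^- d * \int[leb]_z Num.sqrt (phi2 z).

Let c0 : 0 <= (2 * pi) ^- d :> R.
Proof. by rewrite invr_ge0 exprn_ge0// mulr_ge0// pi_ge0. Qed.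

Lemma integrable_chi x th : leb.-integrable setT (EFin \o chi x th).
Proof.
apply: le_integrable_EFin iphi; first exact: measurable_chi.
exact: normr_chi_le.
Qed.

Let idchi n x th : leb.-integrable setT (EFin \o (fun z => damp (eps_ n) z * chi x th z)).
Proof.
apply: integrable_dampM => //; first exact: measurable_chi.
exact: normr_chi_le1.
Qed.

Lemma cvg_integral_damp_chi x th :
  (\int[mu]_y pkernel (eps_ n) (y - x)) * cos th @[n --> \oo] --> \int[leb]_z chi x th z.
Proof.
under eq_cvg do rewrite -integral_damp_chi//.
have [||_ _] := @dominated_convergence _ _ _ leb setT measurableT
  (fun n => EFin \o (fun z => damp (eps_ n) z * chi x th z)) (EFin \o chi x th) _
  (fun n => measurable_int _ (idchi n x th)) (measurable_int _ (integrable_chi x th))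
  _ iphi.
- apply: aeW => z _; apply: cvg_EFin; first exact: nearW.
  rewrite -[X in _ --> X]mul1r; apply: cvgM; [exact: damp_cvg1|exact: cvg_cst].
- apply: aeW => z n _; rewrite /= lee_fin normrM ger0_norm ?damp_ge0//.
  by apply: le_trans (normr_chi_le mu x th z); rewrite ler_piMl// damp_le1.
rewrite -EFin_Rintegral; last exact: integrable_chi.
by move=> /fine_cvgP[_].
Qed.

Lemma cvg_smooth_density x : smooth_density n x @[n --> \oo] --> inversion_density x.
Proof.
apply: cvgM; first exact: cvg_cst.
by have := @cvg_integral_damp_chi x 0; under eq_cvg do rewrite cos0 mulr1.
Qed.

Lemma integral_chi_im x : \int[leb]_z chi x (- (pi / 2)) z = 0.
Proof.
have := @cvg_integral_damp_chi x (- (pi / 2)).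
under eq_cvg do rewrite cosN cos_pihalf mulr0.
by move=> /(cvg_unique _)/(_ (cvg_cst _)) <-.
Qed.

Lemma smooth_density_ge0 n x : 0 <= smooth_density n x.
Proof.
by rewrite mulr_ge0// Rintegral_ge0// => y _; exact: pkernel_ge0.
Qed.

Lemma smooth_density_le n x : smooth_density n x <= density_bound.
Proof.
rewrite ler_wpM2l// -[leLHS]mulr1 -cos0 -integral_damp_chi//.
apply: le_Rintegral => // z _.
apply: (le_trans (ler_norm _)); rewrite normrM ger0_norm ?damp_ge0//.
by apply: le_trans (normr_chi_le mu x 0 z); rewrite ler_piMl// damp_le1.
Qed.

Lemma measurable_smooth_density n : measurable_fun setT (smooth_density n).
Proof.
apply: measurable_funM => //.
pose F (p : 'rV[R]_d * 'rV[R]_d) := (pkernel (eps_ n) (p.2 - p.1))%:E.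
have mF : measurable_fun setT F.
  apply/measurable_EFinP; apply: (measurableT_comp (measurable_pkernel _)) => //.
  exact: measurable_rVB.
have F0 p : (0 <= F p)%E by rewrite lee_fin pkernel_ge0.
have := measurable_fun_fubini_tonelli_F (m2 := mu) F mF F0 => mG.
exact: measurableT_comp mG.
Qed.

Lemma inversion_density_ge0 x : 0 <= inversion_density x.
Proof.
rewrite -(cvg_lim _ (@cvg_smooth_density x))//; apply: limr_ge.
  by apply/cvg_ex; eexists; exact: cvg_smooth_density.
by apply: nearW => n; exact: smooth_density_ge0.
Qed.

Lemma inversion_density_le x : inversion_density x <= density_bound.
Proof.
rewrite -(cvg_lim _ (@cvg_smooth_density x))//; apply: limr_le.
  by apply/cvg_ex; eexists; exact: cvg_smooth_density.
by apply: nearW => n; exact: smooth_density_le.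
Qed.

Lemma measurable_inversion_density : measurable_fun setT inversion_density.
Proof.
apply/measurable_EFinP.
apply: (emeasurable_fun_cvg (fun n x => (smooth_density n x)%:E)) => [n|x _].
  by apply/measurable_EFinP; exact: measurable_smooth_density.
by apply: cvg_EFin; [exact: nearW|exact: cvg_smooth_density].
Qed.

End fourier_bounds.

(** * Open boxes as a generating pi-system *)

Section open_boxes.
Variables (R : realType) (d : nat).

Definition obox (a b : 'I_d -> R) : set 'rV[R]_d :=
  [set v | forall i, `]a i, b i[%classic (v 0 i)].

Definition cbox (a b : 'I_d -> R) : set 'rV[R]_d :=
  [set v | forall i, `[a i, b i]%classic (v 0 i)].

Definition oboxes : set (set 'rV[R]_d) := [set obox ab.1 ab.2 | ab in setT].

Lemma measurable_obox a b : measurable (obox a b).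
Proof. by apply: (@measurable_boxes R d (fun i => `]a i, b i[%classic)). Qed.

Lemma measurable_cbox a b : measurable (cbox a b).
Proof. by apply: (@measurable_boxes R d (fun i => `[a i, b i]%classic)). Qed.

(** Disjoint boxes cause no exception, since degenerate, empty boxes belong to the family. *)
Lemma setI_closed_oboxes : setI_closed oboxes.
Proof.
move=> _ _ [[a b] _ <-] [[a' b'] _ <-] /=.
exists (fun i => Num.max (a i) (a' i), fun i => Num.min (b i) (b' i)) => //.
apply/seteqP; split => v /=.
  move=> h; split => i; have := h i; rewrite /= !in_itv/= gt_max lt_min.
    by move=> /andP[/andP[-> _] /andP[-> _]].
  by move=> /andP[/andP[_ ->] /andP[_ ->]].
move=> [h1 h2] i; have := h1 i; have := h2 i; rewrite /= !in_itv/= gt_max lt_min.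
by move=> /andP[-> ->] /andP[-> ->].
Qed.

Lemma bigcup_obox : \bigcup_n obox (fun=> - n%:R) (fun=> n%:R) = setT.
Proof.
apply/seteqP; split => // v _.
exists (Num.truncn (enorm v)).+1 => // i; rewrite /= in_itv/= -ltr_norml.
by apply: le_lt_trans (coord_le_enorm v i) _; exact: truncnS_gt.
Qed.

(** For the inclusion in the generated sigma-algebra, the identity map is measurable as soon as the
    coordinates are, and each open half-space v_i > x is a countable union of open boxes. *)
Lemma measurable_rV_oboxes : @measurable _ 'rV[R]_d = <<s oboxes >>.
Proof.
apply/seteqP; split; last first.
  apply: smallest_sub; first exact: sigma_algebra_measurable.
  by move=> _ [[a b] _ <-]; exact: measurable_obox.
have mid : measurable_fun [set: g_sigma_algebraType oboxes]
    (fun v : g_sigma_algebraType oboxes => (v : 'rV[R]_d)).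
  apply: measurable_fun_rV => i.
  apply: (measurability _ (RGenOInfty.measurableE R)) => _ [_ [x ->] <-].
  rewrite setTI.
  have -> : (fun v : 'rV[R]_d => v 0 i) @^-1` `]x, +oo[%classic =
      \bigcup_n obox (fun j => if j == i then x else - n%:R) (fun=> n%:R).
    apply/seteqP; split => v /=.
      rewrite in_itv/= andbT => xv.
      exists (Num.truncn (enorm v)).+1 => // j; rewrite /= in_itv/=.
      have : `|v 0 j| < (Num.truncn (enorm v)).+1%:R.
        by apply: le_lt_trans (coord_le_enorm v j) _; exact: truncnS_gt.
      rewrite ltr_norml => /andP[h1 ->]; case: eqP => [->|_]; rewrite ?xv ?h1//.
    move=> [n _ /(_ i)]; rewrite /= eqxx !in_itv/= => /andP[-> _]//.
  apply: bigcup_measurable => n _; apply: sub_sigma_algebra.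
  by exists (fun j => if j == i then x else - n%:R, fun=> n%:R).
move=> B mB; have := mid measurableT B mB; rewrite setTI; exact.
Qed.

End open_boxes.

Section density_measure.
Context d (T : measurableType d) (R : realType) (m : {measure set T -> \bar R}).
Variable f : T -> \bar R.

(** The proofs [mf] and [f0] are arguments so that the measure structure can be inferred from the
    term itself. *)
Definition density_measure (mf : measurable_fun setT f)
  (f0 : forall x, (0 <= f x)%E) (A : set T) : \bar R := (\int[m]_(x in A) f x)%E.

Variables (mf : measurable_fun setT f) (f0 : forall x, (0 <= f x)%E).
Local Notation nu := (density_measure mf f0).

Let nu0 : nu set0 = 0%E. Proof. exact: integral_set0. Qed.

Let nu_ge0 A : (0 <= nu A)%E. Proof. exact: integral_ge0. Qed.

Let nu_sigma_additive : semi_sigma_additive nu.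
Proof.
move=> F mF tF mUF; rewrite /density_measure ge0_integral_bigcup//; last first.
  exact: measurable_funTS.
by apply: is_cvg_ereal_nneg_natsum_cond => n _ _; exact: integral_ge0.
Qed.

HB.instance Definition _ := isMeasure.Build _ _ _ nu nu0 nu_ge0 nu_sigma_additive.

End density_measure.

Section atan_limits.
Variable R : realType.

(** The case c = 0 is a point on the boundary of the box: the argument is then -(n+1), which still
    tends to -oo. *)
Let atan_lim_neg (c : R) : c <= 0 ->
  atan ((c - n.+1%:R^-1) / epsn R n) @[n --> \oo] --> - (pi / 2).
Proof.
move=> c0.
have h : n.+1%:R * (1 - c * n.+1%:R) @[n --> \oo] --> +oo.
  apply/cvgryPge => A; exists (Num.truncn `|A|) => // n /= An.
  have : A <= n.+1%:R.
    apply: le_trans (ler_norm _) _; apply/ltW/(lt_le_trans (truncnS_gt _)).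
    by rewrite ler_nat.
  move=> /le_trans; apply; rewrite ler_peMr// lerBrDr gerDl.
  by rewrite mulr_le0_ge0.
have E n : atan ((c - n.+1%:R^-1) / epsn R n) = - atan (n.+1%:R * (1 - c * n.+1%:R)).
  have := lt0r_neq0 (ltr0Sn R n).
  by rewrite -atanN /epsn; move: n.+1%:R => N N0; congr atan; field.
under eq_cvg do rewrite E.
by apply: cvgN; apply: (cvg_comp _ _ h); exact: cvgy_atan.
Qed.

Let atan_lim_pos (c : R) : 0 < c ->
  atan ((c - n.+1%:R^-1) / epsn R n) @[n --> \oo] --> pi / 2.
Proof.
move=> c0.
have h : n.+1%:R * (c * n.+1%:R - 1) @[n --> \oo] --> +oo.
  apply/cvgryPge => A; exists (maxn (Num.truncn `|A|) (Num.truncn (2 / c))) => // n /=.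
  rewrite geq_max => /andP[An cn].
  have : A <= n.+1%:R.
    apply: le_trans (ler_norm _) _; apply/ltW/(lt_le_trans (truncnS_gt _)).
    by rewrite ler_nat.
  have : 2 / c <= n.+1%:R.
    by apply/ltW/(lt_le_trans (truncnS_gt _)); rewrite ler_nat.
  rewrite ler_pdivrMr// mulrC => h2.
  by move=> /le_trans; apply; rewrite ler_peMr//; lra.
have E n : atan ((c - n.+1%:R^-1) / epsn R n) = atan (n.+1%:R * (c * n.+1%:R - 1)).
  have := lt0r_neq0 (ltr0Sn R n).
  by rewrite /epsn; move: n.+1%:R => N N0; congr atan; field.
under eq_cvg do rewrite E.
by apply: (cvg_comp _ _ h); exact: cvgy_atan.
Qed.

Lemma cvg_atan_indic (a b y : R) : a < b ->
  (atan ((b - n.+1%:R^-1 - y) / epsn R n) - atan ((a + n.+1%:R^-1 - y) / epsn R n))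
    / pi @[n --> \oo] --> (\1_(`]a, b[%classic : set R) y : R).
Proof.
move=> ab; have pi0 : pi != 0 :> R by rewrite gt_eqF// pi_gt0.
pose s (c : R) : R := if 0 < c then pi / 2 else - (pi / 2).
have lims c : atan ((c - n.+1%:R^-1) / epsn R n) @[n --> \oo] --> s c.
  rewrite /s; case: ltP => c0; [exact: atan_lim_pos|exact: atan_lim_neg].
(* At either endpoint [s] is evaluated at 0, where it equals -pi/2; this yields the indicator of the
   open interval rather than half of it at the ends. *)
have -> : \1_(`]a, b[%classic : set R) y = (s (b - y) - - s (y - a)) / pi.
  rewrite indicE /s !subr_gt0; have [ay|ya] := ltP a y; have [yb|by_] := ltP y b.
  - rewrite mem_set/=; last by rewrite in_itv/= ay yb.
    by rewrite opprK -splitr divff.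
  - rewrite memNset/=; last by rewrite in_itv/= [y < b]ltNge by_ andbF.
    by rewrite opprK addNr mul0r.
  - rewrite memNset/=; last by rewrite in_itv/= [a < y]ltNge ya.
    by rewrite opprK subrr mul0r.
  - by have := lt_le_trans ab (le_trans by_ ya); rewrite ltxx.
apply: cvgM; last exact: cvg_cst.
have Ea n : atan ((a + n.+1%:R^-1 - y) / epsn R n) =
    - atan ((y - a - n.+1%:R^-1) / epsn R n).
  by rewrite -atanN -mulNr; congr (atan (_ / _)); ring.
have Eb n : atan ((b - n.+1%:R^-1 - y) / epsn R n) =
    atan ((b - y - n.+1%:R^-1) / epsn R n) by rewrite addrAC.
under eq_cvg do rewrite Ea Eb.
by apply: cvgB; [exact: lims|apply: cvgN; exact: lims].
Qed.

End atan_limits.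

Section inversion.
Variables (R : realType) (d : nat) (mu : probability 'rV[R]_d R).
Local Notation leb := (lebesgue_rV R d).
Hypothesis iphi : leb.-integrable setT (EFin \o (fun z => Num.sqrt (phi2 mu z))).
Local Notation p := (inversion_density mu).
Implicit Types a b : 'I_d -> R.

(** The indicator of the closed box convolved with the normalized product kernel, in closed form. *)
Let wt a b eps (y : 'rV[R]_d) : R :=
  \prod_(i < d) ((atan ((b i - y 0 i) / eps) - atan ((a i - y 0 i) / eps)) / pi).

Let measurable_wt a b eps : measurable_fun setT (wt a b eps).
Proof.
apply: measurable_prod => i _; apply: measurable_funM => //.
have ma (c : R) : measurable_fun setT (fun y : 'rV[R]_d => atan ((c - y 0 i) / eps)).
  apply: (measurableT_comp (continuous_measurable_fun (@continuous_atan R))).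
  by apply: measurable_funM => //; apply: measurable_funB => //; exact: measurable_coord.
exact: measurable_funB.
Qed.

Let integral_smooth_cbox n a b : (forall i, a i < b i) ->
  (\int[leb]_(x in cbox a b) (smooth_density mu n x)%:E =
   \int[mu]_y (wt a b (epsn R n) y)%:E)%E.
Proof.
move=> ab; set eps := epsn R n; have e0 : 0 < eps by exact: epsn_gt0.
pose F (q : 'rV[R]_d * 'rV[R]_d) : \bar R :=
  ((2 * pi) ^- d * (\1_(cbox a b) q.1 * pkernel eps (q.2 - q.1)))%:E.
have c0 : 0 <= (2 * pi) ^- d :> R.
  by rewrite invr_ge0 exprn_ge0// mulr_ge0// pi_ge0.
have mF : measurable_fun setT F.
  apply/measurable_EFinP; apply: measurable_funM => //; apply: measurable_funM.
    apply: (@measurableT_comp _ _ _ _ _ _ (\1_(cbox a b) : _ -> R) _ fst) => //.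
    by apply: measurable_indic; exact: measurable_cbox.
  apply: (measurableT_comp (measurable_pkernel e0)).
  exact: measurable_rVB.
have F0 q : (0 <= F q)%E by rewrite lee_fin !mulr_ge0 ?pkernel_ge0// indicE.
have mpk (x : 'rV[R]_d) :
    measurable_fun setT (fun y : 'rV[R]_d => pkernel eps (y - x)).
  apply: (measurableT_comp (measurable_pkernel e0)).
  exact: measurable_rVB.
transitivity (\int[leb]_x \int[mu]_y F (x, y))%E.
  rewrite integral_mkcond; apply: eq_integral => x _; rewrite patchE /F /=.
  rewrite indicE; case: ifPn => _; last first.
    by under eq_integral do rewrite mul0r mulr0; rewrite integral0.
  under eq_integral do rewrite mul1r EFinM.
  rewrite ge0_integralZl_EFin//; last 2 first.
  - by move=> y _; rewrite lee_fin pkernel_ge0.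
  - exact/measurable_EFinP.
  rewrite EFinM EFin_Rintegral//.
  apply: (@integrable_bounded _ _ _ mu _ ((2 / eps) ^+ d)) => // y.
  by rewrite ger0_norm ?pkernel_ge0// pkernel_le.
rewrite (@fubini_tonelli _ _ _ _ R leb mu F mF F0).
apply: eq_integral => y _.
transitivity (((2 * pi) ^- d)%:E *
    \int[leb]_(x in cbox a b) (pkernel eps (x - y))%:E)%E.
  rewrite [in RHS]integral_mkcond -ge0_integralZl_EFin//; last 2 first.
  - move=> x _; rewrite patchE; case: ifPn => // _.
    by rewrite lee_fin pkernel_ge0.
  - apply/(measurable_restrictT _ _).1; first exact: measurable_cbox.
    by apply: measurable_funTS; apply/measurable_EFinP.
  apply: eq_integral => x _; rewrite /F/= patchE indicE.
  case: ifPn => _; last by rewrite mul0r mulr0 mule0.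
  by rewrite mul1r EFinM -[in RHS]pkernelN opprB.
rewrite integral_box_pkernel// -EFinM /wt; congr EFin.
rewrite -exprVn -[X in _ ^+ X]card_ord -prodr_const -big_split/=.
apply: eq_bigr => i _; rewrite -/eps; have := lt0r_neq0 (pi_gt0 R).
by move: pi => q q0; field.
Qed.

(* The box shrinks at rate 1/n and the kernel at rate 1/n^2, so the smoothed
   indicators converge to that of the open box at every point, its boundary
   included. *)
Let integral_obox_lt a b : (forall i, a i < b i) ->
  (\int[leb]_(x in obox a b) (p x)%:E = mu (obox a b))%E.
Proof.
move=> ab.
pose an n i := a i + n.+1%:R^-1 : R; pose bn n i := b i - n.+1%:R^-1 : R.
(* The formula for smoothed densities on a box requires nondegenerate sides, which the shrunken box
   has only for large n. *)
have hn : \forall n \near \oo, forall i, an n i < bn n i.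
  apply: filter_forall => i.
  have bi : 0 < b i - a i by rewrite subr_gt0.
  exists (Num.truncn (2 / (b i - a i))) => // n /= hn.
  have : 2 / (b i - a i) < n.+1%:R.
    by apply: (lt_le_trans (truncnS_gt _)); rewrite ler_nat.
  rewrite ltr_pdivrMr// mulrC -ltr_pdivrMr// /an /bn.
  by move: (n.+1%:R^-1) => q; lra.
have mb : measurable_fun setT p by exact: measurable_inversion_density.
pose f n x : R := smooth_density mu n x * \1_(cbox (an n) (bn n)) x.
have f0 n x : 0 <= f n x by rewrite mulr_ge0 ?smooth_density_ge0// indicE.
have mf n : measurable_fun setT (EFin \o f n).
  apply/measurable_EFinP; apply: measurable_funM.
    exact: measurable_smooth_density.
  by apply: measurable_indic; exact: measurable_cbox.
pose B := density_bound mu.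
have B0 : 0 <= B by apply: le_trans (smooth_density_le iphi 0 0); exact: smooth_density_ge0.
(* All shrunken boxes lie in one box of finite volume, on which the smoothed densities are uniformly
   bounded. *)
pose g x := B * \1_(cbox a b) x : R.
have ig : leb.-integrable setT (EFin \o g).
  apply: integrable_EFinZ; apply/integrableP; split.
    by apply/measurable_EFinP; apply: measurable_indic; exact: measurable_cbox.
  under eq_integral do rewrite /= ger0_norm ?indicE//.
  rewrite integral_indic ?setIT//; last exact: measurable_cbox.
  rewrite [X in (X < _)%E](@lebesgue_rV_box R d (fun i => `[a i, b i]%classic))//.
  under eq_bigr do rewrite lebesgue_measure_itv/= lte_fin ab -EFinD.
  by rewrite -(big_morph EFin (@EFinM _) erefl) ltry.
have inc n i : `[an n i, bn n i]%classic `<=` `[a i, b i]%classic.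
  move=> x /=; rewrite !in_itv/= /an /bn => /andP[h1 h2].
  have : 0 <= n.+1%:R^-1 :> R by rewrite invr_ge0.
  by move: (n.+1%:R^-1) h1 h2 => q h1 h2 q0; apply/andP; split; lra.
have fcvg : {ae leb, forall x, setT x ->
    (EFin \o f n) x @[n --> \oo] --> (EFin \o (fun x => p x * \1_(obox a b) x)) x}.
  apply: aeW => x _; apply: cvg_EFin; first exact: nearW.
  apply: cvgM; first exact: cvg_smooth_density.
  apply: cvg_near_cst; rewrite indicE; have [xo|xo] := boolP (x \in obox a b).
    have : \forall n \near \oo, forall i, `[an n i, bn n i]%classic (x 0 i).
      apply: filter_forall => i; move: xo; rewrite inE => /(_ i).
      rewrite /= in_itv/= => /andP[ax xb].
      have d1 : 0 < x 0 i - a i by rewrite subr_gt0.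
      have d2 : 0 < b i - x 0 i by rewrite subr_gt0.
      exists (maxn (Num.truncn (x 0 i - a i)^-1) (Num.truncn (b i - x 0 i)^-1)) => //.
      move=> n /=; rewrite geq_max => /andP[n1 n2].
      have h1 : n.+1%:R^-1 < x 0 i - a i.
        rewrite -[X in _ < X]invrK ltf_pV2 ?posrE ?invr_gt0//.
        by apply: (lt_le_trans (truncnS_gt _)); rewrite ler_nat.
      have h2 : n.+1%:R^-1 < b i - x 0 i.
        rewrite -[X in _ < X]invrK ltf_pV2 ?posrE ?invr_gt0//.
        by apply: (lt_le_trans (truncnS_gt _)); rewrite ler_nat.
      rewrite in_itv/= /an /bn; move: (n.+1%:R^-1) h1 h2 => q h1 h2.
      by apply/andP; split; lra.
    by apply: filterS => n h; rewrite indicE mem_set.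
  apply: nearW => n; rewrite indicE memNset// => cx.
  move/negP: xo; apply; rewrite inE => i; have := cx i.
  rewrite /= !in_itv/= /an /bn => /andP[h1 h2].
  have : 0 < n.+1%:R^-1 :> R by rewrite invr_gt0.
  by move: (n.+1%:R^-1) h1 h2 => q h1 h2 q0; apply/andP; split; lra.
have fbd : {ae leb, forall x n, setT x -> (`|(EFin \o f n) x| <= (EFin \o g) x)%E}.
  apply: aeW => x n _; rewrite /= lee_fin ger0_norm//.
  rewrite ler_pM ?smooth_density_ge0 ?smooth_density_le// !indicE ?ler0n//.
  rewrite ler_nat; have [xn|//] := boolP (x \in cbox (an n) (bn n)).
  rewrite mem_set// => i; apply: inc; move: xn; rewrite inE; exact.
have mpo : measurable_fun setT (EFin \o (fun x => p x * \1_(obox a b) x)).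
  apply/measurable_EFinP; apply: measurable_funM => //.
  by apply: measurable_indic; exact: measurable_obox.
have [_ _ cvg1] := dominated_convergence measurableT mf mpo fcvg ig fbd.
pose w n y := wt (an n) (bn n) (epsn R n) y.
have w1 n y : `|w n y| <= 1.
  rewrite normr_prod; apply: prodr_ile1 => i _; rewrite normr_ge0/= normrM.
  rewrite [X in _ * X]ger0_norm ?invr_ge0 ?pi_ge0// ler_pdivrMr ?pi_gt0// mul1r.
  rewrite ler_norml.
  have := atan_ltpi2 ((bn n i - y 0 i) / epsn R n).
  have := atan_gtNpi2 ((bn n i - y 0 i) / epsn R n).
  have := atan_ltpi2 ((an n i - y 0 i) / epsn R n).
  have := atan_gtNpi2 ((an n i - y 0 i) / epsn R n).
  by move=> ? ? ? ?; apply/andP; split; lra.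
have wcvg : {ae mu, forall y, setT y ->
    (EFin \o w n) y @[n --> \oo] --> (EFin \o \1_(obox a b)) y}.
  apply: aeW => y _; apply: cvg_EFin; first exact: nearW.
  have -> : (\1_(obox a b) y : R) = \prod_(i < d) \1_(`]a i, b i[%classic) (y 0 i).
    rewrite indicE; have [yo|yo] := boolP (y \in obox a b).
      rewrite big1// => i _; rewrite indicE mem_set//.
      by move: yo; rewrite inE; exact.
    have [i yi] : exists i, ~ `]a i, b i[%classic (y 0 i).
      by apply/existsNP => h; move/negP: yo; apply; rewrite inE.
    by rewrite (bigD1 i)//= indicE memNset// mul0r.
  apply: cvg_big => [|i _]; first exact: mul_continuous.
  exact: cvg_atan_indic.
have wbd : {ae mu, forall y n, setT y -> (`|(EFin \o w n) y| <= (EFin \o cst (1%R : R)) y)%E}.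
  by apply: aeW => y n _; rewrite /= lee_fin w1.
have i1 : mu.-integrable setT (EFin \o cst (1 : R)).
  by apply: (@integrable_bounded _ _ _ mu _ 1) => // y; rewrite normr1.
have mi : measurable_fun setT (EFin \o \1_(obox a b) : _ -> \bar R).
  by apply/measurable_EFinP; apply: measurable_indic; exact: measurable_obox.
have mw n : measurable_fun setT (EFin \o w n).
  by apply/measurable_EFinP; exact: measurable_wt.
have [_ _ cvg2] := dominated_convergence measurableT mw mi wcvg i1 wbd.
have e1 : (\int[leb]_x (p x * \1_(obox a b) x)%:E)%E =
    (\int[leb]_(x in obox a b) (p x)%:E)%E.
  rewrite [RHS]integral_mkcond; apply: eq_integral => x _.
  by rewrite /= patchE indicE; case: ifPn => _; rewrite ?mulr1 ?mulr0.
have e2 : (\int[mu]_y (\1_(obox a b) y)%:E)%E = mu (obox a b).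
  by rewrite integral_indic ?setIT//; exact: measurable_obox.
rewrite -e1 -e2; apply: (@cvg_unique _ _ _ _ _ _ cvg1) => //.
apply: cvg_trans cvg2; apply: near_eq_cvg; near=> n.
have abn : forall i, an n i < bn n i by near: n.
rewrite /= -integral_smooth_cbox// [LHS]integral_mkcond; apply: eq_integral => x _.
by rewrite /= patchE /f indicE; case: ifPn => _; rewrite ?mulr1 ?mulr0.
Unshelve. all: by end_near. Qed.

Lemma inversion_densityP (B : set 'rV[R]_d) : measurable B ->
  (mu B = \int[leb]_(x in B) (p x)%:E)%E.
Proof.
have mp : measurable_fun setT (EFin \o p).
  by apply/measurable_EFinP; exact: measurable_inversion_density.
have p0 x : (0 <= (EFin \o p) x)%E by rewrite lee_fin inversion_density_ge0.
move=> mB; apply: (measure_unique (@oboxes R d)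
   (fun n => obox (fun=> - n%:R) (fun=> n%:R)) _ _ _ _ mu (density_measure leb mp p0)) => //.
- exact: measurable_rV_oboxes.
- exact: setI_closed_oboxes.
- by move=> n; exists (fun=> - n%:R, fun=> n%:R).
- exact: bigcup_obox.
- move=> _ [[a b] _ <-] /=.
  have [/forallP ab|/forallPn[i ab]] := boolP [forall i, a i < b i].
    by rewrite /density_measure integral_obox_lt.
  have -> : obox a b = set0.
    rewrite -subset0 => v /(_ i); rewrite /= in_itv/= => /andP[h1 h2].
    by move/negP: ab; apply; exact: lt_trans h2.
  by rewrite !measure0.
- by move=> n; apply: (le_lt_trans (probability_le1 _ _)); rewrite ?ltry//; exact: measurable_obox.
Qed.

End inversion.

(** * Equivalence of the conditions *)

Section levy_characteristic.
Variables (R : realType) (d : nat) (d0 : (0 < d)%N).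
Variables (disp : measure_display) (T : measurableType disp) (P : probability T R).
Variable Y : R -> {RV P >-> 'rV[R]_d}.
Variables (A : 'M[R]_d) (N : {measure set 'rV[R]_d -> \bar R}) (b : 'rV[R]_d).
Hypothesis YL : levy_process_with_triplet Y A N b.
Hypothesis hoo : hfun A N r @[r --> 0^'+] --> +oo.
Local Notation psi x := (complex.Re (Psi A N b x)).
Local Notation h := (hfun A N).
Local Notation hinv := (h_inv A N).
Local Notation leb := (lebesgue_rV R d).
Local Notation mu t := (distribution P (Y t)).

Let gt : generating_triplet A N. Proof. by case: YL. Qed.

Lemma cexp_i (r : R) : cexp ('i%C * r%:C)%C = (cos r +i* sin r)%C.
Proof.
rewrite /cexp /= !(mul0r, mulr0, mul1r, subr0, add0r); simpc.
by rewrite expR0 !mul1r.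
Qed.

Lemma cexp_Ni (r : R) : cexp (- ('i%C * r%:C))%C = (cos r +i* - sin r)%C.
Proof.
rewrite /cexp /= !(mul0r, mulr0, mul1r, subr0, add0r) cosN sinN; simpc.
by rewrite ?oppr0 expR0 !mul1r.
Qed.

Let Rintegral_RV t (f : 'rV[R]_d -> R) : measurable_fun setT f ->
  (forall y, `|f y| <= 1) -> \int[mu t]_y f y = \int[P]_w f (Y t w).
Proof.
move=> mf f1; rewrite /Rintegral integral_distribution//.
  exact/measurable_EFinP.
apply: (@integrable_bounded _ _ _ P (fun w => f (Y t w)) 1) => //.
exact: measurableT_comp.
Qed.

Let cfE t x : 0 <= t ->
  cexp (- (t%:C * Psi A N b x))%C = (phic (mu t) x +i* phis (mu t) x)%C.
Proof.
move=> t0; have [_ _ cf] := YL; rewrite -cf// /cintegral.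
congr (_ +i* _)%C.
  rewrite /phic Rintegral_RV//; last 2 first.
  - by apply: measurable_cos_comp; exact: measurable_dotv.
  - by move=> y; exact: cos_max.
  by apply: eq_Rintegral => w _; rewrite cexp_i.
rewrite /phis Rintegral_RV//; last 2 first.
- by apply: measurable_sin_comp; exact: measurable_dotv.
- by move=> y; exact: sin_max.
by apply: eq_Rintegral => w _; rewrite cexp_i.
Qed.

Lemma phi2E t x : 0 <= t -> phi2 (mu t) x = expR (- (t * psi x)) ^+ 2.
Proof.
move=> t0; have := cfE x t0; rewrite /cexp /phi2.
case: (Psi A N b x) => u v /=; rewrite !(mul0r, subr0, addr0); simpc => -[<- <-].
by rewrite !exprMn -mulrDr cos2Dsin2 mulr1.
Qed.

Lemma sqrt_phi2E t x : 0 <= t -> Num.sqrt (phi2 (mu t) x) = expR (- (t * psi x)).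
Proof. by move=> t0; rewrite phi2E// sqrtr_sqr ger0_norm ?expR_ge0. Qed.

(** The modulus of the characteristic function of Y_1 is e^{-psi}, and its measurability in x is
    already known. *)
Lemma measurable_RePsi : measurable_fun setT (fun x => psi x).
Proof.
have -> : (fun x => psi x) = (fun x => - ln (Num.sqrt (phi2 (mu 1) x))).
  by apply/funext => x; rewrite sqrt_phi2E// expRK mul1r opprK.
have mq : measurable_fun setT (fun x => Num.sqrt (phi2 (mu 1) x)).
  apply: (measurableT_comp (continuous_measurable_fun (@sqrt_continuous R))).
  exact: measurable_phi2.
have ml := measurableT_comp (@measurable_ln R) mq.
by apply: measurableT_comp => //; exact: ml.
Qed.

Let mpsi := measurable_RePsi.

Lemma lt_EFin_of_gt0 (S : \bar R) : (0 < S)%E ->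
  exists2 s : R, 0 < s & forall t, t < s -> (t%:E < S)%E.
Proof.
case: S => [s||] //= S0; first by exists s.
by exists 1 => // t _; rewrite ltry.
Qed.

Lemma C2_C3 : C2 A N b -> C3 A N b.
Proof.
move=> [S [c [S0 c0 hc]]]; have [s s0 sS] := lt_EFin_of_gt0 S0.
apply: (C2half_C3 d0 gt hoo mpsi s0 c0) => t /andP[t0 ts].
apply: le_trans (hc t t0 (sS t ts)); apply: ge0_le_integral => //.
- apply/measurable_EFinP.
  apply: (measurableT_comp (continuous_measurable_fun (@continuous_expR R))).
  by apply: measurableT_comp => //; apply: measurable_funM.
- apply/measurable_EFinP.
  apply: (measurableT_comp (continuous_measurable_fun (@continuous_expR R))).
  by apply: measurableT_comp => //; apply: measurable_funM.
- move=> z _; rewrite lee_fin ler_expR lerN2 -mulrA ler_peMl ?ler1n//.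
  by rewrite mulr_ge0 ?(ltW t0)// RePsi_ge0.
Qed.

Lemma C1_C3 : C1 A N b Y -> C3 A N b.
Proof.
move=> [p [hp [S [c [S0 c0 hc]]]]]; have [s s0 sS] := lt_EFin_of_gt0 S0.
have c'0 : 0 < c * (2 * pi) ^+ d by rewrite mulr_gt0 ?exprn_gt0 ?mulr_gt0 ?pi_gt0.
apply: (C2half_C3 d0 gt hoo mpsi s0 c'0) => t /andP[t0 ts].
have [mp p0 dp _] := hp t t0.
pose M := c * hinv t^-1 ^- d.
have pM x : p t x <= M.
  rewrite -lee_fin; apply: le_trans (hc t t0 (sS t ts)).
  by apply: ereal_sup_ubound; exists x.
have M0 : 0 <= M by apply: le_trans (p0 0) (pM 0).
have := @bounded_density_phi2 R d (mu t) M M0.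
under eq_integral do rewrite phi2E ?(ltW t0)// -expRM_natl mulrN mulrA.
have -> : M * (2 * pi) ^+ d = c * (2 * pi) ^+ d * hinv t^-1 ^- d by rewrite /M; ring.
apply => B mB.
apply: (@le_trans _ _ (\int[leb]_(x in B) (p t x)%:E)%E); first by rewrite -(dp B mB).
apply: (@le_trans _ _ (\int[leb]_(x in B) (cst M%:E x))%E).
  apply: ge0_le_integral => //.
  - by move=> x _; rewrite lee_fin.
  - by apply: measurable_funTS; exact/measurable_EFinP.
  - by move=> x _; rewrite lee_fin.
by rewrite integral_cst.
Qed.

Let integral_exp_mono s t : 0 < s -> s <= t ->
  (\int[leb]_z (expR (- (t * psi z)))%:E <= \int[leb]_z (expR (- (s * psi z)))%:E)%E.
Proof.
move=> s0 st; apply: ge0_le_integral => //.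
- apply/measurable_EFinP.
  apply: (measurableT_comp (continuous_measurable_fun (@continuous_expR R))).
  by apply: measurableT_comp => //; apply: measurable_funM.
- apply/measurable_EFinP.
  apply: (measurableT_comp (continuous_measurable_fun (@continuous_expR R))).
  by apply: measurableT_comp => //; apply: measurable_funM.
- by move=> z _; rewrite lee_fin ler_expR lerN2 ler_wpM2r ?RePsi_ge0.
Qed.

Lemma C2_C1 : C2 A N b -> C1 A N b Y.
Proof.
move=> [S [c [S0 c0 hc]]]; have [s s0 sS] := lt_EFin_of_gt0 S0.
have iphi t : 0 < t -> leb.-integrable setT (EFin \o (fun z => Num.sqrt (phi2 (mu t) z))).
  move=> t0; have t0' := ltW t0; apply/integrableP; split.
    apply/measurable_EFinP.
    apply: (measurableT_comp (continuous_measurable_fun (@sqrt_continuous R))).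
    exact: measurable_phi2.
  under eq_integral do rewrite /= ger0_norm ?sqrtr_ge0// sqrt_phi2E//.
  (* (C2) speaks of small times only, whereas a density is required at every t > 0; the integral
     decreases in t, so a smaller time bounds it. *)
  pose r := Num.min t (s / 2).
  have r0 : 0 < r by rewrite lt_min t0 divr_gt0.
  have rs : r < s by rewrite gt_min; apply/orP; right; lra.
  have rt : r <= t by rewrite ge_min lexx.
  apply: le_lt_trans (integral_exp_mono r0 rt) _.
  by apply: le_lt_trans (hc r r0 (sS r rs)) _; rewrite ltry.
exists (fun t => inversion_density (mu t)); split.
  move=> t t0; have t0' := ltW t0; split.
  - exact: measurable_inversion_density (iphi t t0).
  - by move=> x; apply: inversion_density_ge0; exact: iphi.
  - by move=> B mB; apply: inversion_densityP => //; exact: iphi.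
  - move=> _ x; rewrite /cintegral.
    have E z : (cexp (- ('i * (dotv x z)%:C)) * cexp (- (t%:C * Psi A N b z)))%C =
        (chi (mu t) x 0 z +i* chi (mu t) x (- (pi / 2)) z)%C.
      rewrite cfE// cexp_Ni; simpc; rewrite !chiE dotvC sub0r cosN sinN.
      by congr (_ +i* _)%C; [ring|rewrite -opprD cosN sinN sinD cosD cos_pihalf sin_pihalf; ring].
    have Ere : \int[leb]_z complex.Re (cexp (- ('i * (dotv x z)%:C)) *
        cexp (- (t%:C * Psi A N b z)))%C = \int[leb]_z chi (mu t) x 0 z.
      by apply: eq_Rintegral => z _; rewrite (E z).
    have Eim : \int[leb]_z complex.Im (cexp (- ('i * (dotv x z)%:C)) *
        cexp (- (t%:C * Psi A N b z)))%C = 0.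
      rewrite -[RHS](@integral_chi_im R d (mu t) (iphi t t0) x).
      by apply: eq_Rintegral => z _; rewrite (E z).
    rewrite Ere Eim complexr0 /inversion_density.
    by rewrite rmorphM.
exists S, ((2 * pi) ^- d * c); split => //.
  by rewrite mulr_gt0// invr_gt0 exprn_gt0// mulr_gt0// pi_gt0.
move=> t t0 tS; apply: ge_ereal_sup => _ [x _ <-]; rewrite lee_fin.
apply: (le_trans (inversion_density_le (iphi t t0) x)).
rewrite /density_bound -mulrA ler_wpM2l//.
  by rewrite invr_ge0 exprn_ge0// mulr_ge0// pi_ge0.
rewrite -lee_fin EFin_Rintegral; last exact: iphi.
under eq_integral do rewrite sqrt_phi2E ?(ltW t0)//.
exact: hc.
Qed.

Lemma C3_C5_every : C3 A N b -> C5_every A N b.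
Proof.
move=> [S [c [al h3]]]; have [S0 /andP[c0 _] _ _ _] := h3.
exists (hfun_ext A N S)^-1%E; last first.
  move=> m m0; exists (C5_constant d m al c); first exact: C5_constant_gt0.
  exact: (C3_C5 d0 gt hoo mpsi m h3).
case: S S0 {h3} => [s||] //= S0; last by rewrite inve0 ltry.
rewrite lte_fin in S0; have hs := hfun_gt0 gt hoo S0.
by rewrite inver gt_eqF// lte_fin invr_gt0.
Qed.

Lemma C5_every_some : C5_every A N b -> C5_some A N b.
Proof. by move=> [S S0 h5]; exists S => //; exists 1%N => //; exact: h5. Qed.

Lemma conditions_tfae :
  [<-> C1 A N b Y; C2 A N b; C3 A N b; C4 A N b; C5_some A N b; C5_every A N b].
Proof.
(* The cycle is composed of C1 -> C3, C2 -> C3, C3 <-> C4, C3 -> C5_every -> C5_some -> C2 and C2 ->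
   C1. *)
tfae.
- by move=> /C1_C3/C3_C5_every/C5_every_some/(C5_some_C2 gt hoo mpsi).
- exact: C2_C3.
- exact: (C3_C4 gt).
- by move=> /(C4_C3 d0 gt)/C3_C5_every/C5_every_some.
- by move=> /(C5_some_C2 gt hoo mpsi)/C2_C3/C3_C5_every.
- by move=> /C5_every_some/(C5_some_C2 gt hoo mpsi)/C2_C1.
Qed.

End levy_characteristic.

Theorem proposition3p4 (R : realType) (d : nat) (hd : (0 < d)%N) :
  (forall (disp : measure_display) (T : measurableType disp)
      (P : probability T R) (Y : R -> {RV P >-> 'rV[R]_d}) (A : 'M[R]_d)
      (N : {measure set 'rV[R]_d -> \bar R}) (b : 'rV[R]_d),
    levy_process_with_triplet Y A N b ->
    hfun A N r @[r --> 0^'+] --> +oo ->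
    [<-> C1 A N b Y; C2 A N b; C3 A N b; C4 A N b;
         C5_some A N b; C5_every A N b]) /\
  (forall (m : nat) (alpha3 c3 : R), (0 < m)%N ->
    exists2 c5 : R, 0 < c5 &
      forall (disp : measure_display) (T : measurableType disp)
        (P : probability T R) (Y : R -> {RV P >-> 'rV[R]_d}) (A : 'M[R]_d)
        (N : {measure set 'rV[R]_d -> \bar R}) (b : 'rV[R]_d) (T3 : \bar R),
      levy_process_with_triplet Y A N b ->
      hfun A N r @[r --> 0^'+] --> +oo ->
      C3_with A N b T3 c3 alpha3 ->
      C5_with A N b (hfun_ext A N T3)^-1%E m c5).
Proof.
split; first by move=> disp T P Y A N b YL hoo; exact: conditions_tfae.
(* The constant is produced before (C3) is available; for c <= 0 any value will do, as (C3) then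
   contradicts 0 < c3. *)
move=> m al c m0; have [c0|c0] := ltP 0 c; last first.
  exists 1 => // disp T P Y A N b T3 _ _ [_ /andP[]].
  by rewrite ltNge c0.
exists (C5_constant d m al c); first exact: C5_constant_gt0.
move=> disp T P Y A N b T3 YL hoo h3.
have gt : generating_triplet A N by case: YL.
exact: (C3_C5 hd gt hoo (measurable_RePsi YL) m h3).
Qed.
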